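(* Let $p \ge 2$ be an integer, let $f, g_1, \ldots, g_l, h_1, \ldots, h_m \colon \mathbb{R}^n \to \mathbb{R}$ be definable $C^p$-functions, and assume that $$S := \{x \in \mathbb{R}^n \mid g_1(x) \ge 0, \ldots, g_l(x) \ge 0,\ h_1(x) = 0, \ldots, h_m(x) = 0\} \ne \emptyset.$$ Assume that $f$ is non-negative on $S$. If at every zero $x^* \in S$ of the restriction of $f$ to $S$ the set $S$ is regular and the strict complementarity and second-order sufficiency conditions hold, then there are definable $C^{p-2}$-functions $\phi_i, \psi_j \colon \mathbb{R}^n \to \mathbb{R}$ for $i = 0, \ldots, l$ and $j = 1, \ldots, m$, where each $\phi_i$ is a sum of squares of definable $C^{p-2}$-functions, such that on $\mathbb{R}^n$ $$f = \phi_0 + \sum_{i=1}^l \phi_i g_i + \sum_{j=1}^m \psi_j h_j.$$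
   Context: An o-minimal structure on $(\mathbb{R}, +, \cdot)$ is a sequence $\mathcal{D} = (\mathcal{D}_n)_{n \in \mathbb{N}}$ such that for each $n$: (a) $\mathcal{D}_n$ is a Boolean algebra of subsets of $\mathbb{R}^n$; (b) if $X \in \mathcal{D}_m$ and $Y \in \mathcal{D}_n$ then $X \times Y \in \mathcal{D}_{m+n}$; (c) if $X \in \mathcal{D}_{n+1}$ then $\pi(X) \in \mathcal{D}_n$, where $\pi \colon \mathbb{R}^{n+1} \to \mathbb{R}^n$ is the projection on the first $n$ coordinates; (d) $\mathcal{D}_n$ contains all algebraic subsets of $\mathbb{R}^n$; (e) each set in $\mathcal{D}_1$ is a finite union of points and intervals. Fix an o-minimal structure on $(\mathbb{R}, +, \cdot)$; ''definable'' means belonging to this structure, and a mapping is definable if its graph is a definable set. ''Sum of squares'' means a finite sum of squares; the functions being squared have the same domain as $\phi_i$. For $x \in S$, let $I(x) := \{i \in \{1, \ldots, l\} \mid g_i(x) = 0\}$ (the active constraint indices). $S$ is regular at $x \in S$ if the gradient vectors $\nabla g_i(x)$, $i \in I(x)$, and $\nabla h_j(x)$, $j = 1, \ldots, m$, are linearly independent. If $x^*$ is a local minimizer of the restriction of $f$ to $S$ and $S$ is regular at $x^*$, there exist unique Lagrange multipliers $\lambda_1, \ldots, \lambda_l, \nu_1, \ldots, \nu_m \in \mathbb{R}$ satisfying the KKT optimality conditions $$\nabla f(x^* ) - \sum_{i=1}^l \lambda_i \nabla g_i(x^* ) - \sum_{j=1}^m \nu_j \nabla h_j(x^* ) = 0,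 \qquad \lambda_i g_i(x^* ) = 0,\ \lambda_i \ge 0 \ \text{ for } i = 1, \ldots, l.$$ (A zero in $S$ of a function $f$ that is non-negative on $S$ is such a minimizer.) With these multipliers: The strict complementarity condition holds at $x^*$ if $\lambda_i + g_i(x^* ) > 0$ for all $i = 1, \ldots, l$ (equivalently, $\lambda_i > 0$ for every $i \in I(x^* )$). Let $L(x) := f(x) - \sum_{i \in I(x^* )} \lambda_i g_i(x) - \sum_{j=1}^m \nu_j h_j(x)$ and $$T_{x^*}S := \{v \in \mathbb{R}^n \mid \langle v, \nabla g_i(x^* ) \rangle = 0 \text{ for } i \in I(x^* ), \ \langle v, \nabla h_j(x^* ) \rangle = 0 \text{ for } j = 1, \ldots, m\}.$$ The second-order sufficiency condition holds at $x^*$ if $v^T \nabla^2 L(x^* ) v > 0$ for all $v \in T_{x^*}S \setminus \{0\}$, where $\nabla^2 L(x^* )$ is the Hessian matrix of $L$ at $x^*$. *)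

(* Defs.v *)
From HB Require Import structures.
From mathcomp Require Import all_boot all_order all_algebra.
From mathcomp Require Import all_classical all_reals topology normedtype derive.
(* Not imported: its notations clash with those of mathcomp-analysis. *)
From mathcomp Require mpoly.

Set Implicit Arguments.
Unset Strict Implicit.
Unset Printing Implicit Defensive.

Import numFieldNormedType.Exports.
Import Order.TTheory GRing.Theory Num.Theory.

Local Open Scope classical_set_scope.
Local Open Scope ring_scope.

Section OMinimal.
Variable R : realType.

Definition prod_set m n (X : set 'rV[R]_m) (Y : set 'rV[R]_n) :
    set 'rV[R]_(m + n) :=
  [set z | X (lsubmx z) /\ Y (rsubmx z)].

Definition proj_set n (X : set 'rV[R]_(n + 1)) : set 'rV[R]_n :=
  [set lsubmx z | z in X].

Definition algebraic_set n (X : set 'rV[R]_n) : Prop :=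
  exists (k : nat) (q : 'I_k -> mpoly.mpoly n R),
    X = [set x | forall a, mpoly.meval (fun i => x 0 i) (q a) = 0].

Definition finite_union_points_intervals (X : set 'rV[R]_1) : Prop :=
  exists (s : seq R) (I : seq (interval R)),
    X = [set x | x 0 0 \in s \/ exists2 i, i \in I & x 0 0 \in i].

Record o_minimal (D : forall n, set (set 'rV[R]_n)) : Prop := OMinimal {
  om_set0 : forall n, D n set0;
  om_setU : forall n (X Y : set 'rV[R]_n), D n X -> D n Y -> D n (X `|` Y);
  om_setC : forall n (X : set 'rV[R]_n), D n X -> D n (~` X);
  om_prod : forall m n (X : set 'rV[R]_m) (Y : set 'rV[R]_n),
    D m X -> D n Y -> D (m + n)%N (prod_set X Y);
  om_proj : forall n (X : set 'rV[R]_(n + 1)),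
    D (n + 1)%N X -> D n (proj_set X);
  om_alg : forall n (X : set 'rV[R]_n), algebraic_set X -> D n X;
  om_dim1 : forall X : set 'rV[R]_1, D 1%N X -> finite_union_points_intervals X
}.

Definition definable_fun (D : forall n, set (set 'rV[R]_n)) n
    (f : 'rV[R]_n -> R) : Prop :=
  D (n + 1)%N [set row_mx x (f x)%:M | x in [set: 'rV[R]_n]].

End OMinimal.

Section Differential.
Variables (R : realType) (n : nat).
Implicit Types (f : 'rV[R]_n -> R) (x : 'rV[R]_n).

Definition partial (i : 'I_n) f : 'rV[R]_n -> R :=
  fun x => 'D_(delta_mx 0 i) f x.

(* [Ck k f]: all iterated partial derivatives of f of order at most k exist
   and are continuous on the whole space. *)
Fixpoint Ck (k : nat) f : Prop :=
  continuous f /\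
  if k is k'.+1 then
    forall i : 'I_n,
      (forall x, derivable f x (delta_mx 0 i)) /\ Ck k' (partial i f)
  else True.

Definition gradient f x : 'rV[R]_n := \row_i partial i f x.

Definition hessian f x : 'M[R]_n := \matrix_(i, j) partial i (partial j f) x.

Definition dotprod (u v : 'rV[R]_n) : R := \sum_i u 0 i * v 0 i.

End Differential.

Section Optimality.
Variables (R : realType) (n l m : nat).
Variables (f : 'rV[R]_n -> R).
Variables (g : 'I_l -> 'rV[R]_n -> R) (h : 'I_m -> 'rV[R]_n -> R).

Definition feasible : set 'rV[R]_n :=
  [set x | (forall i, 0 <= g i x) /\ (forall j, h j x = 0)].

Definition active (x : 'rV[R]_n) : pred 'I_l := [pred i | g i x == 0].

(* The gradients are taken as a family: a repeated vector is dependent. *)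
Definition regular_at (x : 'rV[R]_n) : bool :=
  free ([seq gradient (g i) x | i <- enum (active x)] ++
        [seq gradient (h j) x | j <- enum 'I_m]).

Definition KKT (x : 'rV[R]_n) (lam : 'I_l -> R) (nu : 'I_m -> R) : Prop :=
  gradient f x - \sum_i lam i *: gradient (g i) x
    - \sum_j nu j *: gradient (h j) x = 0 /\
  (forall i, lam i * g i x = 0 /\ 0 <= lam i).

Definition strict_complementarity (x : 'rV[R]_n) (lam : 'I_l -> R) : Prop :=
  forall i, 0 < lam i + g i x.

Definition lagrangian (xs : 'rV[R]_n) (lam : 'I_l -> R) (nu : 'I_m -> R) :
    'rV[R]_n -> R :=
  fun x => f x - \sum_(i | active xs i) lam i * g i x - \sum_j nu j * h j x.

Definition tangent_space (x : 'rV[R]_n) : set 'rV[R]_n :=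
  [set v | (forall i, active x i -> dotprod v (gradient (g i) x) = 0) /\
           (forall j, dotprod v (gradient (h j) x) = 0)].

Definition second_order_sufficiency (x : 'rV[R]_n)
    (lam : 'I_l -> R) (nu : 'I_m -> R) : Prop :=
  forall v, tangent_space x v -> v != 0 ->
    0 < (v *m hessian (lagrangian x lam nu) x *m v^T) 0 0.

(* At a regular local minimizer of f on the feasible set, Lagrange multipliers
   exist and are unique, so quantifying over all of them is a way of naming
   "the" multipliers. *)
Definition nondegenerate_at (x : 'rV[R]_n) : Prop :=
  regular_at x /\
  (forall lam nu, KKT x lam nu ->
     strict_complementarity x lam /\ second_order_sufficiency x lam nu).

End Optimality.

Definition sum_of_squares_in (R : realType) (T : Type) (P : set (T -> R))
    (phi : T -> R) : Prop :=
  exists (N : nat) (q : 'I_N -> T -> R),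
    (forall k, P (q k)) /\ (forall x, phi x = \sum_k q k x ^+ 2).

(* Main.v *)
Require Import Defs.
From HB Require Import structures.
From mathcomp Require Import all_boot all_order all_algebra.
From mathcomp Require Import all_classical all_reals topology normedtype derive.
From mathcomp Require Import realfun ereal measure lebesgue_measure.
From mathcomp Require Import ring lra.
From mathcomp Require mpoly.
Import -(notations) mpoly.

Set Implicit Arguments.
Unset Strict Implicit.
Unset Printing Implicit Defensive.

Import numFieldNormedType.Exports.
Import Order.TTheory GRing.Theory Num.Theory.

Local Open Scope classical_set_scope.
Local Open Scope ring_scope.

(** Write S for the feasible set. The theorem combines a representation near each
zero of f on S, a representation away from these zeros, and a gluing.

Near a zero z. Since z minimizes f on S and S is regular at z, multipliers lam,
nu exist ([KKT_exists]); let L be the Lagrangian and u_s the active constraints.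
The function F = L + M sum_s u_s^2 vanishes at z together with its gradient, and
for M large its Hessian at z is positive definite on the whole space, because
that of L is so on the common kernel of the gradients of the u_s
([positive_definite_penalty]). Two applications of Hadamard's lemma give
F(x) = sum_ij B_ij(x) (x - z)_i (x - z)_j with B(z) half the Hessian
([quadratic_representation]); this is where two orders of differentiability are
lost. Completing squares with pivots that stay positive near z turns F into a
sum of squares ([sum_of_squares_quadratic]). Finally
f = F + sum_i (lam_i - M g_i) g_i + sum_j (nu_j - M h_j) h_j, and the
coefficients lam_i - M g_i of the active g_i are positive near z by strict
complementarity, hence are squares ([local_representation]). The local identity
also shows that f vanishes on S near z only at z.

The coefficients have to be definable, so Hadamard's lemma cannot be proved by
integrating derivatives. The coefficients are divided differences, extended to
the hyperplane x_i = z_i by a partial derivative. A derivative of such a quotient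
involves a divided difference of higher order, and all orders are treated
together by Taylor's formula ([Ck_divdiff]).

The zeros are finite in number. A set of isolated points is countable; its
coordinate projections are definable, hence finite unions of points and
intervals, and being countable they are finite ([isolated_finite]).

Away from the zeros. Let w be the sum of high odd powers of the negative parts of
the g_i and of the squares of the h_j, a smooth nonnegative function with zero
set S. Where (f, w) avoids the half-line f <= 0, w = 0, the weight
w / (sqrt (f^2 + w^2) + f) is smooth and adding this multiple of w to f gives
sqrt (f^2 + w^2) > 0 ([penalty_identity]). A slightly larger weight gives
f = (positive) - M w with M > 0. An odd power of the negative part of g_i is -g_i
times an even power, so - M w is a combination of the g_i and h_j of the required
form ([representation_off_zeros]).

Gluing. Multiplying a representation of f by the square of a definable cutoff
function that removes its singularities makes it global, and f is recovered on
dividing by the sum of these squares. *)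

(** * Derivatives as limits of difference quotients *)

Lemma is_derive_limP (R : realType) (V : normedModType R) (f : V -> R) x v l :
  is_derive x v f l <-> t^-1 * (f (t *: v + x) - f x) @[t --> 0^'] --> l.
Proof.
split=> [[df <-]|fl]; first exact: df.
by split; [apply/cvg_ex; exists l|exact: cvg_lim fl].
Qed.

Lemma is_derive_epsP (R : realType) (V : normedModType R) (f : V -> R) x v l :
  is_derive x v f l <-> forall e, 0 < e -> exists2 d, 0 < d & forall t,
    t != 0 -> `|t| < d -> `|l - t^-1 * (f (t *: v + x) - f x)| < e.
Proof.
rewrite is_derive_limP; split.
  move=> /cvgrPdist_lt H e /H[d /= d0 Hd]; exists d => // t t0 td.
  by apply: Hd => //=; rewrite sub0r normrN.
move=> H; apply/cvgrPdist_lt => e /H[d d0 Hd]; exists d => //= t.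
by rewrite /= sub0r normrN => td t0; exact: Hd.
Qed.

(** * Definable sets and functions *)

Section Definability.
Variables (R : realType) (D : forall n, set (set 'rV[R]_n)).
Hypothesis hD : o_minimal D.

Lemma defset_ext n (X Y : set 'rV[R]_n) :
  (forall x, X x <-> Y x) -> D X -> D Y.
Proof. by move=> e; have -> : X = Y by apply/seteqP; split=> x /e. Qed.

Lemma defset_setT n : D [set: 'rV[R]_n].
Proof. by rewrite -setC0; apply: om_setC hD _ _ (om_set0 hD n). Qed.

Lemma defset_not n (P : 'rV[R]_n -> Prop) : D [set x | P x] -> D [set x | ~ P x].
Proof. by move=> DP; apply: om_setC hD _ _ DP. Qed.

Lemma defset_or n (P Q : 'rV[R]_n -> Prop) :
  D [set x | P x] -> D [set x | Q x] -> D [set x | P x \/ Q x].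
Proof. by move=> DP DQ; apply: om_setU hD _ _ _ DP DQ. Qed.

Lemma defset_and n (P Q : 'rV[R]_n -> Prop) :
  D [set x | P x] -> D [set x | Q x] -> D [set x | P x /\ Q x].
Proof.
move=> /defset_not DP /defset_not DQ.
apply: defset_ext (defset_not (defset_or DP DQ)) => x /=.
by rewrite not_orE !notK.
Qed.

Lemma defset_imp n (P Q : 'rV[R]_n -> Prop) :
  D [set x | P x] -> D [set x | Q x] -> D [set x | P x -> Q x].
Proof.
move=> /defset_not DP DQ; apply: defset_ext (defset_or DP DQ) => x /=.
by rewrite implyE.
Qed.

Lemma defset_fin_forall n k (P : 'I_k -> 'rV[R]_n -> Prop) :
  (forall i, D [set x | P i x]) -> D [set x | forall i, P i x].
Proof.
move=> DP.
suff: forall s : seq 'I_k, D [set x | forall i, i \in s -> P i x].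
  move=> /(_ (enum 'I_k)); apply: defset_ext => x /=.
  by split=> H i *; apply: H; rewrite mem_enum.
elim=> [|a s IH].
  by apply: defset_ext (@defset_setT n) => x.
apply: defset_ext (defset_and (DP a) IH) => x /=; split.
  by move=> [H1 H2] i; rewrite inE => /orP[/eqP->|/H2].
by move=> H; split=> [|i ia]; apply: H; rewrite inE ?eqxx ?ia ?orbT.
Qed.

Lemma defset_castmx n n' (e : n = n') (X : set 'rV[R]_n') :
  D X -> D [set x | X (castmx (erefl, e) x)].
Proof. by case: n' / e X => X; apply: defset_ext => x /=; rewrite castmx_id. Qed.

(** Quantification over a vector is projection along one coordinate at a time. *)
Lemma defset_exists_rV m n (X : set 'rV[R]_(n + m)) :
  D X -> D [set x | exists y, X (row_mx x y)].
Proof.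
elim: m n X => [|m IH] n X DX.
  have := defset_castmx (esym (addn0 n)) DX.
  apply: defset_ext => x /=.
  have e y : row_mx x y = castmx (erefl, esym (addn0 n)) x.
    apply/rowP => k; rewrite castmxE /= -(row_mxEl x y); congr (row_mx _ _ _ _).
      by rewrite !ord1.
    exact: val_inj.
  by split=> [Xx|[y]]; [exists 0; rewrite e|rewrite e].
have e : (n + 1 + m = n + m.+1)%N by rewrite -addnA.
have /IH/(om_proj hD) := defset_castmx e DX.
apply: defset_ext => x /=.
have E t y : castmx (erefl, e) (row_mx (row_mx x t) y)
    = row_mx x (row_mx t y : 'rV_m.+1).
  by rewrite (eq_irrelevance e (esym (addnA n 1 m))); apply: esym; exact: (@row_mxA _ 1 n 1 m x t y).
split=> [[z [y Xz] zx]|[y Xy]].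
  by exists (row_mx (rsubmx z) y); rewrite -E -zx hsubmxK.
exists (row_mx x (@lsubmx _ _ 1 m y)); last by rewrite row_mxKl.
by exists (@rsubmx _ _ 1 m y); rewrite /= E hsubmxK.
Qed.

Lemma defset_exists n (P : 'rV[R]_n -> R -> Prop) :
  D [set z : 'rV_(n + 1) | P (lsubmx z) (rsubmx z 0 0)] ->
  D [set x | exists t, P x t].
Proof.
move=> /(om_proj hD); apply: defset_ext => x; split=> [[z Pz <-]|[t Pt]].
  by exists (rsubmx z 0 0).
by exists (row_mx x t%:M); rewrite /= ?row_mxKl // row_mxKr mxE eqxx.
Qed.

Lemma defset_forall n (P : 'rV[R]_n -> R -> Prop) :
  D [set z : 'rV_(n + 1) | P (lsubmx z) (rsubmx z 0 0)] ->
  D [set x | forall t, P x t].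
Proof.
move=> /defset_not/(@defset_exists _ (fun x t => ~ P x t))/defset_not.
apply: defset_ext => x /=; split=> [H t|H [t /(_ (H t))//]].
by apply: contrapT => nP; apply: H; exists t.
Qed.

Lemma defset_zero n (q : mpoly.mpoly n R) :
  D [set x | mpoly.meval (fun i => x 0 i) q = 0].
Proof.
apply: (om_alg hD); exists 1%N, (fun=> q); apply/seteqP; split=> x /=.
  by [].
by apply; exact: ord0.
Qed.

(** Selecting and repeating coordinates is an algebraic operation, so the preimage
is a projection of the product of its algebraic graph with X. *)
Lemma defset_coords m n (s : 'I_m -> 'I_n) (X : set 'rV[R]_m) :
  D X -> D [set x | X (\row_k x 0 (s k))].
Proof.
move=> DX; have DTX := om_prod hD (@defset_setT n) DX.
have Dk k : D [set z : 'rV[R]_(n + m) | z 0 (rshift n k) = z 0 (lshift m (s k))].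
  have := defset_zero (mpoly.mpolyX R (mpoly.mnm1 (rshift n k))
    - mpoly.mpolyX R (mpoly.mnm1 (lshift m (s k))) : mpoly.mpoly (n + m) R).
  apply: defset_ext => z /=; rewrite mpoly.mevalB !mpoly.mevalXU.
  by split=> [/eqP|->]; rewrite ?subrr // subr_eq0 => /eqP.
have := defset_exists_rV (defset_and DTX (defset_fin_forall Dk)).
apply: defset_ext => x /=; split.
  move=> [y [[_]]]; rewrite row_mxKr => Xy e; congr X: Xy.
  by apply/rowP => k; rewrite mxE; have := e k; rewrite row_mxEr row_mxEl.
move=> Xx; exists (\row_k x 0 (s k)); split; first by rewrite row_mxKr.
by move=> k; rewrite row_mxEr row_mxEl mxE.
Qed.

(** Graphs as first-order formulas in a point and a value. *)
Lemma definable_funE n (f : 'rV[R]_n -> R) :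
  definable_fun D f <->
  D [set z : 'rV_(n + 1) | rsubmx z 0 0 = f (lsubmx z)].
Proof.
rewrite /definable_fun; set A := (X in D X <-> _); set B := (X in _ <-> D X).
suff -> : A = B by [].
rewrite /A /B; apply/seteqP; split=> z /=.
  by move=> [x _ <-]; rewrite row_mxKl row_mxKr mxE eqxx.
move=> e; exists (lsubmx z) => //; rewrite -[RHS]hsubmxK -e; congr row_mx.
by apply/rowP => i; rewrite !ord1 mxE eqxx.
Qed.

Lemma definable_fun_graph n (f : 'rV[R]_n -> R) (P : 'rV[R]_n -> R -> Prop) :
  (forall x t, P x t <-> t = f x) ->
  D [set z : 'rV_(n + 1) | P (lsubmx z) (rsubmx z 0 0)] -> definable_fun D f.
Proof.
by move=> Pf DP; apply/definable_funE; apply: defset_ext DP => z; rewrite /= Pf.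
Qed.

Definition definable_map m n (F : 'rV[R]_n -> 'rV[R]_m) :=
  forall k, definable_fun D (fun x => F x 0 k).

(** The preimage is the set of x for which some y in X satisfies the formulas
y_k = F_k(x). *)
Lemma defset_map m n (F : 'rV[R]_n -> 'rV[R]_m) (X : set 'rV[R]_m) :
  definable_map F -> D X -> D [set x | X (F x)].
Proof.
move=> DF DX; have DTX := om_prod hD (@defset_setT n) DX.
have Dk k : D [set z : 'rV[R]_(n + m) | z 0 (rshift n k) = F (lsubmx z) 0 k].
  pose s (i : 'I_(n + 1)) : 'I_(n + m) :=
    match fintype.split i with inl a => lshift m a | inr _ => rshift n k end.
  have /definable_funE/(defset_coords s) := DF k.
  apply: defset_ext => z /=; rewrite !mxE /s.
  have -> : fintype.split (rshift n (0 : 'I_1)) = inr 0.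
    by rewrite -[rshift _ _]/(unsplit (inr _)) unsplitK.
  set u := lsubmx _; suff -> : u = lsubmx z by split.
  apply/rowP => j; rewrite !mxE.
  by rewrite -[lshift 1 _]/(unsplit (inl _)) unsplitK.
have := defset_exists_rV (defset_and DTX (defset_fin_forall Dk)).
apply: defset_ext => x /=; split.
  move=> [y [[_]]]; rewrite row_mxKr => Xy e; congr X: Xy.
  by apply/rowP => k; have := e k; rewrite row_mxEr row_mxKl.
move=> Xx; exists (F x); split; first by rewrite row_mxKr.
by move=> k; rewrite row_mxEr row_mxKl.
Qed.

Lemma definable_coord n (i : 'I_n) : definable_fun D (fun x => x 0 i).
Proof.
apply/definable_funE.
have := defset_zero (mpoly.mpolyX R (mpoly.mnm1 (rshift n (0 : 'I_1)))
    - mpoly.mpolyX R (mpoly.mnm1 (lshift 1 i)) : mpoly.mpoly (n + 1) R).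
apply: defset_ext => z /=; rewrite mpoly.mevalB !mpoly.mevalXU !mxE.
by split=> [/eqP|->]; rewrite ?subrr // subr_eq0 => /eqP.
Qed.

Lemma definable_cst n (c : R) : definable_fun D (fun _ : 'rV[R]_n => c).
Proof.
apply/definable_funE.
have := defset_zero (mpoly.mpolyX R (mpoly.mnm1 (rshift n (0 : 'I_1)))
    - mpoly.mpolyC (n + 1) c : mpoly.mpoly (n + 1) R).
apply: defset_ext => z /=; rewrite mpoly.mevalB mpoly.mevalXU mpoly.mevalC !mxE.
by split=> [/eqP|->]; rewrite ?subrr // subr_eq0 => /eqP.
Qed.

Lemma definable_lsubmx m n : definable_map (@lsubmx R 1 m n).
Proof.
move=> k; have -> : (fun x : 'rV[R]_(m + n) => lsubmx x 0 k) = fun x => x 0 (lshift n k).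
  by apply/funext => x; rewrite mxE.
exact: definable_coord.
Qed.

Lemma definable_comp m n (f : 'rV[R]_m -> R) (F : 'rV[R]_n -> 'rV[R]_m) :
  definable_fun D f -> definable_map F -> definable_fun D (fun x => f (F x)).
Proof.
move=> /definable_funE Df DF; apply/definable_funE.
pose G (z : 'rV[R]_(n + 1)) : 'rV[R]_(m + 1) := row_mx (F (lsubmx z)) (rsubmx z).
suff /(@defset_map _ _ G)/(_ Df) : definable_map G.
  by apply: defset_ext => z /=; rewrite /G row_mxKl row_mxKr.
move=> k; rewrite /G; case: (splitP k) => j ej.
  rewrite (_ : k = lshift 1 j); last exact: val_inj.
  under [X in definable_fun D X]funext do rewrite row_mxEl.
  have /definable_funE DFj := DF j; apply/definable_funE.
  pose s (i : 'I_(n + 1)) : 'I_(n + 1 + 1) :=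
    match fintype.split i with inl a => lshift 1 (lshift 1 a) | inr b => rshift (n + 1) b end.
  have := defset_coords s DFj.
  apply: defset_ext => z /=; rewrite !mxE /s.
  have -> : fintype.split (rshift n (0 : 'I_1)) = inr 0.
    by rewrite -[rshift _ _]/(unsplit (inr _)) unsplitK.
  set u := lsubmx _; suff -> : u = lsubmx (lsubmx z) by split.
  apply/rowP => a; rewrite !mxE.
  by rewrite -[lshift 1 _]/(unsplit (inl _)) unsplitK.
rewrite (_ : k = rshift m j); last exact: val_inj.
under [X in definable_fun D X]funext do rewrite row_mxEr mxE.
exact: definable_coord.
Qed.

Lemma definable_last n : definable_fun D (fun z : 'rV[R]_(n + 1) => rsubmx z 0 0).
Proof.
under [X in definable_fun D X]funext do rewrite mxE.
exact: definable_coord.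
Qed.

Lemma definable_lsub n (f : 'rV[R]_n -> R) :
  definable_fun D f -> definable_fun D (fun z : 'rV[R]_(n + 1) => f (lsubmx z)).
Proof. by move=> Df; apply: definable_comp Df (@definable_lsubmx _ _). Qed.

Lemma definable_op2 n (op : R -> R -> R) (f g : 'rV[R]_n -> R) :
  definable_fun D (fun u : 'rV[R]_2 => op (u 0 0) (u 0 1)) ->
  definable_fun D f -> definable_fun D g ->
  definable_fun D (fun x => op (f x) (g x)).
Proof.
move=> Dop Df Dg.
pose F (x : 'rV[R]_n) : 'rV[R]_2 := \row_k (if k == 0 then f x else g x).
have -> : (fun x => op (f x) (g x)) = fun x => op (F x 0 0) (F x 0 1).
  by apply/funext => x; rewrite !mxE.
apply: (definable_comp Dop) => k.
under [X in definable_fun D X]funext do rewrite mxE.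
by case: (k == 0).
Qed.

Lemma definableD n (f g : 'rV[R]_n -> R) :
  definable_fun D f -> definable_fun D g -> definable_fun D (fun x => f x + g x).
Proof.
apply: (@definable_op2 _ +%R); apply/definable_funE.
have := defset_zero (mpoly.mpolyX R (mpoly.mnm1 (rshift 2 (0 : 'I_1)))
  - (mpoly.mpolyX R (mpoly.mnm1 (lshift 1 (0 : 'I_2))) + mpoly.mpolyX R (mpoly.mnm1 (lshift 1 (1 : 'I_2)))) : mpoly.mpoly (2 + 1) R).
apply: defset_ext => z /=.
rewrite mpoly.mevalB mpoly.mevalD !mpoly.mevalXU !mxE.
by split=> [/eqP|->]; rewrite ?subrr // subr_eq0 => /eqP.
Qed.

Lemma definableM n (f g : 'rV[R]_n -> R) :
  definable_fun D f -> definable_fun D g -> definable_fun D (fun x => f x * g x).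
Proof.
apply: (@definable_op2 _ *%R); apply/definable_funE.
have := defset_zero (mpoly.mpolyX R (mpoly.mnm1 (rshift 2 (0 : 'I_1)))
  - (mpoly.mpolyX R (mpoly.mnm1 (lshift 1 (0 : 'I_2))) * mpoly.mpolyX R (mpoly.mnm1 (lshift 1 (1 : 'I_2)))) : mpoly.mpoly (2 + 1) R).
apply: defset_ext => z /=.
rewrite mpoly.mevalB mpoly.mevalM !mpoly.mevalXU !mxE.
by split=> [/eqP|->]; rewrite ?subrr // subr_eq0 => /eqP.
Qed.

Lemma definableN n (f : 'rV[R]_n -> R) :
  definable_fun D f -> definable_fun D (fun x => - f x).
Proof.
move=> Df; have := definableM (@definable_cst n (-1)) Df.
by under [X in definable_fun D X]funext do rewrite mulN1r.
Qed.

Lemma definableB n (f g : 'rV[R]_n -> R) :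
  definable_fun D f -> definable_fun D g -> definable_fun D (fun x => f x - g x).
Proof. by move=> Df /definableN; exact: definableD. Qed.

Lemma definableX n (f : 'rV[R]_n -> R) k :
  definable_fun D f -> definable_fun D (fun x => f x ^+ k).
Proof.
move=> Df; elim: k => [|k IH].
  by under [X in definable_fun D X]funext do rewrite expr0; exact: definable_cst.
by under [X in definable_fun D X]funext do rewrite exprS; exact: definableM.
Qed.

Lemma definable_sum n (I : Type) (s : seq I) (P : pred I) (f : I -> 'rV[R]_n -> R) :
  (forall i, P i -> definable_fun D (f i)) ->
  definable_fun D (fun x => \sum_(i <- s | P i) f i x).
Proof.
move=> Df; elim: s => [|a s IH].
  by under [X in definable_fun D X]funext do rewrite big_nil; exact: definable_cst.
under [X in definable_fun D X]funext do rewrite big_cons.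
by case Pa: (P a) => //; apply: definableD => //; exact: Df.
Qed.

Lemma definable_prod n (I : Type) (s : seq I) (P : pred I) (f : I -> 'rV[R]_n -> R) :
  (forall i, P i -> definable_fun D (f i)) ->
  definable_fun D (fun x => \prod_(i <- s | P i) f i x).
Proof.
move=> Df; elim: s => [|a s IH].
  by under [X in definable_fun D X]funext do rewrite big_nil; exact: definable_cst.
under [X in definable_fun D X]funext do rewrite big_cons.
by case Pa: (P a) => //; apply: definableM => //; exact: Df.
Qed.

Lemma defset_eq0 n (f : 'rV[R]_n -> R) :
  definable_fun D f -> D [set x | f x = 0].
Proof.
move=> Df; pose F (x : 'rV[R]_n) : 'rV[R]_1 := \row__ f x.
have := @defset_map _ _ F _ _ (defset_zero (mpoly.mpolyX R (mpoly.mnm1 (0 : 'I_1)))).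
have DF : definable_map F.
  by move=> k; under [X in definable_fun D X]funext do rewrite mxE.
by move=> /(_ DF); apply: defset_ext => x /=; rewrite mpoly.mevalXU mxE.
Qed.

Lemma defset_eq n (f g : 'rV[R]_n -> R) :
  definable_fun D f -> definable_fun D g -> D [set x | f x = g x].
Proof.
move=> Df Dg; apply: defset_ext (defset_eq0 (definableB Df Dg)) => x /=.
by split=> [/eqP|->]; rewrite ?subrr // subr_eq0 => /eqP.
Qed.

(** Nonnegative numbers are the squares, so the order is definable. *)
Lemma defset_le n (f g : 'rV[R]_n -> R) :
  definable_fun D f -> definable_fun D g -> D [set x | f x <= g x].
Proof.
move=> Df Dg.
have := @defset_exists n (fun x t => g x - f x = t ^+ 2).
have H : D [set z : 'rV[R]_(n + 1) |
    g (lsubmx z) - f (lsubmx z) = rsubmx z 0 0 ^+ 2].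
  apply: defset_eq; last exact/definableX/definable_last.
  by apply: definableB; exact: definable_lsub.
move=> /(_ H); apply: defset_ext => x /=; rewrite -subr_ge0.
by split=> [[t ->]|h]; [rewrite sqr_ge0|exists (Num.sqrt (g x - f x)); rewrite sqr_sqrtr].
Qed.

Lemma defset_lt n (f g : 'rV[R]_n -> R) :
  definable_fun D f -> definable_fun D g -> D [set x | f x < g x].
Proof.
move=> Df Dg; apply: defset_ext (defset_not (defset_le Dg Df)) => x /=.
by rewrite ltNge; split => /negP.
Qed.

Lemma definable_if n (P : 'rV[R]_n -> bool) (f g : 'rV[R]_n -> R) :
  D [set x | P x] -> definable_fun D f -> definable_fun D g ->
  definable_fun D (fun x => if P x then f x else g x).
Proof.
move=> DP Df Dg.
pose Q (x : 'rV[R]_n) t := (P x -> t = f x) /\ (~ P x -> t = g x).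
apply: (@definable_fun_graph _ _ Q) => [x t|].
  rewrite /Q; case: (P x); split=> [[h1 h2]|->]; first [exact: h1|exact: h2|by split].
have DPl : D [set z : 'rV[R]_(n + 1) | P (lsubmx z)].
  exact: defset_map (@definable_lsubmx _ _) DP.
apply: defset_and; apply: defset_imp.
- exact: DPl.
- by apply: defset_eq; [exact: definable_last|exact: definable_lsub].
- exact: defset_not.
- by apply: defset_eq; [exact: definable_last|exact: definable_lsub].
Qed.

Lemma definable_max0 n (f : 'rV[R]_n -> R) :
  definable_fun D f -> definable_fun D (fun x => Num.max 0 (f x)).
Proof.
move=> Df; apply: definable_if => //; last exact: definable_cst.
by apply: defset_lt => //; exact: definable_cst.
Qed.

Lemma definableV n (f : 'rV[R]_n -> R) :
  definable_fun D f -> definable_fun D (fun x => (f x)^-1).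
Proof.
move=> Df.
pose Q (x : 'rV[R]_n) t := (f x = 0 -> t = 0) /\ (f x <> 0 -> t * f x = 1).
apply: (@definable_fun_graph _ _ Q) => [x t|].
  rewrite /Q; have [->|f0] := eqVneq (f x) 0.
    by rewrite invr0; split=> [[/(_ erefl)]|->].
  split=> [[_ h]|->].
    by apply: (mulIf f0); rewrite mulVf // h //; exact/eqP.
  by split=> [e|_]; rewrite ?mulVf //; rewrite e eqxx in f0.
have D0 m : definable_fun D (fun _ : 'rV[R]_m => 0) by exact: definable_cst.
have DL := @definable_last n; have Dfl := definable_lsub Df.
by apply: defset_and; apply: defset_imp; do ?apply: defset_not;
  apply: defset_eq => //; [exact: definableM|exact: definable_cst].
Qed.

Lemma definable_sqrt n (f : 'rV[R]_n -> R) :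
  definable_fun D f -> definable_fun D (fun x => Num.sqrt (f x)).
Proof.
move=> Df.
pose Q (x : 'rV[R]_n) t := 0 <= t /\ t ^+ 2 = Num.max 0 (f x).
apply: (@definable_fun_graph _ _ Q) => [x t|].
  rewrite /Q; split=> [[t0]|->].
    have [f0|f0] := leP 0 (f x).
      by move=> <-; rewrite sqrtr_sqr ger0_norm.
    move=> /eqP; rewrite sqrf_eq0 => /eqP ->.
    by rewrite ltr0_sqrtr.
  split; first exact: sqrtr_ge0.
  have [f0|f0] := leP 0 (f x); first by rewrite sqr_sqrtr.
  by rewrite ltr0_sqrtr // expr0n.
have DL := @definable_last n; have Dfl := definable_lsub Df.
apply: defset_and; first by apply: defset_le => //; exact: definable_cst.
by apply: defset_eq; [exact: definableX|exact: definable_max0].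
Qed.

(** The epsilon-delta definition of a partial derivative is a first-order
formula over the graph of the function. *)
Lemma definable_partial n (i : 'I_n) (f : 'rV[R]_n -> R) :
  (forall x, derivable f x (delta_mx 0 i)) ->
  definable_fun D f -> definable_fun D (partial i f).
Proof.
move=> df Df.
pose Q (x : 'rV[R]_n) (y : R) := forall e, 0 < e -> exists d, 0 < d /\ forall t,
  (t <> 0 /\ t ^+ 2 < d) ->
  (y - t^-1 * (f (t *: delta_mx 0 i + x) - f x)) ^+ 2 < e.
pose slope x y t := y - t^-1 * (f (t *: delta_mx 0 i + x) - f x).
have sqr_lt (u w : R) : 0 < w -> (u ^+ 2 < w) = (`|u| < Num.sqrt w).
  move=> w0; rewrite -[RHS](@ltr_pXn2r _ 2) ?nnegrE ?sqrtr_ge0 // sqr_sqrtr ?ltW //.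
  by rewrite real_normK ?num_real.
apply: (@definable_fun_graph _ _ Q) => [x y|].
  have -> : y = partial i f x <-> is_derive x (delta_mx 0 i) f y.
    by split=> [->|[_ <-]] //; exact: derivableP.
  rewrite is_derive_epsP; split=> H e e0.
    have [d [d0 Hd]] := H _ (exprn_gt0 2 e0).
    exists (Num.sqrt d); first by rewrite sqrtr_gt0.
    move=> t t0 td; have := Hd t.
    rewrite !sqr_lt ?exprn_gt0 // sqrtr_sqr (gtr0_norm e0); apply.
    by split=> //; exact/eqP.
  have se0 : 0 < Num.sqrt e by rewrite sqrtr_gt0.
  have [d d0 Hd] := H _ se0.
  exists (d ^+ 2); split; first exact: exprn_gt0.
  move=> t [/eqP t0]; rewrite !sqr_lt ?exprn_gt0 // sqrtr_sqr (gtr0_norm d0).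
  exact: Hd.
apply: defset_forall; apply: defset_imp.
  by apply: defset_lt; [exact: definable_cst|exact: definable_last].
apply: (@defset_exists _ (fun (z : 'rV[R]_(n + 1 + 1)) d => 0 < d /\ forall t,
  (t <> 0 /\ t ^+ 2 < d) ->
   slope (lsubmx (lsubmx z)) (rsubmx (lsubmx z) 0 0) t ^+ 2 < rsubmx z 0 0)).
apply: defset_and.
  by apply: defset_lt; [exact: definable_cst|exact: definable_last].
apply: (@defset_forall _ (fun (z : 'rV[R]_(n + 1 + 1 + 1)) t =>
  (t <> 0 /\ t ^+ 2 < rsubmx z 0 0) ->
   slope (lsubmx (lsubmx (lsubmx z))) (rsubmx (lsubmx (lsubmx z)) 0 0) t ^+ 2
   < rsubmx (lsubmx z) 0 0)).
have DL m := @definable_last m.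
apply: defset_imp.
  apply: defset_and.
    by apply: defset_not; apply: defset_eq => //; exact: definable_cst.
  by apply: defset_lt; [exact: definableX|exact: (definable_lsub (DL _))].
apply: defset_lt; last exact: (definable_lsub (definable_lsub (DL _))).
apply: definableX; apply: definableB.
  exact: (definable_lsub (definable_lsub (definable_lsub (DL _)))).
apply: definableM; first exact: definableV.
apply: definableB; last first.
  by apply: (definable_comp Df) => k;
    exact: (definable_lsub (definable_lsub (definable_lsub (@definable_lsubmx _ _ k)))).
apply: (definable_comp Df) => k.
under [X in definable_fun D X]funext do rewrite mxE [X in X + _]mxE.
apply: definableD.
  by apply: definableM => //; exact: definable_cst.
exact: (definable_lsub (definable_lsub (definable_lsub (@definable_lsubmx _ _ k)))).
Qed.
End Definability.

(** * Directional derivatives *)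

Section DirectionalDerivatives.
Variables (R : realType) (V : normedModType R).
Implicit Types (f g : V -> R) (x v : V).

Lemma is_derive_line f x v t l :
  is_derive (t *: v + x) v f l <-> is_derive t 1 (fun s : R => f (s *: v + x)) l.
Proof.
rewrite !is_derive_limP; set F := (X in X @ _); set G := (X in _ <-> X @ _ --> _).
suff -> : F = G by [].
by apply/funext => h; rewrite /F /G /= [h *: 1]mulr1 scalerDl addrA.
Qed.

Lemma is_derive_comp1 f (phi : R -> R) x v df dphi :
  is_derive x v f df -> is_derive (f x) 1 phi dphi ->
  is_derive x v (fun y => phi (f y)) (dphi * df).
Proof.
move=> Hf Hp; have := @is_derive_line (fun y => phi (f y)) x v 0 (dphi * df).
rewrite scale0r add0r => ->.
apply: is_derive1_comp.
  by rewrite scale0r add0r.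
by apply/is_derive_line; rewrite scale0r add0r.
Qed.

Lemma is_derive_add f g x v df dg : is_derive x v f df -> is_derive x v g dg ->
  is_derive x v (fun y => f y + g y) (df + dg).
Proof. exact: is_deriveD. Qed.

Lemma is_derive_opp f x v df : is_derive x v f df ->
  is_derive x v (fun y => - f y) (- df).
Proof. exact: is_deriveN. Qed.

Lemma is_derive_mul f g x v df dg : is_derive x v f df -> is_derive x v g dg ->
  is_derive x v (fun y => f y * g y) (f x * dg + g x * df).
Proof. exact: is_deriveM. Qed.

Lemma is_derive_inv f x v df : f x != 0 -> is_derive x v f df ->
  is_derive x v (fun y => (f y)^-1) (- df / f x ^+ 2).
Proof.
move=> f0 [Hf <-]; split; first exact: derivableV.
rewrite deriveV // [LHS](_ : _ = - (f x)^-2 * 'D_v f x) //.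
by rewrite !mulNr mulrC.
Qed.

End DirectionalDerivatives.

(** * Functions of class C^k near a point *)

Lemma near_forall_fin (T : topologicalType) (I : finType) (P : I -> T -> Prop) (z : T) :
  (forall i, \forall x \near z, P i x) -> \forall x \near z, forall i, P i x.
Proof. exact: (@filter_forall T I P (nbhs z) _). Qed.

Section LocalSmoothness.
Variables (R : realType) (n : nat).
Implicit Types (f g : 'rV[R]_n -> R) (x z : 'rV[R]_n).

(** The pointwise version of [Ck]: inverses, square roots and truncated powers are
total functions, smooth only near some of their points. *)
Fixpoint Ck_near (k : nat) f z : Prop :=
  (\forall x \near z, {for x, continuous f}) /\
  if k is k'.+1 then
    forall i : 'I_n,
      (\forall x \near z, derivable f x (delta_mx 0 i)) /\
      Ck_near k' (partial i f) z
  else True.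

Lemma Ck_near_cont k f z : Ck_near k f z -> \forall x \near z, {for x, continuous f}.
Proof. by case: k => [|k] []. Qed.

Lemma Ck_near_continuous k f z : Ck_near k f z -> {for z, continuous f}.
Proof. by move=> /Ck_near_cont/nbhs_singleton. Qed.

Lemma Ck_near_near k f z : Ck_near k f z -> \forall x \near z, Ck_near k f x.
Proof.
elim: k f z => [|k IH] f z [/near_join cf H].
  by near=> x; split=> //; near: x.
have H' : \forall x \near z, forall i, (\forall y \near x, derivable f y (delta_mx 0 i)) /\
      Ck_near k (partial i f) x.
  apply: near_forall_fin => i.
  by have [/near_join di /IH Ci] := H i; apply: filterS2 di Ci.
by near=> x; split; near: x.
Unshelve. all: by end_near. Qed.

Lemma CkP k f : Ck k f <-> forall z, Ck_near k f z.
Proof.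
elim: k f => [|k IH] f; split.
- by move=> [cf _] z; split=> //; near=> x; exact: cf.
- by move=> H; split=> // z; exact: Ck_near_continuous (H z).
- move=> [cf H] z; split; first by near=> x; exact: cf.
  move=> i; have [di /IH Ci] := H i; split=> //; near=> x; exact: di.
- move=> H; split=> [z|i]; first exact: Ck_near_continuous (H z).
  split=> [x|]; last by apply/IH => z; have [_ /(_ i)[]] := H z.
  by have [_ /(_ i)[/nbhs_singleton]] := H x.
Unshelve. all: by end_near. Qed.

Lemma near_eq_partial i f g z : (\forall x \near z, f x = g x) ->
  \forall x \near z, partial i f x = partial i g x.
Proof. by move=> /near_join; apply: filterS => x; exact: near_eq_derive. Qed.

Lemma near_eq_continuous f g z : (\forall x \near z, f x = g x) ->
  {for z, continuous f} -> {for z, continuous g}.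
Proof.
move=> fg cf; rewrite /prop_for /continuous_at -(nbhs_singleton fg).
by exact: cvg_trans (near_eq_cvg fg) cf.
Qed.

Lemma Ck_near_ext k f g z :
  (\forall x \near z, f x = g x) -> Ck_near k f z -> Ck_near k g z.
Proof.
elim: k f g z => [|k IH] f g z fg [cf H]; split=> //.
- by apply: filterS2 (near_join fg) cf => x; exact: near_eq_continuous.
- by apply: filterS2 (near_join fg) cf => x; exact: near_eq_continuous.
- move=> i; have [di Ci] := H i; split; last exact: IH (near_eq_partial i fg) Ci.
  by apply: filterS2 (near_join fg) di => x; exact: near_eq_derivable.
Qed.

Lemma Ck_nearS k f z : Ck_near k.+1 f z -> Ck_near k f z.
Proof.
elim: k f z => [|k IH] f z [cf H]; split=> // i.
by have [di /IH Ci] := H i.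
Qed.

Lemma Ck_nearW k k' f z : (k <= k')%N -> Ck_near k' f z -> Ck_near k f z.
Proof.
elim: k' => [|k' IH]; first by rewrite leqn0 => /eqP ->.
by rewrite leq_eqVlt => /orP[/eqP -> //|/IH h /Ck_nearS].
Qed.

(** Reduces smoothness to a formula for the derivatives that need only be valid near
the point. *)
Lemma Ck_near_intro k f (df : 'I_n -> 'rV[R]_n -> R) z :
  (\forall x \near z, {for x, continuous f}) ->
  (forall i, \forall x \near z, is_derive x (delta_mx 0 i) f (df i x)) ->
  (forall i, Ck_near k (df i) z) -> Ck_near k.+1 f z.
Proof.
move=> cf Hd Hc; split=> // i; split.
  by apply: filterS (Hd i) => x [].
by apply: Ck_near_ext (Hc i); apply: filterS (Hd i) => x [_ <-].
Qed.

Lemma Ck_near_elim k f z : Ck_near k.+1 f z -> forall i,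
  (\forall x \near z, is_derive x (delta_mx 0 i) f (partial i f x)) /\
  Ck_near k (partial i f) z.
Proof.
move=> [cf H] i; have [di Ci] := H i; split=> //.
by apply: filterS di => x; exact: derivableP.
Qed.

Lemma Ck_near_cst k (c : R) z : Ck_near k (fun=> c) z.
Proof.
elim: k c => [|k IH] c; first by split=> //; near=> x; exact: cst_continuous.
apply: (@Ck_near_intro _ _ (fun _ _ => 0)) => [|i|i //].
  by near=> x; exact: cst_continuous.
by near=> x; exact: is_derive_cst.
Unshelve. all: by end_near. Qed.

Lemma is_derive_coord (j i : 'I_n) x :
  is_derive x (delta_mx 0 i) (fun y : 'rV[R]_n => y 0 j) (i == j)%:R.
Proof.
apply/is_derive_epsP => e e0; exists 1 => // t t0 _.
by rewrite !mxE eqxx /= addrK eq_sym mulKf // subrr normr0.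
Qed.

Lemma Ck_near_coord k (j : 'I_n) z : Ck_near k (fun x => x 0 j) z.
Proof.
have cj : \forall x \near z, {for x, continuous (fun x : 'rV[R]_n => x 0 j)}.
  by near=> x; exact: coord_continuous.
case: k => [|k] //.
apply: (@Ck_near_intro _ _ (fun i _ => (i == j)%:R)) => // i.
  by near=> x; exact: is_derive_coord.
exact: Ck_near_cst.
Unshelve. all: by end_near. Qed.

Lemma Ck_nearD k f g z : Ck_near k f z -> Ck_near k g z ->
  Ck_near k (fun x => f x + g x) z.
Proof.
have cD f' g' k' : Ck_near k' f' z -> Ck_near k' g' z ->
    \forall x \near z, {for x, continuous (fun x => f' x + g' x)}.
  by move=> /Ck_near_cont cf /Ck_near_cont; apply: filterS2 cf => x; exact: continuousD.
elim: k f g => [|k IH] f g Cf Cg; first by split=> //; exact: cD Cf Cg.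
apply: (@Ck_near_intro _ _ (fun i x => partial i f x + partial i g x)) => [|i|i].
- exact: cD Cf Cg.
- apply: filterS2 (proj1 (Ck_near_elim Cf i)) (proj1 (Ck_near_elim Cg i)) => x.
  exact: is_derive_add.
- exact: IH (proj2 (Ck_near_elim Cf i)) (proj2 (Ck_near_elim Cg i)).
Qed.

Lemma Ck_nearM k f g z : Ck_near k f z -> Ck_near k g z ->
  Ck_near k (fun x => f x * g x) z.
Proof.
have cM f' g' k' : Ck_near k' f' z -> Ck_near k' g' z ->
    \forall x \near z, {for x, continuous (fun x => f' x * g' x)}.
  by move=> /Ck_near_cont cf /Ck_near_cont; apply: filterS2 cf => x; exact: continuousM.
elim: k f g => [|k IH] f g Cf Cg; first by split=> //; exact: cM Cf Cg.
apply: (@Ck_near_intro _ _ (fun i x => f x * partial i g x + g x * partial i f x))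
  => [|i|i].
- exact: cM Cf Cg.
- apply: filterS2 (proj1 (Ck_near_elim Cf i)) (proj1 (Ck_near_elim Cg i)) => x.
  exact: is_derive_mul.
- have [_ Cfi] := Ck_near_elim Cf i; have [_ Cgi] := Ck_near_elim Cg i.
  by apply: Ck_nearD; apply: IH => //; exact: Ck_nearS.
Qed.

Lemma Ck_nearN k f z : Ck_near k f z -> Ck_near k (fun x => - f x) z.
Proof.
move=> /(Ck_nearM (Ck_near_cst k (-1) z)); apply: Ck_near_ext.
by near=> x; rewrite mulN1r.
Unshelve. all: by end_near. Qed.

Lemma Ck_nearB k f g z : Ck_near k f z -> Ck_near k g z ->
  Ck_near k (fun x => f x - g x) z.
Proof. by move=> Cf /Ck_nearN; exact: Ck_nearD. Qed.

Lemma Ck_nearX k f m z : Ck_near k f z -> Ck_near k (fun x => f x ^+ m) z.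
Proof.
move=> Cf; elim: m => [|m IH].
  by under [X in Ck_near k X]funext do rewrite expr0; exact: Ck_near_cst.
by under [X in Ck_near k X]funext do rewrite exprS; exact: Ck_nearM.
Qed.

Lemma Ck_near_sum k (I : Type) (s : seq I) (P : pred I) (f : I -> 'rV[R]_n -> R) z :
  (forall i, P i -> Ck_near k (f i) z) ->
  Ck_near k (fun x => \sum_(i <- s | P i) f i x) z.
Proof.
move=> Cf; elim: s => [|a s IH].
  by under [X in Ck_near k X]funext do rewrite big_nil; exact: Ck_near_cst.
under [X in Ck_near k X]funext do rewrite big_cons.
by case Pa: (P a) => //; apply: Ck_nearD => //; exact: Cf.
Qed.

Lemma Ck_near_prod k (I : Type) (s : seq I) (P : pred I) (f : I -> 'rV[R]_n -> R) z :
  (forall i, P i -> Ck_near k (f i) z) ->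
  Ck_near k (fun x => \prod_(i <- s | P i) f i x) z.
Proof.
move=> Cf; elim: s => [|a s IH].
  by under [X in Ck_near k X]funext do rewrite big_nil; exact: Ck_near_cst.
under [X in Ck_near k X]funext do rewrite big_cons.
by case Pa: (P a) => //; apply: Ck_nearM => //; exact: Cf.
Qed.

Lemma near_cont_neq0 f z : {for z, continuous f} -> f z != 0 ->
  \forall x \near z, f x != 0.
Proof. by move=> cf fz; exact: cvgr_neq0 cf fz. Qed.

Lemma near_cont_gt (c : R) f z : {for z, continuous f} -> c < f z ->
  \forall x \near z, c < f x.
Proof. by move=> cf fz; exact: (cf _ (lt_nbhsr fz)). Qed.

Lemma Ck_nearV k f z : f z != 0 -> Ck_near k f z -> Ck_near k (fun x => (f x)^-1) z.
Proof.
move=> fz; elim: k f fz => [|k IH] f fz Cf.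
  split=> //; have f0 := near_cont_neq0 (Ck_near_continuous Cf) fz.
  by apply: filterS2 f0 (Ck_near_cont Cf) => x; exact: continuousV.
have f0 := near_cont_neq0 (Ck_near_continuous Cf) fz.
apply: (@Ck_near_intro _ _ (fun i x => - partial i f x / f x ^+ 2)) => [|i|i].
- by apply: filterS2 f0 (Ck_near_cont Cf) => x; exact: continuousV.
- have [di _] := Ck_near_elim Cf i.
  by apply: filterS2 f0 di => x; exact: is_derive_inv.
- have [_ Ci] := Ck_near_elim Cf i; apply: Ck_nearM; first exact: Ck_nearN.
  by apply: IH; [rewrite expf_neq0|apply/Ck_nearX/Ck_nearS].
Qed.

Lemma Ck_near_sqrt k f z : 0 < f z -> Ck_near k f z ->
  Ck_near k (fun x => Num.sqrt (f x)) z.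
Proof.
move=> fz; elim: k f fz => [|k IH] f fz Cf.
  split=> //; apply: filterS (Ck_near_cont Cf) => x cf.
  by apply: (continuous_comp cf); exact: sqrt_continuous.
have f0 := near_cont_gt (Ck_near_continuous Cf) fz.
apply: (@Ck_near_intro _ _ (fun i x => (2 * Num.sqrt (f x))^-1 * partial i f x))
  => [|i|i].
- apply: filterS (Ck_near_cont Cf) => x cf.
  by apply: (continuous_comp cf); exact: sqrt_continuous.
- have [di _] := Ck_near_elim Cf i; apply: filterS2 f0 di => x f0 di.
  by apply: (is_derive_comp1 di); exact: is_derive1_sqrt.
- have [_ Ci] := Ck_near_elim Cf i; apply: Ck_nearM => //.
  apply: Ck_nearV; first by rewrite mulf_neq0 // gt_eqF // sqrtr_gt0.
  by apply: Ck_nearM; [exact: Ck_near_cst|apply: IH => //; exact: Ck_nearS].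
Qed.

End LocalSmoothness.

(** From exponent 2 on, the corner of max 0 s at the origin is flattened. *)
Lemma is_derive_max0X (R : realType) (m : nat) (t : R) :
  is_derive t 1 (fun s : R => Num.max 0 s ^+ m.+2) (m.+2%:R * Num.max 0 t ^+ m.+1).
Proof.
have [t0|t0|->] := ltgtP t 0.
- rewrite expr0n mulr0; apply: (@near_eq_is_derive _ _ _ (fun=> 0)).
    have : \forall s \near t, s < 0 by apply: lt_nbhsl.
    by apply: filterS => s s0; rewrite max_l ?ltW // expr0n.
- have dX : is_derive t 1 (fun s : R => s ^+ m.+2) (m.+2%:R * t ^+ m.+1).
    by split; [exact: exprn_derivable|rewrite exp_derive [LHS]mulr1].
  apply: near_eq_is_derive dX.
  have : \forall s \near t, 0 < s by apply: lt_nbhsr.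
  by apply: filterS => s s0; rewrite max_r ?ltW.
- rewrite expr0n mulr0; apply/is_derive_epsP => e e0.
  have d0 : 0 < Num.min 1 e by rewrite lt_min ltr01.
  exists (Num.min 1 e) => // s s0; rewrite lt_min => /andP[s1 se].
  rewrite sub0r normrN [s *: 1]mulr1 addr0 maxxx (expr0n _ m.+2) subr0.
  apply: le_lt_trans se; have [s0'|s0'] := leP s 0.
    by rewrite expr0n mulr0 normr0.
  rewrite exprS mulKf // exprS normrM ler_piMr // normrX exprn_ile1 //.
  exact: ltW.
Qed.

(** Each differentiation lowers the exponent by one, so exponent m leaves room for
m - 1 continuous derivatives. *)
Lemma Ck_near_max0X (R : realType) n k m (f : 'rV[R]_n -> R) z : (k < m)%N ->
  Ck_near k f z -> Ck_near k (fun x => Num.max 0 (f x) ^+ m) z.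
Proof.
have cm (g : 'rV[R]_n -> R) (x : 'rV[R]_n) m' : {for x, continuous g} ->
    {for x, continuous (fun x : 'rV[R]_n => Num.max 0 (g x) ^+ m')}.
  move=> cg.
  have cmax : {for x, continuous (fun x : 'rV[R]_n => Num.max 0 (g x))}.
    exact: continuous_max (@cst_continuous _ _ 0 x) cg.
  exact: (continuous_comp cmax (@exprn_continuous _ m' _)).
elim: k m f => [|k IH] m f km Cf.
  by split=> //; apply: filterS (Ck_near_cont Cf) => x; exact: cm.
case: m km => [|[|m]] // km.
apply: (@Ck_near_intro _ _ _ _ (fun i x =>
   m.+2%:R * Num.max 0 (f x) ^+ m.+1 * partial i f x)) => [|i|i].
- by apply: filterS (Ck_near_cont Cf) => x; exact: cm.
- have [di _] := Ck_near_elim Cf i; apply: filterS di => x di.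
  exact: is_derive_comp1 di (is_derive_max0X _ _).
- have [_ Ci] := Ck_near_elim Cf i; apply: Ck_nearM => //.
  by apply: Ck_nearM; [exact: Ck_near_cst|apply: IH => //; exact: Ck_nearS].
Qed.

(** * Mean values and the symmetry of second derivatives *)

Lemma rV_norm_ltP (R : realType) n (u : 'rV[R]_n) (e : R) : 0 < e ->
  `|u| < e <-> forall k, `|u 0 k| < e.
Proof.
move=> e0; rewrite [X in X < _]mx_normrE; split.
  by move=> /bigmax_ltP[_ H] k; exact: (H (0, k)).
by move=> H; apply/bigmax_ltP; split=> // -[a k] _ /=; rewrite ord1.
Qed.

Lemma ler_dist_half (R : realFieldType) (a b c e : R) :
  `|a - c| < e / 2 -> `|b - c| < e / 2 -> `|a - b| <= e.
Proof.
move=> h1 h2; have h := ler_distD c a b; rewrite (distrC c b) in h.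
by rewrite (le_trans h) // [leRHS]splitr lerD // ltW.
Qed.

(** Increments of either sign are treated at once. *)
Lemma MVT_abs (R : realType) (f df : R -> R) (t : R) :
  (forall s : R, `|s| <= `|t| -> is_derive s 1 f (df s)) ->
  exists2 s : R, `|s| <= `|t| & f t - f 0 = t * df s.
Proof.
move=> Hd.
have cf (s : R) : `|s| <= `|t| -> {for s, continuous f}.
  by move=> /Hd[/derivable1_diffP/differentiable_continuous].
have [t0|t0] := leP 0 t.
  have [||s st ->] := @MVT_segment R f df 0 t t0.
  - move=> s; rewrite in_itv /= => /andP[s0 st]; apply: Hd.
    by rewrite (ger0_norm t0) (ger0_norm (ltW s0)) ltW.
  - apply: derivable_within_continuous => s; rewrite in_itv /= => /andP[s0 st].
    by have [] : is_derive s 1 f (df s) by apply: Hd; rewrite !ger0_norm.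
  exists s; last by rewrite subr0 mulrC.
  by move: st; rewrite in_itv /= => /andP[s0 st]; rewrite !ger0_norm.
have [||s st e] := @MVT_segment R f df t 0 (ltW t0).
- move=> s; rewrite in_itv /= => /andP[st s0]; apply: Hd.
  by rewrite (ltr0_norm t0) (ltr0_norm s0) lerN2 ltW.
- apply: derivable_within_continuous => s; rewrite in_itv /= => /andP[st s0].
  have [] // : is_derive s 1 f (df s).
  by apply: Hd; rewrite (ltr0_norm t0) (ler0_norm s0) lerN2.
exists s; last by rewrite -opprB e; ring.
move: st; rewrite in_itv /= => /andP[st s0].
by rewrite (ltr0_norm t0) (ler0_norm s0) lerN2.
Qed.

Lemma continuous_atP (R : realType) n (f : 'rV[R]_n -> R) (x : 'rV[R]_n) :
  {for x, continuous f} <->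
  forall e : R, 0 < e -> \forall y \near x, `|f x - f y| <= e.
Proof.
rewrite /prop_for /continuous_at.
split=> [/cvgrPdist_le H e e0|H]; first exact: H.
by apply/cvgrPdist_le; [exact: (nbhs_filter x)|exact: H].
Qed.

Section GlobalCk.
Variables (R : realType) (n : nat).
Implicit Types (f F : 'rV[R]_n -> R) (x z : 'rV[R]_n).

Lemma Ck_continuous k f : Ck k f -> continuous f.
Proof. by case: k => [|k] []. Qed.

Lemma Ck_elim k f : Ck k.+1 f -> forall i,
  (forall x, is_derive x (delta_mx 0 i) f (partial i f x)) /\ Ck k (partial i f).
Proof.
by move=> [cf H] i; have [di Ci] := H i; split=> // x; exact: derivableP.
Qed.

Lemma Ck_intro k f (df : 'I_n -> 'rV[R]_n -> R) :
  continuous f ->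
  (forall i x, is_derive x (delta_mx 0 i) f (df i x)) ->
  (forall i, Ck k (df i)) -> Ck k.+1 f.
Proof.
move=> cf Hd Hc; split=> // i; split; first by move=> x; have [] := Hd i x.
suff -> : partial i f = df i by [].
by apply/funext => x; have [_ <-] := Hd i x.
Qed.

Lemma CkS k f : Ck k.+1 f -> Ck k f.
Proof. by move=> /CkP Cf; apply/CkP => z; exact: Ck_nearS. Qed.

Lemma CkW k k' f : (k <= k')%N -> Ck k' f -> Ck k f.
Proof. by move=> kk' /CkP Cf; apply/CkP => z; exact: Ck_nearW kk' (Cf z). Qed.

Lemma Ck_iter_partial k s i f : Ck (k + s) f -> Ck k (iter s (partial i) f).
Proof.
elim: s f => [|s IH] f; first by rewrite addn0.
by rewrite addnS => /Ck_elim/(_ i)[_ /IH]; rewrite iterSr.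
Qed.

(** Applying the mean value theorem first along the axis i and then along j; the
left-hand side is symmetric in i and j. *)
Lemma second_difference F i j x t : Ck 2 F -> exists s u : R,
  [/\ `|s| <= `|t|, `|u| <= `|t| &
  F (t *: delta_mx 0 i + (t *: delta_mx 0 j + x)) - F (t *: delta_mx 0 i + x)
   - (F (t *: delta_mx 0 j + x) - F x)
  = t * (t * partial j (partial i F) (u *: delta_mx 0 j + (s *: delta_mx 0 i + x)))].
Proof.
move=> CF; have [dF /Ck_elim/(_ j)[ddF _]] := Ck_elim CF i.
pose G s := F (s *: delta_mx 0 i + (t *: delta_mx 0 j + x)) - F (s *: delta_mx 0 i + x).
have [|s st Gt] := @MVT_abs R G (fun s =>
    partial i F (s *: delta_mx 0 i + (t *: delta_mx 0 j + x))
    - partial i F (s *: delta_mx 0 i + x)) t.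
  by move=> s _; apply: is_derive_add; [|apply: is_derive_opp];
    apply: (iffLR (@is_derive_line _ _ F _ _ _ _)); exact: dF.
pose H u := partial i F (u *: delta_mx 0 j + (s *: delta_mx 0 i + x)).
have [|u ut Hu] := @MVT_abs R H (fun u =>
    partial j (partial i F) (u *: delta_mx 0 j + (s *: delta_mx 0 i + x))) t.
  by move=> u _; apply: (iffLR (@is_derive_line _ _ (partial i F) _ _ _ _)); exact: ddF.
exists s, u; split=> //.
move: Gt Hu; rewrite /G /H !scale0r !add0r => -> <-.
by rewrite [s *: _ + (_ + _)]addrCA.
Qed.

(** Symmetry of second derivatives: both mixed derivatives are values of the
same second difference quotient at nearby points. *)
Lemma partialC F i j : Ck 2 F -> partial i (partial j F) = partial j (partial i F).
Proof.
move=> CF; apply/funext => x.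
have cij a b : continuous (partial a (partial b F)).
  have [_ /Ck_elim/(_ a)[_]] := Ck_elim CF b; exact: Ck_continuous.
apply/eqP; rewrite -subr_eq0 -normr_le0; apply/ler_addgt0Pr => e e0; rewrite add0r.
have e20 : 0 < e / 2 by rewrite divr_gt0.
have /cvgrPdist_lt/(_ _ e20) := cij i j x.
have /cvgrPdist_lt/(_ _ e20) := cij j i x.
move=> /nbhs_ballP[d1 /= d10 Hd1] /nbhs_ballP[d2 /= d20 Hd2].
pose N := 1 + `|delta_mx 0 i : 'rV[R]_n| + `|delta_mx 0 j : 'rV[R]_n|.
have N0 : 0 < N by rewrite /N -addrA ltr_pwDl // addr_ge0.
pose t := Num.min d1 d2 / N.
have t0 : 0 < t by rewrite divr_gt0 // lt_min d10.
have small a b s u : (a = i /\ b = j) \/ (a = j /\ b = i) -> `|s| <= t -> `|u| <= t ->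
    `|u *: delta_mx 0 b + s *: delta_mx 0 a : 'rV[R]_n| < Num.min d1 d2.
  move=> ab st ut; apply: le_lt_trans (ler_normD _ _) _; rewrite !normrZ.
  apply: (@le_lt_trans _ _ (t * (`|delta_mx 0 i : 'rV[R]_n| + `|delta_mx 0 j : 'rV[R]_n|))).
    by rewrite mulrDr; case: ab => -[-> ->]; [rewrite addrC|];
      apply: lerD; apply: ler_wpM2r.
  have -> : Num.min d1 d2 = t * N by rewrite divfK // gt_eqF.
  by rewrite ltr_pM2l // /N -addrA ltrDr.
have [s [u [st ut E1]]] := second_difference i j x t CF.
have [s' [u' [st' ut' E2]]] := second_difference j i x t CF.
rewrite (gtr0_norm t0) in st ut st' ut'.
have E : partial j (partial i F) (u *: delta_mx 0 j + (s *: delta_mx 0 i + x)) =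
    partial i (partial j F) (u' *: delta_mx 0 i + (s' *: delta_mx 0 j + x)).
  have tn0 := lt0r_neq0 t0.
  have E12 := E2; rewrite [t *: delta_mx 0 j + (_ + x)]addrCA in E12.
  have E21 (p q r w : R) : p - q - (r - w) = p - r - (q - w) by ring.
  rewrite E21 E1 in E12.
  by move: E12 => /(mulfI tn0)/(mulfI tn0).
have eqd (U S : 'rV[R]_n) : x - (U + (S + x)) = - (U + S).
  by rewrite addrA opprD addrCA subrr addr0.
have B1 := Hd1 (u *: delta_mx 0 j + (s *: delta_mx 0 i + x)).
have B2 := Hd2 (u' *: delta_mx 0 i + (s' *: delta_mx 0 j + x)).
have {}B1 : `|partial j (partial i F) x -
   partial j (partial i F) (u *: delta_mx 0 j + (s *: delta_mx 0 i + x))| < e / 2.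
  apply: B1; rewrite -ball_normE /= eqd normrN.
  by have := small i j s u (or_introl (conj erefl erefl)) st ut; rewrite lt_min => /andP[].
have {}B2 : `|partial i (partial j F) x -
   partial i (partial j F) (u' *: delta_mx 0 i + (s' *: delta_mx 0 j + x))| < e / 2.
  apply: B2; rewrite -ball_normE /= eqd normrN.
  by have := small j i s' u' (or_intror (conj erefl erefl)) st' ut'; rewrite lt_min => /andP[].
move: B1; rewrite E => B1.
exact: ler_dist_half B2 B1.
Qed.

Lemma partial_iterC F i j s : Ck s.+1 F ->
  partial j (iter s (partial i) F) = iter s (partial i) (partial j F).
Proof.
elim: s F => [|s IH] F CF //; rewrite !iterSr.
rewrite IH; last by have [_] := Ck_elim CF i.
by rewrite partialC //; apply: CkW CF.
Qed.

End GlobalCk.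

Arguments Ck_continuous {R n k f} _ x.

(** * Divided differences along a coordinate axis *)

Lemma is_derive_expn (R : realType) r (t : R) :
  is_derive t 1 (fun s : R => s ^+ r.+1) (r.+1%:R * t ^+ r).
Proof. by split; [exact: exprn_derivable|rewrite exp_derive [LHS]mulr1]. Qed.

Section DividedDifferences.
Variables (R : realType) (n : nat) (i : 'I_n) (c : R).
Implicit Types (F : 'rV[R]_n -> R) (x : 'rV[R]_n).

(** Projection to the hyperplane x_i = c along the i-th axis. *)
Definition hproj x : 'rV[R]_n := x + (c - x 0 i) *: delta_mx 0 i.

Lemma hproj_i x : hproj x 0 i = c.
Proof. by rewrite !mxE !eqxx mulr1 addrC subrK. Qed.

Lemma hproj_j x j : j != i -> hproj x 0 j = x 0 j.
Proof. by move=> ji; rewrite !mxE (negbTE ji) andbF mulr0 addr0. Qed.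

Lemma hproj_id x : x 0 i = c -> hproj x = x.
Proof. by move=> xi; rewrite /hproj xi subrr scale0r addr0. Qed.

Lemma hprojK x : (x 0 i - c) *: delta_mx 0 i + hproj x = x.
Proof. by rewrite /hproj addrCA -scalerDl [X in X *: _]addrA subrK subrr scale0r addr0. Qed.

Lemma shift_i t x : (t *: delta_mx 0 i + x : 'rV[R]_n) 0 i = t + x 0 i.
Proof. by rewrite !mxE !eqxx mulr1. Qed.

Lemma shift_j j t x : j != i -> (t *: delta_mx 0 j + x : 'rV[R]_n) 0 i = x 0 i.
Proof. by move=> ji; rewrite !mxE eqxx eq_sym (negbTE ji) mulr0 add0r. Qed.

Lemma hproj_shift_i t x : hproj (t *: delta_mx 0 i + x) = hproj x.
Proof.
by rewrite /hproj shift_i [_ + x]addrC -addrA -scalerDl; congr (_ + _ *: _); ring.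
Qed.

Lemma hproj_shift_j j t x : j != i ->
  hproj (t *: delta_mx 0 j + x) = t *: delta_mx 0 j + hproj x.
Proof. by move=> ji; rewrite /hproj shift_j // addrA. Qed.

Lemma hproj_continuous : continuous hproj.
Proof.
move=> x.
have cc := Ck_near_continuous (Ck_nearB (Ck_near_cst 0 c x) (Ck_near_coord 0 i x)).
have cz := continuousZr_tmp (a := delta_mx 0 i : 'rV[R]_n) cc.
have ci : {for x, continuous (fun y : 'rV[R]_n => y)} by exact: cvg_id.
by have := continuousD ci cz.
Qed.

(** A directional derivative only depends on the restriction to a line. *)
Lemma is_derive_along F G x v l : (forall t, F (t *: v + x) = G (t *: v + x)) ->
  is_derive x v F l -> is_derive x v G l.
Proof.
move=> FG; rewrite !is_derive_limP; have := FG 0; rewrite scale0r add0r => FG0.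
set A := (X in X @ _ --> _ -> _); set B := (X in _ -> X @ _ --> _).
by suff -> : A = B by []; apply/funext => t; rewrite /A /B FG FG0.
Qed.

Lemma is_derive_hproj_i F x : is_derive x (delta_mx 0 i) (fun y => F (hproj y)) 0.
Proof.
apply: (@is_derive_along (fun=> F (hproj x))).
by move=> t; rewrite hproj_shift_i.
Qed.

Lemma is_derive_hproj_j F j x l : j != i -> is_derive (hproj x) (delta_mx 0 j) F l ->
  is_derive x (delta_mx 0 j) (fun y => F (hproj y)) l.
Proof.
move=> ji; rewrite !is_derive_limP.
set A := (X in X @ _ --> _ -> _); set B := (X in _ -> X @ _ --> _).
suff -> : A = B by [].
by apply/funext => t; rewrite /A /B hproj_shift_j.
Qed.

Lemma Ck_hproj k F : Ck k F -> Ck k (fun x => F (hproj x)).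
Proof.
have cP (G : 'rV[R]_n -> R) : continuous G -> continuous (fun x => G (hproj x)).
  by move=> cG x; exact: (@continuous_comp _ _ _ hproj G x (@hproj_continuous x) (cG _)).
elim: k F => [|k IH] F CF; first by split=> //; apply: cP; exact: Ck_continuous CF.
apply: (@Ck_intro _ _ _ _
  (fun j => if j == i then fun=> 0 else fun x => partial j F (hproj x))) => [|j x|j].
- by apply: cP; exact: Ck_continuous CF.
- have [->|ji] := eqVneq j i; first exact: is_derive_hproj_i.
  by apply: is_derive_hproj_j => //; have [] := Ck_elim CF j.
- case: eqVneq => [_|ji]; last by apply: IH; have [] := Ck_elim CF j.
  by apply/CkP => z; exact: Ck_near_cst.
Qed.

(** Remainder of order r in the Taylor expansion of F along the i-th axis,
based at the hyperplane x_i = c. *)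
Fixpoint taylor_rem r F x : R :=
  if r is s.+1 then
    taylor_rem s F x - (x 0 i - c) ^+ s / s`!%:R * iter s (partial i) F (hproj x)
  else F x.

Lemma is_derive_powi x r :
  is_derive x (delta_mx 0 i) (fun y : 'rV[R]_n => (y 0 i - c) ^+ r.+1)
    (r.+1%:R * (x 0 i - c) ^+ r).
Proof.
have dc : is_derive x (delta_mx 0 i) (fun y : 'rV[R]_n => y 0 i - c) 1.
  have := is_derive_add (is_derive_coord i i x) (is_derive_cst (- c) x (delta_mx 0 i)).
  by rewrite eqxx addr0.
by have := is_derive_comp1 dc (is_derive_expn r (x 0 i - c)); rewrite mulr1.
Qed.

(** The base point hproj x does not move along the i-th axis, so the Taylor
polynomial is differentiated in the power of x_i - c only. *)
Lemma is_derive_taylor_rem_i r F x : Ck 1 F ->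
  is_derive x (delta_mx 0 i) (taylor_rem r.+1 F) (taylor_rem r (partial i F) x).
Proof.
move=> CF; have [dF _] := Ck_elim CF i.
elim: r => [|r IH] /=.
  have := is_derive_add (dF x) (is_derive_opp (is_derive_hproj_i F x)).
  rewrite oppr0 addr0; apply: is_derive_along => t.
  by rewrite expr0 fact0 invr1 !mul1r.
have := is_derive_add IH (is_derive_opp
  (is_derive_mul (is_derive_powi x r)
     (is_derive_hproj_i (fun y => (r.+1)`!%:R^-1 * iter r.+1 (partial i) F y) x))).
rewrite mulr0 add0r -iterSr => /is_derive_eq h.
apply: is_derive_along (h _ _) => [t|]; first by rewrite mulrA.
congr (_ - _); rewrite factS natrM invfM /=; field.
by rewrite nat1r !pnatr_eq0 -lt0n fact_gt0.
Qed.

(** Transversal derivatives pass to the Taylor coefficients by symmetry of the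
mixed derivatives. *)
Lemma is_derive_taylor_rem_j r F j x : j != i -> Ck r.+1 F ->
  is_derive x (delta_mx 0 j) (taylor_rem r F) (taylor_rem r (partial j F) x).
Proof.
move=> ji; elim: r => [|r IH] CF /=; first by have [] := Ck_elim CF j.
have CFr : Ck 1 (iter r (partial i) F) by apply: Ck_iter_partial; apply: CkW CF.
apply: is_derive_add; first exact: IH (CkS CF).
apply: is_derive_opp.
apply: (@is_derive_along
  (fun y => (x 0 i - c) ^+ r / r`!%:R * iter r (partial i) F (hproj y))).
  by move=> t; rewrite shift_j.
have := is_derive_mul (is_derive_cst ((x 0 i - c) ^+ r / r`!%:R) x (delta_mx 0 j))
  (is_derive_hproj_j ji (proj1 (Ck_elim CFr j) (hproj x))).
by rewrite mulr0 addr0 (partial_iterC _ _ (CkS CF)).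
Qed.

Lemma taylor_rem_hyperplane r F x : x 0 i = c -> taylor_rem r.+1 F x = 0.
Proof.
move=> xi; elim: r => [|r IH] /=; first by rewrite hproj_id // expr0 fact0 invr1 !mul1r subrr.
by rewrite -/(taylor_rem r.+1 F x) IH xi subrr expr0n !mul0r subrr.
Qed.

Lemma Ck0_taylor_rem r F : Ck r F -> Ck 0 (taylor_rem r F).
Proof.
move=> CF; suff : forall s, (s <= r)%N -> Ck 0 (taylor_rem s F).
  exact.
elim=> [|s IH] sr; first exact: CkW CF.
have CFs : Ck 0 (iter s (partial i) F).
  by apply: Ck_iter_partial; apply: CkW CF; rewrite add0n ltnW.
apply/CkP => x; apply: Ck_nearB; first by move: x; apply/CkP; exact: IH (ltnW sr).
apply: Ck_nearM; last by move: x; apply/CkP; exact: (Ck_hproj CFs).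
apply: Ck_nearM; last exact: Ck_near_cst.
by apply: Ck_nearX; apply: Ck_nearB; [exact: Ck_near_coord|exact: Ck_near_cst].
Qed.

(** Taylor's formula with Peano remainder, uniformly in the base point of the
hyperplane; the mean value theorem reduces order r.+1 for F to order r for
the derivative of F. *)
Lemma taylor_rem_bound r F x0 e : Ck r F -> x0 0 i = c -> 0 < e ->
  \forall x \near x0,
   `|taylor_rem r F x - (x 0 i - c) ^+ r / r`!%:R * iter r (partial i) F x0|
     <= e * `|x 0 i - c| ^+ r.
Proof.
move=> CF x0i e0; elim: r F CF => [|r IH] F CF.
  have /cvgrPdist_le/(_ _ e0) := Ck_continuous CF x0.
  by apply: filterS => x; rewrite /= expr0 fact0 invr1 !mul1r mulr1 distrC.
have [_ CiF] := Ck_elim CF i.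
have /nbhs_ballP[d /= d0 Hd] := IH _ CiF.
apply/nbhs_ballP; exists d => // x /=; rewrite -ball_normE /= => xd.
set t := x 0 i - c.
have td : `|t| < d.
  by have /(_ i) := (rV_norm_ltP _ d0).1 xd; rewrite !mxE x0i distrC.
pose A := iter r.+1 (partial i) F x0.
pose phi (s : R) := taylor_rem r.+1 F (s *: delta_mx 0 i + hproj x)
   + s ^+ r.+1 * (- ((r.+1)`!%:R^-1 * A)).
pose dphi (s : R) := taylor_rem r (partial i F) (s *: delta_mx 0 i + hproj x)
   + s ^+ r * (- (r`!%:R^-1 * A)).
have dphiP (s : R) : `|s| <= `|t| -> is_derive s 1 phi (dphi s).
  move=> _.
  have d1 := is_derive_taylor_rem_i r (s *: delta_mx 0 i + hproj x)
    (CkW (isT : (1 <= r.+1)%N) CF).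
  have {}d1 := iffLR (@is_derive_line _ _ (taylor_rem r.+1 F) _ _ _ _) d1.
  have d2 := is_derive_expn r s.
  have := is_derive_add d1 (is_derive_mul d2
    (is_derive_cst (- ((r.+1)`!%:R^-1 * A)) s (1 : R))).
  move=> /is_derive_eq; apply; rewrite /dphi; congr (_ + _).
  rewrite mulr0 add0r factS natrM invfM /cst; field.
  by rewrite nat1r !pnatr_eq0 -lt0n fact_gt0.
have [s st E] := MVT_abs dphiP.
have phi0 : phi 0 = 0.
  by rewrite /phi scale0r add0r taylor_rem_hyperplane ?hproj_i // expr0n mul0r addr0.
have phit : phi t = taylor_rem r.+1 F x - t ^+ r.+1 / (r.+1)`!%:R * A.
  by rewrite /phi hprojK mulrN mulrA.
rewrite phi0 subr0 phit in E; rewrite E normrM exprS mulrCA.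
apply: ler_wpM2l => //.
apply: (@le_trans _ _ (e * `|s| ^+ r)); last first.
  by apply: ler_wpM2l; [exact: ltW|by apply: lerXn2r; rewrite ?nnegrE].
have := Hd (s *: delta_mx 0 i + hproj x).
rewrite /= shift_i hproj_i addrK -iterSr /dphi mulrN mulrA; apply.
rewrite -ball_normE /=; apply/(rV_norm_ltP _ d0) => k.
have [->|ki] := eqVneq k i.
  rewrite !mxE !eqxx !mulr1 x0i (_ : c - (s + _) = - s); last by ring.
  by rewrite normrN (le_lt_trans st).
have := (rV_norm_ltP _ d0).1 xd k.
by rewrite !mxE (negbTE ki) andbF !mulr0 add0r addr0.
Qed.

(** The quotient of the Taylor remainder of order r by (x_i - c)^r; on the
hyperplane, its limit, which is the Taylor coefficient of order r. *)
Definition divdiff r F x : R :=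
  if x 0 i == c then iter r (partial i) F x / r`!%:R
  else taylor_rem r F x / (x 0 i - c) ^+ r.

Lemma near_off_hyperplane x : x 0 i != c ->
  \forall y \near x, (y : 'rV[R]_n) 0 i != c.
Proof.
move=> xi.
have cc := Ck_near_continuous (Ck_nearB (Ck_near_coord 0 i x) (Ck_near_cst 0 c x)).
have := near_cont_neq0 cc; rewrite subr_eq0 => /(_ xi).
by apply: filterS => y; rewrite subr_eq0.
Qed.

Lemma divdiff_continuous r F : Ck r F -> continuous (divdiff r F).
Proof.
move=> CF x0.
have [x0i|x0i] := eqVneq (x0 0 i) c; last first.
  have nz := near_off_hyperplane x0i.
  apply: (@near_eq_continuous _ _ (fun x => taylor_rem r F x / (x 0 i - c) ^+ r)).
    by apply: filterS nz => x; rewrite /divdiff => /negbTE ->.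
  apply: (@Ck_near_continuous _ _ 0); apply: Ck_nearM.
    by move: (x0); apply/CkP; exact: Ck0_taylor_rem.
  apply: Ck_nearV; first by rewrite expf_neq0 // subr_eq0.
  by apply/Ck_nearX/Ck_nearB; [exact: Ck_near_coord|exact: Ck_near_cst].
apply/continuous_atP => e e0.
have B := taylor_rem_bound CF x0i e0.
have CFr : Ck 0 (iter r (partial i) F) by apply: Ck_iter_partial.
have cI : Ck 0 (fun x => iter r (partial i) F x / r`!%:R).
  by apply/CkP => x; apply: Ck_nearM; [exact: ((CkP _ _).1 CFr)|exact: Ck_near_cst].
have /cvgrPdist_le/(_ _ e0) := Ck_continuous cI x0.
have -> : divdiff r F x0 = iter r (partial i) F x0 / r`!%:R by rewrite /divdiff x0i eqxx.
apply: filterS2 B => x B C; rewrite /divdiff; case: eqVneq => [//|xi].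
have p0 : 0 < `|x 0 i - c| ^+ r by rewrite exprn_gt0 // normr_gt0 subr_eq0.
have nz : (x 0 i - c) ^+ r != 0 by rewrite expf_neq0 // subr_eq0.
set T := taylor_rem r F x in B *; set A := iter r (partial i) F x0 in B *.
set q := x 0 i - c in B p0 nz *.
rewrite (_ : A / _ - T / _ = - (T - q ^+ r / r`!%:R * A) / q ^+ r).
  by rewrite normrM normrN normfV normrX ler_pdivrMr.
by field; rewrite nz pnatr_eq0 -lt0n fact_gt0.
Qed.

Lemma is_derive_divdiff_j r F j x : j != i -> Ck r.+1 F ->
  is_derive x (delta_mx 0 j) (divdiff r F) (divdiff r (partial j F) x).
Proof.
move=> ji CF; rewrite /divdiff; case: eqVneq => xi.
  apply: (@is_derive_along (fun y => r`!%:R^-1 * iter r (partial i) F y)).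
    by move=> t; rewrite shift_j // xi eqxx mulrC.
  have CFr : Ck 1 (iter r (partial i) F) by apply: Ck_iter_partial; apply: CkW CF.
  have := is_derive_mul (is_derive_cst (r`!%:R^-1 : R) x (delta_mx 0 j))
    (proj1 (Ck_elim CFr j) x).
  by rewrite mulr0 addr0 (partial_iterC _ _ CF) mulrC.
apply: (@is_derive_along (fun y => ((x 0 i - c) ^+ r)^-1 * taylor_rem r F y)).
  by move=> t; rewrite shift_j // (negbTE xi) mulrC.
have := is_derive_mul (is_derive_cst (((x 0 i - c) ^+ r)^-1 : R) x (delta_mx 0 j))
    (is_derive_taylor_rem_j x ji CF).
by rewrite mulr0 addr0 mulrC.
Qed.

(** Off the hyperplane this is the quotient rule. On it, the difference quotients of
the divided difference of order r are exactly the values of the one of order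
r.+1, which is continuous. *)
Lemma is_derive_divdiff_i r F x : Ck r.+1 F ->
  is_derive x (delta_mx 0 i) (divdiff r F)
    (divdiff r (partial i F) x - r%:R * divdiff r.+1 F x).
Proof.
move=> CF; have [xi|xi] := eqVneq (x 0 i) c.
  have -> : divdiff r (partial i F) x - r%:R * divdiff r.+1 F x = divdiff r.+1 F x.
    rewrite /divdiff xi eqxx -iterSr factS natrM invfM; field.
    by rewrite nat1r !pnatr_eq0 -lt0n fact_gt0.
  apply/is_derive_epsP => e e0.
  have /cvgrPdist_lt/(_ _ e0) := @divdiff_continuous r.+1 F CF x.
  move=> /nbhs_ballP[d /= d0 Hd]; exists d => // t t0 td.
  have := Hd (t *: delta_mx 0 i + x).
  have -> : divdiff r.+1 F (t *: delta_mx 0 i + x) =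
      t^-1 * (divdiff r F (t *: delta_mx 0 i + x) - divdiff r F x).
    rewrite /divdiff shift_i xi eqxx -subr_eq0 addrK (negbTE t0) /=.
    rewrite hproj_shift_i hproj_id // shift_i xi addrK exprS invfM.
    by field; rewrite t0 expf_neq0 //= pnatr_eq0 -lt0n fact_gt0.
  apply; rewrite -ball_normE /=; apply/(rV_norm_ltP _ d0) => k.
  rewrite !mxE opprD addrCA subrr addr0 normrN normrM.
  apply: le_lt_trans td; rewrite ler_piMr //.
  by case: (_ && _); rewrite ?normr1 ?normr0.
have nz := near_off_hyperplane xi.
have xc : x 0 i - c != 0 by rewrite subr_eq0.
case: r CF => [|r] CF.
  rewrite mul0r subr0; have [dF _] := Ck_elim CF i.
  have : is_derive x (delta_mx 0 i) F (divdiff 0 (partial i F) x).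
    by rewrite /divdiff (negbTE xi) /= expr0 divr1.
  apply: near_eq_is_derive; apply: filterS nz => y /negbTE yi.
  by rewrite /divdiff yi /= expr0 divr1.
have xr : (x 0 i - c) ^+ r.+1 != 0 by rewrite expf_neq0.
have d1 := is_derive_taylor_rem_i r x (CkW (isT : (1 <= r.+2)%N) CF).
have := is_derive_mul d1 (@is_derive_inv _ _ (fun y : 'rV[R]_n => (y 0 i - c) ^+ r.+1)
  x _ _ xr (is_derive_powi x r)).
move=> /is_derive_eq h.
apply: near_eq_is_derive (h _ _) => [|].
  by apply: filterS nz => y /negbTE yi; rewrite /divdiff yi.
rewrite /divdiff (negbTE xi) -[taylor_rem r.+2 F x]/(taylor_rem r.+1 F x - _) /=.
rewrite -iterSr -/(iter r.+1 _ _) factS natrM invfM !exprS.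
set a := x 0 i - c in xc *; set A := (X in X - _ * iter r (partial i) F (hproj x)).
by field; rewrite xc expf_neq0 //= nat1r !pnatr_eq0 -lt0n fact_gt0.
Qed.

(** The derivatives of a divided difference are again combinations of divided
differences, whose orders are balanced by the differentiability left. *)
Lemma Ck_divdiff k r F : Ck (k + r) F -> Ck k (divdiff r F).
Proof.
elim: k r F => [|k IH] r F CF; first by split=> //; exact: divdiff_continuous.
have CFr : Ck r.+1 F by apply: CkW CF; rewrite ltnS leq_addl.
apply: (@Ck_intro _ _ _ _ (fun j => if j == i
   then fun x => divdiff r (partial i F) x - r%:R * divdiff r.+1 F x
   else divdiff r (partial j F))) => [|j x|j].
- by apply: divdiff_continuous; exact: CkS.
- by case: eqVneq => [->|ji]; [exact: is_derive_divdiff_i|exact: is_derive_divdiff_j].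
- have Cj a : Ck (k + r) (partial a F) by have [] := Ck_elim CF a.
  case: eqVneq => [_|ji]; last exact: IH.
  apply/CkP => z; apply: Ck_nearB; first by move: z; apply/CkP; exact: IH.
  apply: Ck_nearM; first exact: Ck_near_cst.
  by move: z; apply/CkP; apply: IH; rewrite addnS.
Qed.

Lemma divdiff1E F x : F x = F (hproj x) + (x 0 i - c) * divdiff 1 F x.
Proof.
rewrite /divdiff; case: eqVneq => xi; first by rewrite hproj_id // xi subrr mul0r addr0.
rewrite /= expr0 fact0 invr1 !mul1r mulrC divfK ?subr_eq0 //.
by rewrite addrC subrK.
Qed.

End DividedDifferences.

(** * Hadamard's lemma *)

Section Hadamard.
Variables (R : realType) (D : forall n, set (set 'rV[R]_n)).
Hypothesis hD : o_minimal D.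
Variable n : nat.
Implicit Types (F : 'rV[R]_n -> R) (x z : 'rV[R]_n).

Lemma definable_hproj i c : definable_map D (@hproj R n i c).
Proof.
move=> k; under [X in definable_fun D X]funext do rewrite mxE [X in _ + X]mxE.
apply: (definableD hD); first exact: definable_coord.
apply: (definableM hD); last exact: definable_cst.
by apply: (definableB hD); [exact: definable_cst|exact: definable_coord].
Qed.

Lemma definable_divdiff1 i c F : definable_fun D F -> Ck 1 F ->
  definable_fun D (divdiff i c 1 F).
Proof.
move=> DF CF.
have Dq : definable_fun D (fun x : 'rV[R]_n => x 0 i - c).
  by apply: (definableB hD); [exact: definable_coord|exact: definable_cst].
apply: (definable_if hD).
- have := defset_eq0 hD Dq; apply: defset_ext => x /=.
  by split=> [/eqP|/eqP ->]; rewrite ?subrr // subr_eq0.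
- apply: (definableM hD); last exact: definable_cst.
  by apply: (definable_partial hD) => // x; have [dF _] := Ck_elim CF i; case: (dF x).
- apply: (definableM hD); last by apply: (definableV hD); exact: (definableX hD).
  apply: (definableB hD) => //=; apply: (definableM hD).
    by apply: (definableM hD); [apply: (definableX hD)|exact: definable_cst].
  exact: (definable_comp hD DF (@definable_hproj i c)).
Qed.

(** Hadamard's lemma. The coefficients are divided differences along the axes
and not integrals of derivatives, because an integral of a definable function
need not be definable. *)
Lemma hadamard k F z : definable_fun D F -> Ck k.+1 F ->
  exists q : 'I_n -> 'rV[R]_n -> R,
    (forall i, definable_fun D (q i) /\ Ck k (q i)) /\
    forall x, F x = F z + \sum_i (x 0 i - z 0 i) * q i x.
Proof.
move=> DF CF.
(* The coordinates listed in s are frozen to those of z one at a time. *)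
pose P (s : seq 'I_n) x := foldr (fun i y => hproj i (z 0 i) y) x s.
suff H : forall s F, definable_fun D F -> Ck k.+1 F ->
    exists q : 'I_n -> 'rV[R]_n -> R,
    (forall i, definable_fun D (q i) /\ Ck k (q i)) /\
    forall x, F x = F (P s x) + \sum_i (x 0 i - z 0 i) * q i x.
  have [q [Hq Fq]] := H (enum 'I_n) F DF CF; exists q; split=> // x.
  rewrite {1}Fq; congr (F _ + _); apply/rowP => j.
  have : j \in enum 'I_n by rewrite mem_enum.
  elim: (enum 'I_n) => // i s IH; rewrite inE /=.
  have [-> _|ji /= js] := eqVneq j i; first by rewrite hproj_i.
  by rewrite hproj_j // IH.
elim=> [|i s IH] {DF CF}F DF CF.
  exists (fun _ _ => 0); split=> [i|x].
    by split; [exact: definable_cst|apply/CkP => y; exact: Ck_near_cst].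
  by rewrite big1 ?addr0 // => i _; rewrite mulr0.
have DG := definable_comp hD DF (@definable_hproj i (z 0 i)).
have CG := @Ck_hproj _ _ i (z 0 i) _ _ CF.
have [q [Hq Gq]] := IH _ DG CG.
exists (fun j x => q j x + (j == i)%:R * divdiff i (z 0 i) 1 F x); split=> [j|x].
  have [Dj Cj] := Hq j; split.
    apply: (definableD hD) => //; apply: (definableM hD); first exact: definable_cst.
    by apply: definable_divdiff1 => //; apply: CkW CF.
  apply/CkP => y; apply: Ck_nearD; first by move: y; apply/CkP.
  apply: Ck_nearM; first exact: Ck_near_cst.
  by move: y; apply/CkP; apply: Ck_divdiff; rewrite addn1.
rewrite {1}(divdiff1E i (z 0 i) F x) Gq /= -addrA; congr (_ + _).
under [in RHS]eq_bigr do rewrite mulrDr.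
rewrite big_split /=; congr (_ + _).
rewrite (bigD1 i) //= eqxx mul1r big1 ?addr0 // => j /negbTE ->.
by rewrite mul0r mulr0.
Qed.

(** The difference quotient of F along the i-th axis at z is the value of q_i at the
shifted point. *)
Lemma is_derive_hadamard F z a (q : 'I_n -> 'rV[R]_n -> R) :
  (forall x, F x = a + \sum_i (x 0 i - z 0 i) * q i x) ->
  (forall i, {for z, continuous (q i)}) ->
  forall i, is_derive z (delta_mx 0 i) F (q i z).
Proof.
move=> Fq cq i; apply/is_derive_epsP => e e0.
have e20 : 0 < e / 2 by rewrite divr_gt0.
have /continuous_atP/(_ _ e20)/nbhs_ballP[d /= d0 Hd] := cq i.
exists d => // t t0 td.
have Fz : F z = a by rewrite Fq big1 ?addr0 // => j _; rewrite subrr mul0r.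
have -> : t^-1 * (F (t *: delta_mx 0 i + z) - F z) = q i (t *: delta_mx 0 i + z).
  rewrite Fz Fq addrAC subrr add0r (bigD1 i) //= big1 ?addr0 => [|j ji].
    by rewrite !mxE !eqxx mulr1 addrK mulKf.
  by rewrite !mxE (negbTE ji) andbF mulr0 add0r subrr mul0r.
apply: (@le_lt_trans _ _ (e / 2)); last by rewrite ltr_pdivrMr // ltr_pMr // ltr1n.
apply: Hd; rewrite -ball_normE /=; apply/(rV_norm_ltP _ d0) => k.
rewrite !mxE opprD addrCA subrr addr0 normrN normrM.
apply: le_lt_trans td; rewrite ler_piMr //.
by case: (_ && _); rewrite ?normr1 ?normr0.
Qed.

Lemma is_derive_sumr (I : Type) (s : seq I) (P : pred I) (f : I -> 'rV[R]_n -> R)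
    (df : I -> R) x v :
  (forall i, is_derive x v (f i) (df i)) ->
  is_derive x v (fun y => \sum_(i <- s | P i) f i y) (\sum_(i <- s | P i) df i).
Proof.
move=> Hd; elim: s => [|a s IH].
  under [X in is_derive _ _ X _]funext do rewrite big_nil.
  by rewrite big_nil; exact: is_derive_cst.
under [X in is_derive _ _ X _]funext do rewrite big_cons.
by rewrite big_cons; case Pa: (P a) => //; exact: is_derive_add.
Qed.

(** A function vanishing to first order at z is a quadratic form in x - z whose
coefficients lose two orders of differentiability, and whose value at z is
half the Hessian. *)
Lemma quadratic_representation k F z : definable_fun D F -> Ck k.+2 F ->
  F z = 0 -> (forall i, partial i F z = 0) ->
  exists B : 'I_n -> 'I_n -> 'rV[R]_n -> R,
  [/\ forall i j, definable_fun D (B i j) /\ Ck k (B i j),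
      forall i j x, B i j x = B j i x,
      forall x, F x = \sum_i \sum_j B i j x * (x 0 i - z 0 i) * (x 0 j - z 0 j) &
      forall i j, partial i (partial j F) z = 2 * B i j z].
Proof.
move=> DF CF Fz dFz.
have [q [Hq Fq]] := hadamard z DF CF.
have cont k' G : Ck k' G -> {for z, continuous G} by move=> /Ck_continuous/(_ z).
have qz i : q i z = 0.
  have [_ <-] := is_derive_hadamard Fq (fun i => cont _ _ (proj2 (Hq i))) i.
  exact: dFz.
have HB i : exists B : 'I_n -> 'rV[R]_n -> R,
    (forall j, definable_fun D (B j) /\ Ck k (B j)) /\
    forall x, q i x = q i z + \sum_j (x 0 j - z 0 j) * B j x.
  by have [Di Ci] := Hq i; exact: hadamard.
have [B0 HB0] := choice HB.
have qB i x : q i x = 0 + \sum_j (x 0 j - z 0 j) * B0 i j x.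
  by have [_ /(_ x)] := HB0 i; rewrite qz.
have dq i j : partial j (q i) z = B0 i j z.
  have [_ <-] // := is_derive_hadamard (qB i)
    (fun j => cont _ _ (proj2 (proj1 (HB0 i) j))) j.
have Cdq i j : Ck k (partial j (q i)) by have [_ Ci] := Hq i; have [] := Ck_elim Ci j.
(* The derivative of F is brought to Hadamard form with base value 0 as well, by
   expanding q_j; its derivatives at z can then be read off. *)
have dFE j x : partial j F x = 0 + \sum_i (x 0 i - z 0 i) * (B0 j i x + partial j (q i) x).
  have H : is_derive x (delta_mx 0 j) F
      (0 + \sum_i ((x 0 i - z 0 i) * partial j (q i) x + q i x * (j == i)%:R)).
    have FE : (fun x => F z + \sum_i (x 0 i - z 0 i) * q i x) = F by apply/funext => y.
    have HS : is_derive x (delta_mx 0 j) (fun x => \sum_i (x 0 i - z 0 i) * q i x)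
        (\sum_i ((x 0 i - z 0 i) * partial j (q i) x + q i x * (j == i)%:R)).
      apply: is_derive_sumr => i; apply: is_derive_mul.
        have := is_derive_add (is_derive_coord i j x)
          (is_derive_cst (- z 0 i) x (delta_mx 0 j)).
        by rewrite addr0.
      by have [_ Ci] := Hq i; have [dqi _] := Ck_elim Ci j; exact: dqi.
    by have := is_derive_add (is_derive_cst (F z) x (delta_mx 0 j)) HS; rewrite FE.
  rewrite /partial; have [_ ->] := H; congr (0 + _).
  rewrite big_split /= addrC (bigD1 j) //= eqxx mulr1 big1 => [|i ij]; last first.
    by rewrite eq_sym (negbTE ij) mulr0.
  rewrite addr0 qB add0r -big_split /=; apply: eq_bigr => i _.
  by rewrite mulrDr.
have ddF i j : partial i (partial j F) z = B0 j i z + B0 i j z.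
  have H := is_derive_hadamard (dFE j).
  have c a : {for z, continuous (fun x => B0 j a x + partial j (q a) x)}.
    apply: (@Ck_near_continuous _ _ k); apply: Ck_nearD.
      by move: (z); apply/CkP; have [/(_ a)[]] := HB0 j.
    by move: (z); apply/CkP.
  by rewrite /partial; have [_ ->] := H c i; rewrite -/(partial j (q i) z) dq.
exists (fun i j x => (B0 i j x + B0 j i x) / 2); split=> [i j|i j x|x|i j].
- have [Dij Cij] := proj1 (HB0 i) j; have [Dji Cji] := proj1 (HB0 j) i; split.
    by apply: (definableM hD); [exact: (definableD hD)|exact: definable_cst].
  apply/CkP => y; apply: Ck_nearM; last exact: Ck_near_cst.
  by apply: Ck_nearD; move: y; apply/CkP.
- by rewrite addrC.
- have S : F x = \sum_i \sum_j B0 i j x * (x 0 i - z 0 i) * (x 0 j - z 0 j).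
    rewrite Fq Fz add0r; apply: eq_bigr => i _; rewrite qB add0r big_distrr /=.
    by apply: eq_bigr => j _; ring.
  have S' : F x = \sum_i \sum_j B0 j i x * (x 0 i - z 0 i) * (x 0 j - z 0 j).
    by rewrite S exchange_big /=; apply: eq_bigr => i _; apply: eq_bigr => j _; ring.
  have -> : F x = (F x + F x) / 2 by field.
  rewrite {1}S S' -big_split /= big_distrl /=; apply: eq_bigr => i _.
  by rewrite -big_split /= big_distrl /=; apply: eq_bigr => j _; ring.
- by rewrite ddF; field.
Qed.

End Hadamard.

(** * Quadratic forms as sums of squares *)

Section CompletingSquares.
Variables (R : realType) (D : forall n, set (set 'rV[R]_n)).
Hypothesis hD : o_minimal D.

(** Completing the square in the first variable. *)
Lemma schur_identity d (b : 'I_d.+1 -> 'I_d.+1 -> R) (y : 'I_d.+1 -> R) :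
  (forall i j, b i j = b j i) -> b 0 0 != 0 ->
  \sum_i \sum_j b i j * y i * y j =
    b 0 0 * (y 0 + \sum_j b 0 (lift 0 j) / b 0 0 * y (lift 0 j)) ^+ 2
    + \sum_i \sum_j (b (lift 0 i) (lift 0 j)
        - b 0 (lift 0 i) * b 0 (lift 0 j) / b 0 0) * y (lift 0 i) * y (lift 0 j).
Proof.
move=> bC b0.
pose S := \sum_j b 0 (lift 0 j) * y (lift 0 j).
have -> : \sum_j b 0 (lift 0 j) / b 0 0 * y (lift 0 j) = S / b 0 0.
  by rewrite /S big_distrl /=; apply: eq_bigr => j _; ring.
have -> : \sum_i \sum_j (b (lift 0 i) (lift 0 j)
        - b 0 (lift 0 i) * b 0 (lift 0 j) / b 0 0) * y (lift 0 i) * y (lift 0 j) =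
   \sum_(i < d) \sum_(j < d) b (lift 0 i) (lift 0 j) * y (lift 0 i) * y (lift 0 j)
    - S ^+ 2 / b 0 0.
  rewrite expr2 {1}/S -mulrA big_distrl /= -sumrB; apply: eq_bigr => i _.
  rewrite /S big_distrl big_distrr /= -sumrB; apply: eq_bigr => j _.
  by ring.
rewrite big_ord_recl big_ord_recl /=.
have -> : \sum_(j < d) b 0 (lift 0 j) * y 0 * y (lift 0 j) = y 0 * S.
  by rewrite /S big_distrr /=; apply: eq_bigr => j _; ring.
have -> : \sum_(i < d) \sum_j b (lift 0 i) j * y (lift 0 i) * y j =
   y 0 * S + \sum_(i < d) \sum_(j < d) b (lift 0 i) (lift 0 j) * y (lift 0 i) * y (lift 0 j).
  rewrite {1}/S big_distrr -big_split /=; apply: eq_bigr => i _.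
  by rewrite big_ord_recl (bC (lift 0 i) 0); congr (_ + _); ring.
by field.
Qed.

(** The pivots stay positive near z, so completing squares one variable at a
time only involves divisions and square roots that are smooth near z. The last
clause, positive definiteness near z, is used to isolate the zeros of f. *)
Lemma sum_of_squares_quadratic n k (z : 'rV[R]_n) d
    (B : 'I_d -> 'I_d -> 'rV[R]_n -> R) (y : 'I_d -> 'rV[R]_n -> R) :
  (forall i j x, B i j x = B j i x) ->
  (forall i j, definable_fun D (B i j) /\ Ck_near k (B i j) z) ->
  (forall i, definable_fun D (y i) /\ Ck_near k (y i) z) ->
  (forall v : 'I_d -> R, (exists i, v i != 0) ->
     0 < \sum_i \sum_j B i j z * v i * v j) ->
  exists q : 'I_d -> 'rV[R]_n -> R,
    (forall i, definable_fun D (q i) /\ Ck_near k (q i) z) /\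
    \forall x \near z,
      \sum_i \sum_j B i j x * y i x * y j x = \sum_i q i x ^+ 2 /\
      ((forall i, q i x = 0) -> forall i, y i x = 0).
Proof.
elim: d B y => [|d IH] B y BC HB Hy PD.
  exists (fun _ _ => 0); split=> [[]//|].
  by near=> x; rewrite !big_ord0; split=> // _ [].
have b0 : 0 < B 0 0 z.
  have := PD (fun i => (i == 0)%:R); rewrite big_ord_recl big_ord_recl /=.
  rewrite !mulr1 big1 ?addr0 => [|i _]; last by rewrite mulr0.
  rewrite big1 ?addr0 => [|i _]; last by rewrite big1 // => j _; rewrite mulr0 mul0r.
  by apply; exists 0; rewrite eqxx oner_eq0.
have [DB0 CB0] := HB 0 0.
have DV : definable_fun D (fun x => (B 0 0 x)^-1) by exact: definableV.
have CV : Ck_near k (fun x => (B 0 0 x)^-1) z by apply: Ck_nearV; rewrite ?gt_eqF.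
pose B' i j x := B (lift 0 i) (lift 0 j) x - B 0 (lift 0 i) x * B 0 (lift 0 j) x / B 0 0 x.
have [|||w [i wi]|q [Hq Eq]] := IH B' (fun i => y (lift 0 i)).
- by move=> i j x; rewrite /B' BC [_ * B 0 (lift 0 j) x]mulrC.
- move=> i j; have [D1 C1] := HB (lift 0 i) (lift 0 j).
  have [D2 C2] := HB 0 (lift 0 i); have [D3 C3] := HB 0 (lift 0 j); split.
    by apply: (definableB hD) => //; do 2!apply: (definableM hD) => //.
  by apply: Ck_nearB => //; do 2!apply: Ck_nearM => //.
- by move=> i.
  (* The first coordinate of v makes the completed square vanish. *)
- pose v (a : 'I_d.+1) := if unlift 0 a is Some j then w j
    else - \sum_j B 0 (lift 0 j) z / B 0 0 z * w j.
  have vl j : v (lift 0 j) = w j by rewrite /v liftK.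
  have v0 : v 0 = - \sum_j B 0 (lift 0 j) z / B 0 0 z * w j by rewrite /v unlift_none.
  have := PD v; rewrite (@schur_identity _ (fun i j => B i j z)) ?gt_eqF //.
  rewrite v0; under [X in - _ + X]eq_bigr do rewrite vl.
  rewrite addNr expr0n mulr0 add0r.
  under eq_bigr do under eq_bigr do rewrite !vl.
  by apply; exists (lift 0 i); rewrite vl.
pose q0 x := Num.sqrt (B 0 0 x) *
   (y 0 x + \sum_j B 0 (lift 0 j) x / B 0 0 x * y (lift 0 j) x).
exists (fun a => if unlift 0 a is Some j then q j else q0); split=> [a|].
  case: unliftP => [j _|_]; first exact: Hq.
  have [Dy Cy] := Hy 0; split.
    apply: (definableM hD); first exact: (definable_sqrt hD).
    apply: (definableD hD) => //; apply: (definable_sum hD) => j _.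
    have [D2 _] := HB 0 (lift 0 j); have [Dyj _] := Hy (lift 0 j).
    by do 2!apply: (definableM hD) => //.
  apply: Ck_nearM; first exact: Ck_near_sqrt.
  apply: Ck_nearD => //; apply: Ck_near_sum => j _.
  have [_ C2] := HB 0 (lift 0 j); have [_ Cyj] := Hy (lift 0 j).
  by do 2!apply: Ck_nearM => //.
have b0x := near_cont_gt (Ck_near_continuous CB0) b0.
apply: filterS2 Eq b0x => x [E E0] {}b0.
split.
  rewrite [RHS]big_ord_recl unlift_none.
  rewrite (@schur_identity _ (fun i j => B i j x) (fun i => y i x)) ?gt_eqF //.
  rewrite exprMn sqr_sqrtr ?ltW // -/(q0 x); congr (_ + _).
  by rewrite E; apply: eq_bigr => i _; rewrite liftK.
move=> H a.
have yl j : y (lift 0 j) x = 0.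
  by apply: E0 => i; have := H (lift 0 i); rewrite liftK.
case: (unliftP 0 a) => [j ->|->]; first exact: yl.
have /eqP := H 0; rewrite unlift_none /q0 mulf_eq0 sqrtr_eq0 leNgt b0 /=.
by rewrite big1 ?addr0 => [/eqP|j _]; rewrite ?yl ?mulr0.
Unshelve. all: by end_near. Qed.

End CompletingSquares.

(** * Penalty weights *)

Section Penalty.
Variable R : realType.

Lemma penalty_denom_gt0 (a w : R) : 0 <= w -> (w = 0 -> 0 < a) ->
  0 < Num.sqrt (a ^+ 2 + w ^+ 2) + a.
Proof.
move=> w0 aw; have [a0|a0] := ltP 0 a.
  by apply: ltr_wpDl => //; exact: sqrtr_ge0.
have {}w0 : 0 < w.
  by rewrite lt_neqAle w0 andbT eq_sym; apply/eqP => /aw; rewrite ltNge a0.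
rewrite -ltrBlDr sub0r -(ler0_norm a0) -sqrtr_sqr ltr_sqrt.
  by rewrite ltrDl exprn_gt0.
by rewrite ltr_wpDl ?exprn_gt0 // sqr_ge0.
Qed.

Lemma penalty_radicand_gt0 (a w : R) : (w = 0 -> 0 < a) -> 0 < a ^+ 2 + w ^+ 2.
Proof.
move=> aw; have [w0|w0] := eqVneq w 0.
  by rewrite ltr_pwDl ?sqr_ge0 ?exprn_gt0 ?aw.
by rewrite ltr_wpDl ?sqr_ge0 // exprn_even_gt0 //= orbT.
Qed.

(** A weight that makes a positive by adding a multiple of w, given by one formula
that is smooth wherever a or w is positive. *)
Lemma penalty_identity (a w : R) : 0 <= w -> (w = 0 -> 0 < a) ->
  a + w / (Num.sqrt (a ^+ 2 + w ^+ 2) + a) * w = Num.sqrt (a ^+ 2 + w ^+ 2).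
Proof.
move=> w0 aw; have d0 := penalty_denom_gt0 w0 aw.
have s2 : Num.sqrt (a ^+ 2 + w ^+ 2) ^+ 2 = a ^+ 2 + w ^+ 2.
  by rewrite sqr_sqrtr // addr_ge0 ?sqr_ge0.
set s := Num.sqrt _ in d0 s2 *.
have {}s2 : w * w = (s - a) * (s + a) by rewrite -subr_sqr s2; ring.
by rewrite mulrAC s2 mulfK ?gt_eqF //; ring.
Qed.

(** The explicit weight is continuous on K, hence bounded. *)
Lemma penalty_compact n (K : set 'rV[R]_n) (a w : 'rV[R]_n -> R) : compact K ->
  Ck 0 a -> Ck 0 w -> (forall x, 0 <= w x) -> (forall x, K x -> w x = 0 -> 0 < a x) ->
  exists2 M, 0 <= M & forall x, K x -> 0 < a x + M * w x.
Proof.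
move=> cK /CkP Ca /CkP Cw w0 aw.
have [[x0 Kx0]|K0] := pselect (K !=set0); last first.
  by exists 0 => // x Kx; exfalso; apply: K0; exists x.
pose mu x := w x / (Num.sqrt (a x ^+ 2 + w x ^+ 2) + a x).
have mu0 x : K x -> 0 <= mu x.
  by move=> Kx; rewrite divr_ge0 // ltW // penalty_denom_gt0 //; exact: aw.
have cmu : {within K, continuous mu}.
  rewrite continuous_subspace_in => x; rewrite inE => Kx.
  apply: continuous_subspaceT_for => //.
  apply: (@Ck_near_continuous _ _ 0); apply: Ck_nearM => //.
  apply: Ck_nearV; first by rewrite gt_eqF // penalty_denom_gt0 //; exact: aw.
  apply: Ck_nearD => //; apply: Ck_near_sqrt.
    by apply: penalty_radicand_gt0; exact: aw.
  by apply: Ck_nearD; apply: Ck_nearX.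
have [c] := EVT_max_rV (ex_intro _ x0 Kx0) cK cmu; rewrite inE => Kc max_c.
exists (mu c + 1) => [|x Kx]; first by rewrite addr_ge0 ?mu0.
have := penalty_identity (w0 x) (aw x Kx); rewrite -/(mu x) => E.
have mux : mu x <= mu c by apply: max_c; rewrite inE.
apply: (@lt_le_trans _ _ (a x + mu x * w x + w x)); last first.
  by rewrite mulrDl mul1r -addrA lerD2l lerD2r ler_wpM2r.
by rewrite E ltr_pwDl // sqrtr_gt0; apply: penalty_radicand_gt0; exact: aw.
Qed.

Lemma norm_sub_continuous n (z : 'rV[R]_n) : continuous (fun x : 'rV[R]_n => `|x - z|).
Proof.
move=> x; have ci : {for x, continuous (fun y : 'rV[R]_n => y)} by exact: cvg_id.
have cc : {for x, continuous (fun _ : 'rV[R]_n => z)} by exact: cst_continuous.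
exact: cvg_norm (continuousB ci cc).
Qed.

Lemma compact_cball n (z : 'rV[R]_n) e : compact [set x : 'rV[R]_n | `|x - z| <= e].
Proof.
apply: bounded_closed_compact.
  exists (`|z| + e); split; first exact: num_real.
  move=> M HM x /= xe; apply: ltW; apply: le_lt_trans HM.
  by rewrite -(subrK z x) addrC (le_trans (ler_normD _ _)) // lerD2l.
have -> : [set x : 'rV[R]_n | `|x - z| <= e] =
    (fun x : 'rV[R]_n => `|x - z|) @^-1` [set y | y <= e] by [].
apply: closed_comp; last exact: closed_le.
by move=> x _; exact: norm_sub_continuous.
Qed.

Lemma compact_sphere n (z : 'rV[R]_n) e : compact [set x : 'rV[R]_n | `|x - z| = e].
Proof.
apply: subclosed_compact (@compact_cball n z e) _ => [|x /= ->//].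
have -> : [set x : 'rV[R]_n | `|x - z| = e] =
    (fun x : 'rV[R]_n => `|x - z|) @^-1` [set e] by [].
apply: closed_comp; last exact: closed_eq.
by move=> x _; exact: norm_sub_continuous.
Qed.

Lemma is_derive_local_min n (F : 'rV[R]_n -> R) c v l :
  (\forall x \near c, F c <= F x) -> is_derive c v F l -> l = 0.
Proof.
move=> Fc /is_derive_epsP dF.
have ct : {for 0, continuous (fun t : R => t *: v + c)}.
  have ci : {for 0, continuous (fun t : R => t)} by exact: cvg_id.
  have cc : {for 0, continuous (fun _ : R => c)} by exact: cst_continuous.
  exact: continuousD (continuousZr_tmp (a := v) ci) cc.
have : \forall t \near (0 : R), F c <= F (t *: v + c).
  have Fc' : nbhs (0 *: v + c) [set x | F c <= F x] by rewrite scale0r add0r.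
  exact: ct Fc'.
move=> /nbhs_ballP[r /= r0 Hr].
apply/eqP/negPn/negP => l0.
have [d d0 Hd] := dF `|l| (ltac:(by rewrite normr_gt0)).
pose t := - Num.sg l * (Num.min d r / 2).
have m0 : 0 < Num.min d r / 2 by rewrite divr_gt0 // lt_min d0.
have tn : `|t| = Num.min d r / 2.
  by rewrite normrM normrN normr_sg l0 mul1r gtr0_norm.
have tm : `|t| < Num.min d r by rewrite tn ltr_pdivrMr // ltr_pMr ?ltr1n // lt_min d0.
move: tm; rewrite lt_min => /andP[td tr].
have t0 : t != 0 by rewrite -normr_gt0 tn.
have := Hd t t0 td.
have : 0 <= F (t *: v + c) - F c.
  by rewrite subr_ge0; apply: Hr; rewrite -ball_normE /= sub0r normrN.
set q := F _ - F c => q0.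
(* the quotient has the sign of t, opposite to the sign of l *)
have sg2 : Num.sg l * Num.sg l = 1 by rewrite -expr2 sqr_sg l0.
have lE : l = Num.sg l * `|l| by exact: numEsg.
have -> : l - t^-1 * q = Num.sg l * (`|l| + q / (Num.min d r / 2)).
  have sV : (Num.sg l)^-1 = Num.sg l.
    have sn0 : Num.sg l != 0 by rewrite sgr_eq0.
    by apply: (mulfI sn0); rewrite sg2 mulfV.
  have -> : t^-1 = - Num.sg l / (Num.min d r / 2) by rewrite /t invfM invrN sV.
  by rewrite {1}lE; ring.
rewrite normrM normr_sg l0 mul1r ltNge => /negP; apply.
have p0 : 0 <= q / (Num.min d r / 2) by rewrite divr_ge0 // ltW.
by rewrite ger0_norm ?lerDl // addr_ge0.
Qed.

End Penalty.

(** * Limits of approximate multipliers *)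

Lemma ler_vanishing (R : realFieldType) (x K e0 : R) : 0 < e0 -> 0 <= K ->
  (forall e, 0 < e -> e <= e0 -> x <= e * K) -> x <= 0.
Proof.
move=> e00 K0 H; rewrite leNgt; apply/negP => x0.
pose e := Num.min e0 (x / (2 * (K + 1))).
have K1 : 0 < K + 1 by rewrite ltr_wpDl.
have e1 : 0 < e by rewrite lt_min e00 divr_gt0 // mulr_gt0.
have ee0 : e <= e0 by rewrite ge_min lexx.
have := H e e1 ee0; apply/negP; rewrite -ltNge.
apply: (@le_lt_trans _ _ (x / (2 * (K + 1)) * (K + 1))).
  apply: ler_pM => //; [exact: ltW| |by rewrite lerDl].
  by rewrite ge_min lexx orbT.
by rewrite invfM mulrA mulfVK ?gt_eqF // ltr_pdivrMr // ltr_pMr // ltr1n.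
Qed.

(** Approximate multipliers for approximate gradients converge, because a dual
basis of the limit gradients computes them up to a controlled error. *)
Lemma multipliers_limit (R : realFieldType) (I : finType) n (u : I -> 'I_n -> R)
    (L : I -> 'I_n -> R) (b0 : 'I_n -> R) (A B : pred I) (e0 : R) :
  0 < e0 ->
  (forall s t, A s -> A t -> \sum_k L t k * u s k = (s == t)%:R) ->
  (forall e, 0 < e -> e <= e0 -> exists (u' : I -> 'I_n -> R) (mu : I -> R),
     [/\ forall s k, `|u' s k - u s k| <= e,
         forall k, `|\sum_s mu s * u' s k - b0 k| <= e,
         forall s, ~~ A s -> mu s = 0 &
         forall s, B s -> 0 <= mu s]) ->
  exists c : I -> R,
    [/\ forall k, b0 k = \sum_s c s * u s k,
        forall s, ~~ A s -> c s = 0 &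
        forall s, B s -> 0 <= c s].
Proof.
move=> e00 dual H.
pose c t := if A t then \sum_k L t k * b0 k else 0.
pose La := 1 + \sum_t \sum_k `|L t k|.
have La1 : 1 <= La by rewrite lerDl; do 2!apply: sumr_ge0 => ? _.
have La0 : 0 < La by apply: lt_le_trans La1.
pose C := \sum_t `|c t|.
have C0 : 0 <= C by apply: sumr_ge0.
pose m0 : R := #|I|%:R.
have m00 : 0 <= m0 by rewrite ler0n.
pose N0 := 2 * C + 1.
have N00 : 0 <= N0 by rewrite /N0; lra.
pose K := La * (N0 + 1).
have K0 : 0 <= K by apply: mulr_ge0; [exact: ltW La0|exact: addr_ge0].
(* For e <= e1 the error in the sum N of the |mu s| is at most half of N + 1, so
   that N is bounded independently of e. *)
pose e1 := Num.min e0 (2 * (m0 * La + 1))^-1.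
have mL0 : 0 <= m0 * La by apply: mulr_ge0 => //; exact: ltW La0.
have e10 : 0 < e1 by rewrite lt_min e00 invr_gt0 mulr_gt0 // ltr_wpDl.
have key e : 0 < e -> e <= e1 -> exists (u' : I -> 'I_n -> R) (mu : I -> R),
     [/\ [/\ forall s k, `|u' s k - u s k| <= e,
         forall k, `|\sum_s mu s * u' s k - b0 k| <= e,
         forall s, ~~ A s -> mu s = 0 &
         forall s, B s -> 0 <= mu s],
       \sum_s `|mu s| <= N0 & forall t, `|mu t - c t| <= e * K].
  move=> e_gt0; rewrite le_min => /andP[ee0 ee1].
  have [u' [mu [Hu Hb HA HB]]] := H e e_gt0 ee0.
  exists u', mu; set N := \sum_s `|mu s|.
  have N_ge0 : 0 <= N by apply: sumr_ge0.
  have err t : `|mu t - c t| <= e * La * (N + 1).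
    have rhs0 : 0 <= e * La * (N + 1).
      by rewrite (mulr_ge0 (mulr_ge0 (ltW e_gt0) (ltW La0))) // addr_ge0.
    rewrite /c; case: ifP => At; last by rewrite HA ?At // subrr normr0.
    have -> : mu t - \sum_k L t k * b0 k = \sum_k L t k *
        ((\sum_s mu s * u' s k - b0 k) - \sum_s mu s * (u' s k - u s k)).
      have -> : mu t = \sum_s mu s * \sum_k L t k * u s k.
        rewrite (bigD1 t) //= dual // eqxx mulr1 big1 ?addr0 // => s st.
        have [As|/HA ->] := boolP (A s); last by rewrite mul0r.
        by rewrite dual // (negbTE st) mulr0.
      under eq_bigr do rewrite big_distrr /=.
      rewrite exchange_big -sumrB /=; apply: eq_bigr => k _.
      rewrite addrAC -sumrB mulrBr; congr (_ - _).
      by rewrite big_distrr /=; apply: eq_bigr => s _; ring.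
    apply: le_trans (ler_norm_sum _ _ _) _.
    apply: (@le_trans _ _ (\sum_k `|L t k| * (e * (N + 1)))).
      apply: ler_sum => k _; rewrite normrM; apply: ler_wpM2l => //.
      apply: le_trans (ler_normB _ _) _; rewrite mulrDr mulr1 addrC lerD //.
      apply: le_trans (ler_norm_sum _ _ _) _; rewrite /N big_distrr /=.
      by apply: ler_sum => s _; rewrite normrM mulrC ler_wpM2r.
    rewrite -big_distrl /= (_ : e * La * (N + 1) = La * (e * (N + 1))); last by ring.
    apply: ler_wpM2r; first by rewrite (mulr_ge0 (ltW e_gt0)) // addr_ge0.
    apply: ler_wpDl => //; rewrite (bigD1 t) //= lerDl.
    by do 2!apply: sumr_ge0 => ? _.
  have NN0 : N <= N0.
    have h1 : N <= C + m0 * (e * La * (N + 1)).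
      apply: (@le_trans _ _ (\sum_t (`|c t| + e * La * (N + 1)))).
        apply: ler_sum => t _; rewrite -{1}(subrK (c t) (mu t)) addrC.
        by apply: le_trans (ler_normD _ _) _; rewrite lerD2l.
      by rewrite big_split /= sumr_const -[_ *+ _]mulr_natl.
    have h2 : m0 * (e * La * (N + 1)) <= (N + 1) / 2.
      have -> : m0 * (e * La * (N + 1)) = (m0 * La * e) * (N + 1) by ring.
      rewrite [leRHS]mulrC; apply: ler_wpM2r; first by rewrite addr_ge0.
      apply: (@le_trans _ _ ((m0 * La + 1) * (2 * (m0 * La + 1))^-1)).
        apply: ler_pM => //; [exact: ltW|by rewrite lerDl].
      by rewrite invfM mulrCA mulfV ?mulr1 // gt_eqF // ltr_wpDl.
    by rewrite /N0; lra.
  split=> // t; apply: le_trans (err t) _.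
  rewrite /K -mulrA; apply: ler_wpM2l; first exact: ltW.
  by apply: ler_wpM2l; [exact: ltW|rewrite lerD2r].
exists c; split=> [k|s|s Bs].
- apply/eqP; rewrite -subr_eq0 -normr_le0.
  pose U := \sum_s `|u s k|.
  have U0 : 0 <= U by apply: sumr_ge0.
  apply: (@ler_vanishing _ _ (1 + N0 + K * U) _ e10).
    by rewrite !addr_ge0 // mulr_ge0.
  move=> e e_gt0 /(key _ e_gt0)[u' [mu [[Hu Hb HA HB] HN Hc]]].
  have -> : b0 k - \sum_s c s * u s k = - (\sum_s mu s * u' s k - b0 k)
     + (\sum_s mu s * (u' s k - u s k) + \sum_s (mu s - c s) * u s k).
    have -> : \sum_s mu s * (u' s k - u s k) =
        \sum_s mu s * u' s k - \sum_s mu s * u s k.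
      by rewrite -sumrB; apply: eq_bigr => s _; ring.
    have -> : \sum_s (mu s - c s) * u s k =
        \sum_s mu s * u s k - \sum_s c s * u s k.
      by rewrite -sumrB; apply: eq_bigr => s _; ring.
    by ring.
  rewrite (_ : e * (1 + N0 + K * U) = e + (e * N0 + e * (K * U))); last by ring.
  apply: le_trans (ler_normD _ _) _; rewrite normrN.
  apply: lerD => //; apply: le_trans (ler_normD _ _) _; apply: lerD.
    apply: le_trans (ler_norm_sum _ _ _) _.
    apply: (@le_trans _ _ (e * \sum_s `|mu s|)); last by rewrite ler_pM2l.
    rewrite big_distrr /=; apply: ler_sum => s _.
    by rewrite normrM mulrC ler_wpM2r.
  apply: le_trans (ler_norm_sum _ _ _) _; rewrite mulrA /U big_distrr /=.
  by apply: ler_sum => s _; rewrite normrM ler_wpM2r.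
- by rewrite /c => /negbTE ->.
- rewrite -oppr_le0; apply: (@ler_vanishing _ _ K _ e10) => // e e_gt0.
  move=> /(key _ e_gt0)[u' [mu [[_ _ _ HB] _ Hc]]].
  apply: le_trans (Hc s); apply: le_trans (ler_norm _).
  by rewrite addrC lerDl HB.
Qed.

(** * Existence of Lagrange multipliers *)

Section Multipliers.
Variables (R : realType) (n l m : nat) (f : 'rV[R]_n -> R).
Variables (g : 'I_l -> 'rV[R]_n -> R) (h : 'I_m -> 'rV[R]_n -> R).

Definition constraint (s : 'I_l + 'I_m) : 'rV[R]_n -> R :=
  match s with inl i => g i | inr j => h j end.

Definition active_index (z : 'rV[R]_n) (s : 'I_l + 'I_m) : bool :=
  match s with inl i => active g z i | inr _ => true end.

(** The coordinates with respect to a free family form a dual basis of it. *)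
Lemma regular_dual z : regular_at g h z ->
  exists L : 'I_l + 'I_m -> 'I_n -> R, forall s t,
    active_index z s -> active_index z t ->
    \sum_k L t k * partial k (constraint s) z = (s == t)%:R.
Proof.
pose idx := [seq inl i | i <- enum (active g z)] ++ [seq inr j | j <- enum 'I_m]
  : seq ('I_l + 'I_m).
pose u s := gradient (constraint s) z.
have idxP s : active_index z s -> s \in idx.
  rewrite mem_cat; case: s => [i|j] /= H; apply/orP; [left|right];
    by apply: map_f; rewrite mem_enum.
have uniq_idx : uniq idx.
  rewrite cat_uniq; apply/and3P; split.
  - by rewrite map_inj_uniq ?enum_uniq // => ? ? [].
  - by apply/hasPn => _ /mapP[j _ ->]; apply/mapP => -[].
  - by rewrite map_inj_uniq ?enum_uniq // => ? ? [].
rewrite /regular_at; set X := _ ++ _.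
have -> : X = map u idx by rewrite /X map_cat -!map_comp.
move=> fX; pose Xt := in_tuple (map u idx).
have sX : size (map u idx) = size idx by rewrite size_map.
pose L t k := if insub (index t idx) is Some i
   then coord Xt i (delta_mx 0 k) else 0.
exists L => s t As At.
have lt_idx a : active_index z a -> (index a idx < size (map u idx))%N.
  by move=> Aa; rewrite sX index_mem; exact: idxP.
have LE k : L t k = coord Xt (Ordinal (lt_idx t At)) (delta_mx 0 k).
  rewrite /L; case: insubP => [i _ ei|]; last by rewrite lt_idx.
  by congr (coord Xt _ _); exact: val_inj.
under eq_bigr do rewrite LE.
transitivity (coord Xt (Ordinal (lt_idx t At)) (u s)).
  rewrite (row_sum_delta (u s)) linear_sum /=; apply: eq_bigr => k _.
  by rewrite linearZ /= mxE mulrC.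
have -> : u s = Xt`_(Ordinal (lt_idx s As)).
  by rewrite /= (nth_map s) ?nth_index // ?index_mem; exact: idxP.
rewrite coord_free // -val_eqE /=; congr (_%:R); congr nat_of_bool.
by apply/eqP/eqP => [e|-> //]; rewrite -(nth_index s (idxP s As)) e nth_index ?idxP.
Qed.

Definition dist2 (z x : 'rV[R]_n) := \sum_k (x 0 k - z 0 k) ^+ 2.

(** The exponent is a parameter because it governs the differentiability of the
truncated powers. *)
Definition infeasibility e (x : 'rV[R]_n) :=
  \sum_i Num.max 0 (- g i x) ^+ e.+1 + \sum_j h j x ^+ 2.

Lemma infeasibility_ge0 e x : 0 <= infeasibility e x.
Proof.
by rewrite addr_ge0 //; apply: sumr_ge0 => ? _;
  [rewrite exprn_ge0 // le_max lexx|exact: sqr_ge0].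
Qed.

Lemma infeasibility_eq0 e x : infeasibility e x = 0 <-> feasible g h x.
Proof.
have g0 i : 0 <= Num.max 0 (- g i x) ^+ e.+1 by rewrite exprn_ge0 // le_max lexx.
split=> [/eqP|[Hg Hh]]; last first.
  rewrite /infeasibility !big1 ?addr0 // => [j|i] _; first by rewrite Hh expr0n.
  by rewrite max_l ?oppr_le0 // expr0n.
rewrite paddr_eq0; try by apply: sumr_ge0 => ? _; rewrite ?sqr_ge0.
rewrite !psumr_eq0 => [/andP[/allP {}Hg /allP Hh]|? _|? _] //; last exact: sqr_ge0.
split=> [i|j].
  have := Hg i (mem_index_enum i); rewrite expf_eq0 /= => /eqP mx.
  by rewrite leNgt; apply/negP => gi; move: mx; rewrite max_r ?oppr_ge0 ?ltW // => /eqP;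
    rewrite oppr_eq0 lt_eqF.
by have := Hh j (mem_index_enum j); rewrite sqrf_eq0 => /eqP.
Qed.

Lemma dist2_ge0 z x : 0 <= dist2 z x.
Proof. by apply: sumr_ge0 => ? _; exact: sqr_ge0. Qed.

Lemma dist2_eq0 z x : dist2 z x = 0 -> x = z.
Proof.
move=> /eqP; rewrite psumr_eq0 => [/allP H|? _]; last exact: sqr_ge0.
apply/rowP => k; have := H k (mem_index_enum k).
by rewrite sqrf_eq0 subr_eq0 => /eqP.
Qed.

Lemma Ck_dist2 k z : Ck k (dist2 z).
Proof.
apply/CkP => x; apply: Ck_near_sum => i _; apply: Ck_nearX.
by apply: Ck_nearB; [exact: Ck_near_coord|exact: Ck_near_cst].
Qed.

Lemma Ck_infeasibility k e : (k <= e)%N ->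
  (forall i, Ck k (g i)) -> (forall j, Ck k (h j)) -> Ck k (infeasibility e).
Proof.
move=> ke Cg Ch; apply/CkP => x; apply: Ck_nearD; apply: Ck_near_sum => i _.
  by apply: Ck_near_max0X => //; apply: Ck_nearN; move: x; apply/CkP.
by apply: Ck_nearX; move: x; apply/CkP.
Qed.

Hypotheses (Cf : Ck 1 f) (Cg : forall i, Ck 1 (g i)) (Ch : forall j, Ck 1 (h j)).

(** Minimizing f + |x - z|^2 plus a large multiple of the infeasibility on a
small ball gives an interior minimizer near z; the derivatives of the penalty
there are the approximate multipliers. *)
Lemma approximate_KKT z e : feasible g h z -> f z = 0 ->
  (forall x, feasible g h x -> 0 <= f x) -> 0 < e ->
  exists c (lam : 'I_l -> R) (nu : 'I_m -> R),
    [/\ `|c - z| < e, forall i, 0 <= lam i, forall i, 0 < g i c -> lam i = 0 &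
    forall k, partial k f c + 2 * (c 0 k - z 0 k) =
       \sum_i lam i * partial k (g i) c + \sum_j nu j * partial k (h j) c].
Proof.
move=> Sz fz f0 e0.
have Ca : Ck 1 (fun x => f x + dist2 z x).
  by apply/CkP => x; apply: Ck_nearD; move: x; apply/CkP => //; exact: Ck_dist2.
have Cw : Ck 1 (infeasibility 1) by exact: Ck_infeasibility.
have [|M M0 HM] := penalty_compact (@compact_sphere R n z e) (CkS Ca) (CkS Cw)
  (infeasibility_ge0 1).
  move=> x xe /infeasibility_eq0 /f0 fx0; rewrite ltr_wpDl //.
  rewrite lt_neqAle dist2_ge0 andbT eq_sym; apply/eqP => /dist2_eq0 xz.
  by move: xe e0; rewrite /= xz subrr normr0 => <-; rewrite ltxx.
pose Phi x := f x + dist2 z x + M * infeasibility 1 x.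
have CPhi : Ck 1 Phi.
  apply/CkP => x; apply: Ck_nearD; first by move: x; apply/CkP.
  by apply: Ck_nearM; [exact: Ck_near_cst|move: x; apply/CkP].
(* Phi vanishes at z and is positive on the sphere, so its minimum on the ball is
   attained in the interior. *)
have Phiz : Phi z = 0.
  rewrite /Phi fz (infeasibility_eq0 1 z).2 // mulr0 addr0 add0r.
  by apply: big1 => k _; rewrite subrr expr0n.
have K0 : [set x : 'rV[R]_n | `|x - z| <= e] !=set0.
  by exists z; rewrite /= subrr normr0 ltW.
have cPhi : {within [set x : 'rV[R]_n | `|x - z| <= e], continuous Phi}.
  by apply: continuous_subspaceT => x; exact: (Ck_continuous CPhi x).
have [c] := EVT_min_rV K0 (@compact_cball R n z e) cPhi; rewrite inE /= => ce Hc.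
have Phic : Phi c <= 0 by rewrite -Phiz; apply: Hc; rewrite inE /= subrr normr0 ltW.
have {}ce : `|c - z| < e.
  rewrite lt_neqAle ce andbT; apply/eqP => /HM.
  by rewrite ltNge Phic.
have near_min : \forall x \near c, Phi c <= Phi x.
  have : \forall x \near c, `|x - z| < e.
    have cN : {for c, continuous (fun x : 'rV[R]_n => `|x - z|)}.
      exact: norm_sub_continuous.
    exact: (cN _ (lt_nbhsl ce)).
  by apply: filterS => x xe; apply: Hc; rewrite inE /= ltW.
exists c, (fun i => 2 * M * Num.max 0 (- g i c)), (fun j => - 2 * M * h j c).
split=> // [i|i gi|k].
- by rewrite mulr_ge0 ?mulr_ge0 // le_max lexx.
- by rewrite max_l ?mulr0 // oppr_le0 ltW.
have dg i : is_derive c (delta_mx 0 k) (fun x => Num.max 0 (- g i x) ^+ 2)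
    (2 * Num.max 0 (- g i c) * - partial k (g i) c).
  have [dgi _] := Ck_elim (Cg i) k.
  by have := is_derive_comp1 (is_derive_opp (dgi c)) (is_derive_max0X 0 _); rewrite expr1.
have dh j : is_derive c (delta_mx 0 k) (fun x => h j x ^+ 2)
    (2 * h j c * partial k (h j) c).
  have [dhj _] := Ck_elim (Ch j) k.
  by have := is_derive_comp1 (dhj c) (is_derive_expn 1 _); rewrite expr1.
have dd : is_derive c (delta_mx 0 k) (dist2 z) (2 * (c 0 k - z 0 k)).
  have da a : is_derive c (delta_mx 0 k) (fun x : 'rV[R]_n => (x 0 a - z 0 a) ^+ 2)
      (2 * (c 0 a - z 0 a) * (k == a)%:R).
    have d1 := is_derive_add (is_derive_coord a k c) (is_derive_cst (- z 0 a) c (delta_mx 0 k)).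
    by have := is_derive_comp1 d1 (is_derive_expn 1 _); rewrite expr1 addr0.
  have := is_derive_sumr (index_enum 'I_n) xpredT da.
  rewrite (bigD1 k) //= eqxx mulr1 big1 ?addr0 // => a ak.
  by rewrite eq_sym (negbTE ak) mulr0.
have [df _] := Ck_elim Cf k.
have dw := is_derive_add (is_derive_sumr (index_enum 'I_l) xpredT dg)
  (is_derive_sumr (index_enum 'I_m) xpredT dh).
have dPhi := is_derive_add (is_derive_add (df c) dd)
  (is_derive_mul (is_derive_cst M c (delta_mx 0 k)) dw).
have := is_derive_local_min near_min dPhi.
rewrite mulr0 addr0 => /eqP; rewrite addr_eq0 => /eqP ->.
rewrite /cst mulrDr opprD !big_distrr /= -!sumrN.
by congr (_ + _); apply: eq_bigr => i _; ring.
Qed.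

(** The approximate multipliers of the inactive constraints vanish near z, and the
gradients of the active ones are independent, so the multipliers have a limit. *)
Lemma KKT_exists z : feasible g h z -> f z = 0 ->
  (forall x, feasible g h x -> 0 <= f x) -> regular_at g h z ->
  exists lam nu, KKT f g h z lam nu.
Proof.
move=> Sz fz f0 /regular_dual[L HL].
have Cc s : Ck 1 (constraint s) by case: s.
have Cd k s : continuous (partial k (constraint s)).
  by have [_ /Ck_continuous] := Ck_elim (Cc s) k.
have Cdf k : continuous (partial k f) by have [_ /Ck_continuous] := Ck_elim Cf k.
have [||c [Hc1 Hc2 Hc3]] := @multipliers_limit R _ _ (fun s k => partial k (constraint s) z) L
  (fun k => partial k f z) (active_index z) (fun s => if s is inl _ then true else false)
  1 ltr01.
- by move=> s t; exact: HL.
- move=> e e0 _.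
  have e30 : 0 < e / 3 by rewrite divr_gt0.
  have n1 : \forall x \near z, forall s, forall k,
      `|partial k (constraint s) z - partial k (constraint s) x| <= e.
    apply: near_forall_fin => s; apply: near_forall_fin => k.
    exact: (continuous_atP _ _).1 (Cd k s z) _ e0.
  have n2 : \forall x \near z, forall k, `|partial k f z - partial k f x| <= e / 3.
    apply: near_forall_fin => k; exact: (continuous_atP _ _).1 (Cdf k z) _ e30.
  have n3 : \forall x \near z, forall i, ~~ active g z i -> 0 < g i x.
    apply: near_forall_fin => i; have [ai|ai] := boolP (active g z i).
      by near=> x.
    have : 0 < g i z by rewrite lt_neqAle eq_sym ai Sz.1.
    move=> /(near_cont_gt (Ck_continuous (Cg i) z)).
    by apply: filterS.
  have nn : \forall x \near z, [/\ forall s k,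
      `|partial k (constraint s) z - partial k (constraint s) x| <= e,
      forall k, `|partial k f z - partial k f x| <= e / 3 &
      forall i, ~~ active g z i -> 0 < g i x].
    by apply: filterS3 n1 n2 n3 => x.
  have /nbhs_ballP[d /= d0 Hd] := nn.
  have de0 : 0 < Num.min d (e / 3) by rewrite lt_min d0.
  have [x [lam [nu [xz lam0 lamg E]]]] := approximate_KKT Sz fz f0 de0.
  move: xz; rewrite lt_min => /andP[xd xe].
  have [|H1 H2 H3] := Hd x; first by rewrite -ball_normE /= distrC.
  exists (fun s k => partial k (constraint s) x),
    (fun s => match s with inl i => lam i | inr j => nu j end); split.
  + by move=> s k; rewrite distrC.
  + move=> k; rewrite big_sumType /= -E.
    have xk : `|x 0 k - z 0 k| < e / 3.
      by have := (rV_norm_ltP _ e30).1 xe k; rewrite !mxE.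
    rewrite addrAC; apply: le_trans (ler_normD _ _) _.
    rewrite normrM ger0_norm // distrC; have := H2 k; lra.
  + by case=> //= i ai; exact/lamg/H3.
  + by case.
- exists (fun i => c (inl i)), (fun j => c (inr j)); split.
  + apply/rowP => k; rewrite !mxE; have := Hc1 k; rewrite big_sumType /= => ->.
    rewrite !summxE.
    under [X in _ - X - _]eq_bigr do rewrite !mxE.
    under [X in _ - X]eq_bigr do rewrite !mxE.
    by rewrite [X in X - _ = _]addrAC subrr add0r subrr.
  + move=> i; split; last exact: (Hc3 (inl i)).
    have [/eqP ->|ai] := boolP (active g z i); first by rewrite mulr0.
    by rewrite (Hc2 (inl i)) // mul0r.
Unshelve. all: by end_near. Qed.

End Multipliers.

(** * Representation near a nondegenerate zero *)

Section LocalRepresentation.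
Variables (R : realType) (D : forall n, set (set 'rV[R]_n)).
Hypothesis hD : o_minimal D.
Variables (k n l m : nat) (f : 'rV[R]_n -> R).
Variables (g : 'I_l -> 'rV[R]_n -> R) (h : 'I_m -> 'rV[R]_n -> R).
Hypotheses (hf : definable_fun D f /\ Ck k.+2 f)
  (hg : forall i, definable_fun D (g i) /\ Ck k.+2 (g i))
  (hh : forall j, definable_fun D (h j) /\ Ck k.+2 (h j))
  (f_ge0 : forall x, feasible g h x -> 0 <= f x).

Notation u := (constraint g h).
Notation A := (active_index g (m := m)).

Let hu s : definable_fun D (u s) /\ Ck k.+2 (u s).
Proof. by case: s. Qed.

Lemma partialD i (a b : 'rV[R]_n -> R) : Ck 1 a -> Ck 1 b ->
  partial i (fun x => a x + b x) = fun x => partial i a x + partial i b x.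
Proof.
move=> /Ck_elim/(_ i)[da _] /Ck_elim/(_ i)[db _]; apply/funext => x.
by rewrite {1}/partial; have [_ ->] := is_derive_add (da x) (db x).
Qed.

Lemma partialM_cst i c (a : 'rV[R]_n -> R) : Ck 1 a ->
  partial i (fun x => c * a x) = fun x => c * partial i a x.
Proof.
move=> /Ck_elim/(_ i)[da _]; apply/funext => x.
rewrite {1}/partial; have [_ ->] := is_derive_mul (is_derive_cst c x _) (da x).
by rewrite mulr0 addr0.
Qed.

Definition active_penalty z x := \sum_(s | A z s) u s x ^+ 2.

Lemma Ck_active_penalty z : Ck k.+2 (active_penalty z).
Proof.
apply/CkP => x; apply: Ck_near_sum => s _; apply: Ck_nearX.
by move: x; apply/CkP; have [] := hu s.
Qed.

Lemma partial_active_penalty z i :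
  partial i (active_penalty z) = fun x => \sum_(s | A z s) 2 * u s x * partial i (u s) x.
Proof.
apply/funext => x.
have ds s : is_derive x (delta_mx 0 i) (fun x => u s x ^+ 2) (2 * u s x * partial i (u s) x).
  have [dus _] := Ck_elim (proj2 (hu s)) i.
  by have := is_derive_comp1 (dus x) (is_derive_expn 1 _); rewrite expr1.
by rewrite {1}/partial; have [_ ->] := is_derive_sumr (index_enum _) (A z) ds.
Qed.

Lemma active0 z s : feasible g h z -> A z s -> u s z = 0.
Proof. by case: s => [i|j] /= [_ hz] => [/eqP|]. Qed.

(** Only products of first derivatives survive, since the active constraints vanish
at z. *)
Lemma hessian_active_penalty z i j : feasible g h z ->
  partial i (partial j (active_penalty z)) z =
  2 * \sum_(s | A z s) partial i (u s) z * partial j (u s) z.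
Proof.
move=> Sz; rewrite partial_active_penalty.
have ds s : is_derive z (delta_mx 0 i) (fun x => 2 * u s x * partial j (u s) x)
    (2 * u s z * partial i (partial j (u s)) z + partial j (u s) z * (2 * partial i (u s) z)).
  have [dus _] := Ck_elim (proj2 (hu s)) i.
  have [_ Cj] := Ck_elim (proj2 (hu s)) j; have [duj _] := Ck_elim Cj i.
  have d2 : is_derive z (delta_mx 0 i) (fun x => 2 * u s x) (2 * partial i (u s) z).
    by have := is_derive_mul (is_derive_cst (2 : R) z _) (dus z); rewrite mulr0 addr0.
  exact: is_derive_mul d2 (duj z).
rewrite {1}/partial; have [_ ->] := is_derive_sumr (index_enum _) (A z) ds.
rewrite big_distrr /=; apply: eq_bigr => s As.
by rewrite active0 // mulr0 mul0r add0r; ring.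
Qed.

(** Debreu's lemma: a quadratic form that is positive on the common kernel of
some linear forms becomes positive definite after adding a large multiple of
the sum of their squares. *)
Lemma positive_definite_penalty (I : finType) (P : pred I) (H : 'M[R]_n)
    (b : I -> 'rV[R]_n) :
  (forall v : 'rV[R]_n, (forall s, P s -> dotprod v (b s) = 0) -> v != 0 ->
     0 < \sum_i \sum_j H i j * v 0 i * v 0 j) ->
  exists2 M, 0 <= M & forall v : 'rV[R]_n, v != 0 ->
    0 < \sum_i \sum_j H i j * v 0 i * v 0 j
        + M * \sum_(s | P s) dotprod v (b s) ^+ 2.
Proof.
move=> Hpos.
pose a (v : 'rV[R]_n) := \sum_i \sum_j H i j * v 0 i * v 0 j.
pose w (v : 'rV[R]_n) := \sum_(s | P s) dotprod v (b s) ^+ 2.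
have Ca : Ck 0 a.
  apply/CkP => v; do 2!apply: Ck_near_sum => ? _.
  by do 2?apply: Ck_nearM; first [exact: Ck_near_cst|exact: Ck_near_coord].
have Cw : Ck 0 w.
  apply/CkP => v; apply: Ck_near_sum => s _; apply: Ck_nearX.
  apply: Ck_near_sum => i _.
  by apply: Ck_nearM; [exact: Ck_near_coord|exact: Ck_near_cst].
have w0 v : 0 <= w v by apply: sumr_ge0 => ? _; exact: sqr_ge0.
have [v v1 wv|M M0 HM] := penalty_compact (@compact_sphere R n 0 1) Ca Cw w0.
  apply: Hpos.
    move/eqP: wv; rewrite psumr_eq0 => [/allP H0 s Ps|? _]; last exact: sqr_ge0.
    by have := H0 s (mem_index_enum s); rewrite Ps sqrf_eq0 => /eqP.
  by apply: contra_eq_neq v1 => ->; rewrite /= subr0 normr0 eq_sym oner_neq0.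
exists M => // v v0; have nv : 0 < `|v| by rewrite normr_gt0.
have sE : v = `|v| *: (`|v|^-1 *: v).
  by rewrite scalerA mulfV ?scale1r // gt_eqF.
have := HM (`|v|^-1 *: v); rewrite /= subr0 normrZ normfV normr_id mulVf ?gt_eqF //.
move=> /(_ erefl); set v1 := `|v|^-1 *: v in sE *.
have vE i : v 0 i = `|v| * v1 0 i by rewrite {1}sE mxE.
have aE : a v = `|v| ^+ 2 * a v1.
  rewrite /a big_distrr; apply: eq_bigr => i _.
  by rewrite big_distrr; apply: eq_bigr => j _ /=; rewrite !vE; ring.
have wE : w v = `|v| ^+ 2 * w v1.
  rewrite /w big_distrr; apply: eq_bigr => s _ /=.
  rewrite -exprMn; congr (_ ^+ 2); rewrite /dotprod big_distrr.
  by apply: eq_bigr => i _ /=; rewrite vE mulrA.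
rewrite -/(a v) -/(w v) aE wE => p1.
rewrite (_ : _ + _ = `|v| ^+ 2 * (a v1 + M * w v1)); last by ring.
by rewrite mulr_gt0 // exprn_gt0.
Qed.

Lemma lagrangianE z lam nu x : lagrangian f g h z lam nu x =
  f x - \sum_(s | A z s) match s with inl i => lam i | inr j => nu j end * u s x.
Proof. by rewrite /lagrangian big_sumType /= opprD addrA. Qed.

(** Near a nondegenerate zero the Lagrangian plus a large multiple of the active
penalty has a positive definite Hessian, hence is a sum of squares. Absorbing
the penalty into the multipliers keeps them positive, by strict
complementarity, so that they are squares as well. *)
Lemma local_representation z : feasible g h z -> f z = 0 ->
  nondegenerate_at f g h z ->
  exists (phi : 'I_l.+1 -> 'rV[R]_n -> R) (psi : 'I_m -> 'rV[R]_n -> R),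
    [/\ forall i, sum_of_squares_in
          (fun q => definable_fun D q /\ Ck_near k q z) (phi i),
        forall j, definable_fun D (psi j) /\ Ck_near k (psi j) z,
        \forall x \near z, f x = phi ord0 x
          + \sum_(i < l) phi (lift ord0 i) x * g i x
          + \sum_(j < m) psi j x * h j x &
        \forall x \near z, feasible g h x -> f x = 0 -> x = z].
Proof.
move=> Sz fz [reg nondeg].
have Cf1 : Ck 1 f by apply: CkW (proj2 hf).
have Cg1 i : Ck 1 (g i) by apply: CkW (proj2 (hg i)).
have Ch1 j : Ck 1 (h j) by apply: CkW (proj2 (hh j)).
have [lam [nu kkt]] := KKT_exists Cf1 Cg1 Ch1 Sz fz f_ge0 reg.
have [SC SO] := nondeg _ _ kkt; case: kkt => kkt lamg.
pose mu s := match s : 'I_l + 'I_m with inl i => lam i | inr j => nu j end.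
pose L := lagrangian f g h z lam nu.
have LE x : L x = f x + -1 * \sum_(s | A z s) mu s * u s x.
  by rewrite /L lagrangianE mulN1r.
have Cu s : Ck k.+2 (u s) by have [] := hu s.
have Du s : definable_fun D (u s) by have [] := hu s.
have CU : Ck k.+2 (fun x => \sum_(s | A z s) mu s * u s x).
  apply/CkP => x; apply: Ck_near_sum => s _.
  by apply: Ck_nearM; [exact: Ck_near_cst|move: x; apply/CkP].
have CL : Ck k.+2 L.
  have -> : L = fun x => f x + -1 * \sum_(s | A z s) mu s * u s x by apply/funext.
  apply/CkP => x; apply: Ck_nearD; first by move: x; apply/CkP; case: hf.
  by apply: Ck_nearM; [exact: Ck_near_cst|move: x; apply/CkP].
have DL : definable_fun D L.
  have -> : L = fun x => f x + -1 * \sum_(s | A z s) mu s * u s x by apply/funext.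
  apply: (definableD hD); first by case: hf.
  apply: (definableM hD); first exact: definable_cst.
  by apply: (definable_sum hD) => s _; apply: (definableM hD) => //; exact: definable_cst.
have mu0 s : ~~ A z s -> mu s = 0.
  case: s => //= i; rewrite /active /= => gi.
  by have [/eqP] := lamg i; rewrite mulf_eq0 (negbTE gi) orbF => /eqP.
have Lz : L z = 0.
  by rewrite LE fz add0r big1 ?mulr0 // => s As; rewrite active0 ?mulr0.
have dLz i : partial i L z = 0.
  have dU : is_derive z (delta_mx 0 i) (fun x => \sum_(s | A z s) mu s * u s x)
      (\sum_(s | A z s) mu s * partial i (u s) z).
    apply: is_derive_sumr => s; have [du _] := Ck_elim (Cu s) i.
    by have := is_derive_mul (is_derive_cst (mu s) z _) (du z); rewrite mulr0 addr0.
  have [df _] := Ck_elim Cf1 i.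
  have dL := is_derive_add (df z) (is_derive_opp dU).
  have -> : L = fun x => f x - \sum_(s | A z s) mu s * u s x.
    by apply/funext => x; rewrite LE mulN1r.
  rewrite {1}/partial; have [_ ->] := dL.
  have /rowP/(_ i) := kkt; rewrite !mxE !summxE.
  under [X in _ - X - _]eq_bigr do rewrite !mxE.
  under [X in _ - X]eq_bigr do rewrite !mxE.
  move=> K; rewrite big_mkcond /= (eq_bigr (fun s => mu s * partial i (u s) z)).
    by rewrite big_sumType /= opprD addrA.
  by move=> s _; case: ifP => // /negbT /mu0 ->; rewrite mul0r.
have HLpos (v : 'rV[R]_n) : (forall s, A z s -> dotprod v (gradient (u s) z) = 0) -> v != 0 ->
    0 < \sum_i \sum_j hessian L z i j * v 0 i * v 0 j.
  move=> Tv v0; have := SO v _ v0.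
  have -> : (v *m hessian (lagrangian f g h z lam nu) z *m v^T) 0 0 =
      \sum_i \sum_j hessian L z i j * v 0 i * v 0 j.
    rewrite exchange_big mxE; apply: eq_bigr => j _.
    rewrite !mxE big_distrl; apply: eq_bigr => i _ /=.
    by rewrite !mxE; ring.
  apply; split=> [i ai|j]; first exact: (Tv (inl i)).
  exact: (Tv (inr j)).
have [M M0 HM] := positive_definite_penalty HLpos.
pose F x := L x + M * active_penalty z x.
have CW := Ck_active_penalty z.
have CMW : Ck k.+2 (fun x => M * active_penalty z x).
  by apply/CkP => x; apply: Ck_nearM; [exact: Ck_near_cst|move: x; apply/CkP].
have CF : Ck k.+2 F by apply/CkP => x; apply: Ck_nearD; move: x; apply/CkP.
have DW : definable_fun D (active_penalty z).
  by apply: (definable_sum hD) => s _; exact: (definableX hD).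
have DF : definable_fun D F.
  apply: (definableD hD) => //; apply: (definableM hD) => //; exact: definable_cst.
have W1 : Ck 1 (active_penalty z) by apply: CkW CW.
have MW1 : Ck 1 (fun x => M * active_penalty z x) by apply: CkW CMW.
have L1 : Ck 1 L by apply: CkW CL.
have Wz : active_penalty z z = 0.
  by apply: big1 => s As; rewrite active0 // expr0n.
have Fz : F z = 0 by rewrite /F Lz Wz mulr0 addr0.
have dF i : partial i F = fun x => partial i L x + M * partial i (active_penalty z) x.
  by rewrite partialD // partialM_cst.
have dFz i : partial i F z = 0.
  rewrite dF dLz partial_active_penalty big1 ?mulr0 ?addr0 // => s As.
  by rewrite active0 // mulr0 mul0r.
have ddF i j : partial i (partial j F) z = partial i (partial j L) z
    + M * (2 * \sum_(s | A z s) partial i (u s) z * partial j (u s) z).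
  have C1 G : Ck k.+2 G -> Ck 1 (partial j G).
    by move=> /Ck_elim/(_ j)[_]; exact: CkW.
  rewrite dF partialD ?partialM_cst ?hessian_active_penalty //; try exact: C1.
  by apply/CkP => x; apply: Ck_nearM; [exact: Ck_near_cst|move: x; apply/CkP; exact: C1].
have [B [HB BC FB BH]] := quadratic_representation hD DF CF Fz dFz.
have HBz i j : definable_fun D (B i j) /\ Ck_near k (B i j) z.
  by have [Dij /CkP Cij] := HB i j.
pose y (i : 'I_n) (x : 'rV[R]_n) := x 0 i - z 0 i.
have Hy i : definable_fun D (y i) /\ Ck_near k (y i) z.
  split; first by apply: (definableB hD); [exact: definable_coord|exact: definable_cst].
  by apply: Ck_nearB; [exact: Ck_near_coord|exact: Ck_near_cst].
(* Twice this form is the Hessian of F at z, which exceeds the positive definite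
   form of HM by one more multiple of the sum of squares. *)
have PD (v : 'I_n -> R) : (exists i, v i != 0) -> 0 < \sum_i \sum_j B i j z * v i * v j.
  move=> [i0 vi0]; pose w : 'rV[R]_n := \row_i v i.
  have w0 : w != 0 by apply: contraNneq vi0 => /rowP/(_ i0); rewrite !mxE => ->.
  have := HM w w0.
  set G := \sum_(s | A z s) dotprod w (gradient (u s) z) ^+ 2.
  have G0 : 0 <= G by apply: sumr_ge0 => s _; exact: sqr_ge0.
  have GE : G = \sum_i \sum_j (\sum_(s | A z s) partial i (u s) z * partial j (u s) z) * v i * v j.
    transitivity (\sum_(s | A z s) \sum_i \sum_j
        partial i (u s) z * partial j (u s) z * v i * v j).
      apply: eq_bigr => s _; rewrite expr2 /dotprod big_distrl /=.
      apply: eq_bigr => i _; rewrite big_distrr /=; apply: eq_bigr => j _.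
      by rewrite !mxE; ring.
    rewrite exchange_big; apply: eq_bigr => i _; rewrite exchange_big.
    by apply: eq_bigr => j _; rewrite !big_distrl.
  have E : 2 * \sum_i \sum_j B i j z * v i * v j =
      \sum_i \sum_j hessian L z i j * w 0 i * w 0 j + M * (2 * G).
    rewrite GE !big_distrr -big_split; apply: eq_bigr => i _ /=.
    rewrite !big_distrr -big_split; apply: eq_bigr => j _ /=.
    by rewrite !mulrA -BH ddF !mxE; ring.
  move=> p1; suff : 0 < 2 * \sum_i \sum_j B i j z * v i * v j by rewrite pmulr_rgt0.
  rewrite E; apply: lt_le_trans p1 _.
  rewrite lerD2l; apply: ler_wpM2l => //; rewrite mulr_natl mulr2n lerDl //.
have [q [Hq Fq]] := sum_of_squares_quadratic hD BC HBz Hy PD.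
pose phi0 x := \sum_i q i x ^+ 2.
pose r i x := if active g z i then Num.sqrt (lam i - M * g i x) else 0.
pose phi (a : 'I_l.+1) x := if unlift ord0 a is Some i then r i x ^+ 2 else phi0 x.
pose psi j x := nu j - M * h j x.
have phil i x : phi (lift ord0 i) x = r i x ^+ 2 by rewrite /phi liftK.
have phi00 x : phi ord0 x = phi0 x by rewrite /phi unlift_none.
have lam_gt0 i : active g z i -> 0 < lam i - M * g i z.
  move=> ai; move: (SC i); move: ai; rewrite /active /= => /eqP ->.
  by rewrite mulr0 subr0 addr0.
have Dr i : definable_fun D (fun x => lam i - M * g i x).
  have [Dgi _] := hg i.
  by apply: (definableB hD); [|apply: (definableM hD)] => //; exact: definable_cst.
have Cr i : Ck_near k (fun x => lam i - M * g i x) z.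
  have [_ /CkP/(_ z) Cgi] := hg i.
  apply: Ck_nearB; first exact: Ck_near_cst.
  by apply: Ck_nearM; [exact: Ck_near_cst|do 2!apply: Ck_nearS].
have nearE : \forall x \near z, f x = phi ord0 x
          + \sum_(i < l) phi (lift ord0 i) x * g i x + \sum_(j < m) psi j x * h j x.
  have npos : \forall x \near z, forall i, active g z i -> 0 < lam i - M * g i x.
    apply: near_forall_fin => i; have [ai|nai] := boolP (active g z i); last by near=> x.
    have := near_cont_gt (Ck_near_continuous (Cr i)) (lam_gt0 i ai).
    by apply: filterS.
  apply: filterS2 Fq npos => x [Ex _] Hpos.
  rewrite phi00 /phi0 -Ex -FB /F LE /active_penalty !big_sumType /=.
  under [X in _ = _ + X + _]eq_bigr do rewrite phil.
  have -> : \sum_(i < l) r i x ^+ 2 * g i x =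
      \sum_(i | active g z i) (lam i - M * g i x) * g i x.
    rewrite [RHS]big_mkcond; apply: eq_bigr => i _; rewrite /r.
    by case: ifP => [ai|_]; rewrite ?sqr_sqrtr ?ltW ?Hpos // expr0n mul0r.
  have -> : \sum_(i | active g z i) (lam i - M * g i x) * g i x =
      \sum_(i | active g z i) lam i * g i x - M * \sum_(i | active g z i) g i x ^+ 2.
    by rewrite big_distrr -sumrB; apply: eq_bigr => i _; rewrite /= mulrBl expr2 mulrA.
  have -> : \sum_j psi j x * h j x = \sum_j nu j * h j x - M * \sum_j h j x ^+ 2.
    by rewrite big_distrr -sumrB; apply: eq_bigr => j _; rewrite /= mulrBl expr2 mulrA.
  by ring.
exists phi, psi; split=> //.
- move=> a; case: (unliftP ord0 a) => [i|] ->; last by exists n, q; split.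
  exists 1%N, (fun _ => r i); split=> [_|x]; last by rewrite phil big_ord1.
  have -> : r i = if active g z i then fun x => Num.sqrt (lam i - M * g i x) else fun=> 0.
    by apply/funext => x; rewrite /r; case: ifP.
  case: ifP => [ai|_]; last by split; [exact: definable_cst|exact: Ck_near_cst].
  by split; [exact: (definable_sqrt hD)|apply: Ck_near_sqrt => //; exact: lam_gt0].
- move=> j; have [Dhj /CkP/(_ z) Chj] := hh j; split.
    by apply: (definableB hD); [|apply: (definableM hD)] => //; exact: definable_cst.
  apply: Ck_nearB; first exact: Ck_near_cst.
  by apply: Ck_nearM; [exact: Ck_near_cst|do 2!apply: Ck_nearS].
- apply: filterS2 Fq nearE => x [_ Hx] E [gx hx] fx.
  have s0 : 0 <= \sum_(i < l) phi (lift ord0 i) x * g i x.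
    by apply: sumr_ge0 => i _; rewrite phil mulr_ge0 // sqr_ge0.
  have p0 : 0 <= phi0 x by apply: sumr_ge0 => i _; exact: sqr_ge0.
  have /eqP : phi0 x = 0.
    move: E; rewrite fx phi00 [X in _ + X]big1 ?addr0 => [|j _]; last by rewrite hx mulr0.
    by move=> /eqP; rewrite eq_sym paddr_eq0 // => /andP[/eqP].
  rewrite psumr_eq0 => [/allP q0|i _]; last exact: sqr_ge0.
  apply/rowP => i; apply/eqP; rewrite -subr_eq0; apply/eqP/Hx => a.
  by have := q0 a (mem_index_enum a); rewrite sqrf_eq0 => /eqP.
Unshelve. all: by end_near. Qed.

End LocalRepresentation.

(** * Isolated points of definable sets *)

Section IsolatedPoints.
Variable R : realType.

Lemma itv_not_countable (a b : R) (A : set R) : a < b ->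
  (forall t, a < t -> t < b -> A t) -> ~ countable A.
Proof.
move=> ab sub cA.
have : countable `]a, b[%classic.
  apply: sub_countable cA; apply: subset_card_le => t /=.
  by rewrite in_itv /= => /andP[]; exact: sub.
move=> /(@countable_lebesgue_measure0 R); rewrite lebesgue_measure_itv /= lte_fin ab.
by rewrite -EFinD => -[/eqP]; rewrite subr_eq0 gt_eqF.
Qed.

(** Each isolated point is determined by a rational point and an integer: the latter
bounds the isolation radius, the former approximates the point. *)
Lemma isolated_countable n (Z : set 'rV[R]_n) :
  (forall z, Z z -> \forall x \near z, Z x -> x = z) -> countable Z.
Proof.
move=> iso.
pose Good (z : 'rV[R]_n) (p : 'rV[rat]_n * nat) :=
  (forall x, Z x -> (forall k, `|z 0 k - x 0 k| < p.2.+1%:R^-1) -> x = z) /\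
  (forall k, `|z 0 k - ratr (p.1 0 k)| < p.2.+1%:R^-1 / 2).
have good z : Z z -> exists p, Good z p.
  move=> /iso /nbhs_ballP[r /= r0 Hr].
  have [N] : exists N : nat, N.+1%:R^-1 < r.
    exists (Num.truncn r^-1); rewrite invf_plt ?posrE //.
    by rewrite truncnS_gt.
  move=> Nr; have N0 : 0 < N.+1%:R^-1 / 2 :> R by rewrite divr_gt0.
  have Hq k : exists q : rat, `|z 0 k - ratr q| < N.+1%:R^-1 / 2.
    have [|q] := @rat_in_itvoo R (z 0 k - N.+1%:R^-1 / 2) (z 0 k + N.+1%:R^-1 / 2).
      by rewrite ltrBlDr -addrA ltrDl addr_gt0.
    rewrite in_itv /= => /andP[q1 q2]; exists q.
    by rewrite ltr_distlC -ltrBlDr in q1 q2 *; apply/andP.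
  have [q qP] := choice Hq.
  exists (\row_k q k, N); split=> /= [x Zx Hx|k]; last by rewrite mxE.
  apply: Hr => //; rewrite -ball_normE /=; apply/(rV_norm_ltP _ r0) => k.
  by rewrite !mxE; apply: lt_trans (Hx k) Nr.
have good' z : exists p, Z z -> Good z p.
  have [/good[p Hp]|nZ] := pselect (Z z); first by exists p.
  by exists (0, 0%N).
have [F FP] := choice good'.
apply/countable_injP; exists (pickle \o F) => z z'; rewrite !inE => Zz Zz' /= /(pcan_inj pickleK) e.
have [_ H1] := FP z Zz; have [H2 H3] := FP z' Zz'.
apply: H2 => // k.
have := H1 k; rewrite e => h1; have h3 := H3 k.
rewrite -(subrK (ratr ((F z').1 0 k)) (z' 0 k)) -addrA.
apply: le_lt_trans (ler_normD _ _) _; rewrite [ltRHS]splitr.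
by rewrite ltrD // distrC.
Qed.

(** A countable interval has at most one point. *)
Lemma finite_countable_union (A : set R) (s : seq R) (I : seq (interval R)) :
  A = [set x | x \in s \/ exists2 i, i \in I & x \in i] -> countable A ->
  exists s' : seq R, forall x, A x -> x \in s'.
Proof.
move=> AE cA.
have : forall i, i \in I -> exists c, forall x, x \in i -> x = c.
  move=> i iI; have [[c ci]|no] := pselect (exists c, c \in i); last first.
    by exists 0 => x xi; exfalso; apply: no; exists x.
  exists c => x xi; apply/eqP/negPn/negP => xc.
  wlog xltc : x c ci xi xc / x < c.
    move=> H; have [|cx|e] := ltgtP x c; first exact: H.
      by apply: (H c x) => //; rewrite eq_sym.
    by rewrite e eqxx in xc.
  apply: (@itv_not_countable x c A xltc) cA => t xt tc.
  rewrite AE /=; right; exists i => //.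
  by apply: (@interval_is_interval _ i x c) => //; rewrite ?xt ?tc ?ltW.
elim: I A AE cA => [|i I IH] A AE cA HI.
  by exists s => x; rewrite AE => -[//|[]].
have [c Hc] := HI i (mem_head _ _).
pose A' := [set x | x \in s \/ exists2 i, i \in I & x \in i].
have [|j jI|s' Hs'] := IH A' erefl.
- apply: sub_countable cA; apply: subset_card_le => x; rewrite AE => -[xs|[j jI xj]].
    by left.
  by right; exists j => //; rewrite inE jI orbT.
- by apply: HI; rewrite inE jI orbT.
exists (c :: s') => x; rewrite AE inE => -[xs|[j]].
  by rewrite Hs' ?orbT //; left.
rewrite inE => /orP[/eqP -> /Hc ->|jI xj]; first by rewrite eqxx.
by rewrite Hs' ?orbT //; right; exists j.
Qed.

Variable D : forall n, set (set 'rV[R]_n).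
Hypothesis hD : o_minimal D.

Lemma definable_rsubmx p q : definable_map D (@rsubmx R 1 p q).
Proof.
move=> k; under [X in definable_fun D X]funext do rewrite mxE.
exact: definable_coord.
Qed.

(** A definable set of isolated points is countable, hence so are its coordinate
projections; being finite unions of points and intervals these are finite. *)
Lemma isolated_finite n (Z : set 'rV[R]_n) : D Z ->
  (forall z, Z z -> \forall x \near z, Z x -> x = z) ->
  exists s : seq 'rV[R]_n, forall z, Z z -> z \in s.
Proof.
move=> DZ iso; have cZ := isolated_countable iso.
have fin i : exists s : seq R, forall z, Z z -> z 0 i \in s.
  pose C := [set t : R | exists2 z, Z z & z 0 i = t].
  have DC : D [set x : 'rV[R]_1 | C (x 0 0)].
    have H1 := defset_map hD (@definable_rsubmx 1 n) DZ.
    have H2 := defset_eq hD (definable_comp hD (@definable_coord _ _ hD n i)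
      (@definable_rsubmx 1 n)) (@definable_coord _ _ hD (1 + n) (lshift n 0)).
    have := defset_exists_rV hD (defset_and hD H1 H2).
    apply: defset_ext => x /=; split=> [[z]|[z Zz zx]].
      by rewrite !row_mxKr row_mxEl => -[Zz zx]; exists z.
    by exists z; rewrite !row_mxKr row_mxEl.
  have [s [I CE]] := om_dim1 hD DC.
  have cC : countable C.
    apply: sub_countable cZ; apply: card_le_trans (card_image_le (fun z : 'rV[R]_n => z 0 i) Z).
    by apply: subset_card_le => t [z Zz <-]; exists z.
  have CE' : C = [set x | x \in s \/ exists2 i, i \in I & x \in i].
    apply/seteqP; split=> t.
      move=> Ct; have : [set x : 'rV[R]_1 | C (x 0 0)] (const_mx t) by rewrite /= mxE.
      by rewrite CE /= mxE.
    move=> Ht; have : [set x : 'rV[R]_1 | C (x 0 0)] (const_mx t) by rewrite CE /= mxE.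
    by rewrite /= mxE.
  have [s' Hs'] := finite_countable_union CE' cC.
  by exists s' => z Zz; apply: Hs'; exists z.
have [S HS] := choice fin.
pose s := flatten [seq S i | i <- enum 'I_n].
exists [seq (\row_i val (F i) : 'rV[R]_n) | F : {ffun 'I_n -> seq_sub s}] => z Zz.
have zs i : z 0 i \in s.
  by apply/flatten_mapP; exists i; [rewrite mem_enum|exact: HS].
apply/mapP; exists [ffun i => SeqSub (zs i)]; first by rewrite mem_enum.
by apply/rowP => i; rewrite mxE ffunE.
Qed.

End IsolatedPoints.

(** * Gluing representations *)

Lemma sum_of_squares_add (R : realType) (T : Type) (P : set (T -> R)) (a b : T -> R) :
  sum_of_squares_in P a -> sum_of_squares_in P b ->
  sum_of_squares_in P (fun x => a x + b x).
Proof.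
move=> [N [q [Pq aE]]] [N' [q' [Pq' bE]]].
exists (N + N')%N, (fun i => match fintype.split i with inl j => q j | inr j => q' j end).
split=> [i|x]; first by case: (fintype.split i).
rewrite big_split_ord aE bE; congr (_ + _); apply: eq_bigr => i _.
  by rewrite -[lshift _ _]/(unsplit (inl _)) unsplitK.
by rewrite -[rshift _ _]/(unsplit (inr _)) unsplitK.
Qed.

Lemma sum_of_squares_mul (R : realType) (T : Type) (P Q : set (T -> R)) (a c : T -> R) :
  (forall q, P q -> Q (fun x => c x * q x)) ->
  sum_of_squares_in P a -> sum_of_squares_in Q (fun x => c x ^+ 2 * a x).
Proof.
move=> PQ [N [q [Pq aE]]]; exists N, (fun i x => c x * q i x); split=> [i|x].
  exact: PQ.
by rewrite aE big_distrr; apply: eq_bigr => i _; rewrite exprMn.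
Qed.

Section Gluing.
Variables (R : realType) (D : forall n, set (set 'rV[R]_n)).
Hypothesis hD : o_minimal D.
Variables (k n l m : nat).
Variables (g : 'I_l -> 'rV[R]_n -> R) (h : 'I_m -> 'rV[R]_n -> R).

Definition smooth_on (U : set 'rV[R]_n) : set ('rV[R]_n -> R) :=
  [set q | definable_fun D q /\ forall x, U x -> Ck_near k q x].

(** Both the smoothness of the coefficients and the identity are asserted on U only;
the coefficients are nevertheless total definable functions. *)
Definition represents (U : set 'rV[R]_n) (F : 'rV[R]_n -> R) :=
  exists (phi : 'I_l.+1 -> 'rV[R]_n -> R) (psi : 'I_m -> 'rV[R]_n -> R),
    [/\ forall i, sum_of_squares_in (smooth_on U) (phi i),
        forall j, smooth_on U (psi j) &
        forall x, U x -> F x = phi ord0 x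
          + \sum_(i < l) phi (lift ord0 i) x * g i x
          + \sum_(j < m) psi j x * h j x].

Lemma smooth_onM U a b : smooth_on U a -> smooth_on U b ->
  smooth_on U (fun x => a x * b x).
Proof.
move=> [Da Ca] [Db Cb]; split; first exact: (definableM hD).
by move=> x Ux; apply: Ck_nearM; [exact: Ca|exact: Cb].
Qed.

Lemma represents_add F G : represents setT F -> represents setT G ->
  represents setT (fun x => F x + G x).
Proof.
move=> [p [s [Hp Hs FE]]] [p' [s' [Hp' Hs' GE]]].
exists (fun i x => p i x + p' i x), (fun j x => s j x + s' j x); split=> [i|j|x _].
- exact: sum_of_squares_add.
- have [D1 C1] := Hs j; have [D2 C2] := Hs' j; split; first exact: (definableD hD).
  by move=> x Ux; apply: Ck_nearD; [exact: C1|exact: C2].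
- rewrite FE // GE //.
  under [in RHS]eq_bigr do rewrite mulrDl.
  under [X in _ = _ + X]eq_bigr do rewrite mulrDl.
  by rewrite !big_split /=; ring.
Qed.

(** Half of c^2 goes into each factor of a square, and the identity is trivial where c
vanishes. *)
Lemma represents_cutoff U (c F : 'rV[R]_n -> R) :
  smooth_on setT c ->
  (forall q, smooth_on U q -> smooth_on setT (fun x => c x * q x)) ->
  (forall x, c x != 0 -> U x) ->
  represents U F -> represents setT (fun x => c x ^+ 2 * F x).
Proof.
move=> sc cU cP [p [s [Hp Hs FE]]].
exists (fun i x => c x ^+ 2 * p i x), (fun j x => c x * (c x * s j x)).
split=> [i|j|x _].
- exact: sum_of_squares_mul cU (Hp i).
- by apply: smooth_onM => //; exact: cU.
- have [->|cx] := eqVneq (c x) 0.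
    by rewrite expr0n !mul0r !add0r !big1 ?addr0 // => i _; rewrite !mul0r.
  rewrite (FE x (cP x cx)) !mulrDr !big_distrr /=; congr (_ + _ + _); apply: eq_bigr => i _.
    by rewrite mulrA.
  by rewrite expr2 !mulrA.
Qed.

Lemma definable_dist2 z : definable_fun D (@dist2 R n z).
Proof.
apply: (definable_sum hD) => i _; apply: (definableX hD).
by apply: (definableB hD); [exact: definable_coord|exact: definable_cst].
Qed.

Lemma Ck_near_dist2 (z x : 'rV[R]_n) : Ck_near k (dist2 z) x.
Proof. by move: x; apply/CkP; exact: Ck_dist2. Qed.

Lemma dist2_lt_norm (z x : 'rV[R]_n) r : 0 < r -> dist2 z x < r ^+ 2 -> `|x - z| < r.
Proof.
move=> r0 dr; apply/(rV_norm_ltP _ r0) => i; rewrite !mxE.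
rewrite -(@ltr_pXn2r _ 2) ?nnegrE ?(ltW r0) // real_normK ?num_real //.
apply: le_lt_trans dr; rewrite /dist2 (bigD1 i) //= lerDl.
by apply: sumr_ge0 => ? _; exact: sqr_ge0.
Qed.

(** Truncated powers of the squared Euclidean distance: [cutoff] is positive inside
the sphere of squared radius r around z, [hole] outside of it. *)
Definition cutoff (z : 'rV[R]_n) r x := Num.max 0 (r - dist2 z x) ^+ k.+1.
Definition hole (z : 'rV[R]_n) r x := Num.max 0 (dist2 z x - r) ^+ k.+1.

Lemma smooth_max0 (a : 'rV[R]_n -> R) : smooth_on setT a ->
  smooth_on setT (fun x => Num.max 0 (a x) ^+ k.+1).
Proof.
move=> [Da Ca]; split; first exact/(definableX hD)/(definable_max0 hD).
by move=> x Ux; apply: Ck_near_max0X => //; exact: Ca.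
Qed.

Lemma smooth_cutoff z r : smooth_on setT (cutoff z r).
Proof.
apply: smooth_max0; split.
  by apply: (definableB hD); [exact: definable_cst|exact: definable_dist2].
by move=> x _; apply: Ck_nearB; [exact: Ck_near_cst|exact: Ck_near_dist2].
Qed.

Lemma smooth_hole z r : smooth_on setT (hole z r).
Proof.
apply: smooth_max0; split.
  by apply: (definableB hD); [exact: definable_dist2|exact: definable_cst].
by move=> x _; apply: Ck_nearB; [exact: Ck_near_dist2|exact: Ck_near_cst].
Qed.

(** The closed support of the cutoff lies in the ball where q is smooth. *)
Lemma smooth_cutoffM z r q : 0 < r -> smooth_on [set x | `|x - z| < r] q ->
  smooth_on setT (fun x => cutoff z (r ^+ 2 / 2) x * q x).
Proof.
move=> r0 [Dq Cq]; have [Db Cb] := smooth_cutoff z (r ^+ 2 / 2).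
split=> [|x _]; first exact: (definableM hD).
have [xr|xr] := ltP (dist2 z x) (r ^+ 2).
  by apply: Ck_nearM; [exact: Cb|apply: Cq; exact: dist2_lt_norm].
have xr2 : r ^+ 2 / 2 < dist2 z x.
  by apply: lt_le_trans xr; rewrite ltr_pdivrMr // ltr_pMr ?ltr1n // exprn_gt0.
apply: Ck_near_ext (Ck_near_cst k 0 x).
have := near_cont_gt (Ck_near_continuous (Ck_near_dist2 z x)) xr2.
by apply: filterS => y yr; rewrite /cutoff max_l ?expr0n ?mul0r // subr_le0 ltW.
Qed.

Lemma near_hole0 (z : 'rV[R]_n) r : 0 < r -> \forall x \near z, hole z r x = 0.
Proof.
move=> r0.
have C : Ck_near k (fun x => r - dist2 z x) z.
  by apply: Ck_nearB; [exact: Ck_near_cst|exact: Ck_near_dist2].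
have := near_cont_gt (c := 0) (Ck_near_continuous C).
rewrite {1}/dist2 big1 ?subr0 => [|i _]; last by rewrite subrr expr0n.
move=> /(_ r0); apply: filterS => x; rewrite subr_gt0 => xr.
by rewrite /hole max_l ?expr0n // subr_le0 ltW.
Qed.

Lemma sum_of_squares_near z a :
  sum_of_squares_in (fun q => definable_fun D q /\ Ck_near k q z) a ->
  \forall r \near (0 : R)^'+, sum_of_squares_in (smooth_on [set x | `|x - z| < r]) a.
Proof.
move=> [N [q [Hq aE]]].
have : \forall x \near z, forall i, Ck_near k (q i) x.
  by apply: near_forall_fin => i; have [_ /Ck_near_near] := Hq i.
move=> /nbhs_ballP[d /= d0 Hd]; near=> r; exists N, q; split=> // i.
have [Di _] := Hq i; split=> // x /= xr; apply: Hd.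
rewrite -ball_normE /= distrC; apply: lt_trans xr _.
by near: r; exact: nbhs_right_lt.
Unshelve. all: by end_near. Qed.

End Gluing.

(** * Representation away from the zeros *)

Section Global.
Variables (R : realType) (D : forall n, set (set 'rV[R]_n)).
Hypothesis hD : o_minimal D.
Variables (k n l m : nat) (f : 'rV[R]_n -> R).
Variables (g : 'I_l -> 'rV[R]_n -> R) (h : 'I_m -> 'rV[R]_n -> R).
Hypotheses (hf : definable_fun D f /\ Ck k f)
  (hg : forall i, definable_fun D (g i) /\ Ck k (g i))
  (hh : forall j, definable_fun D (h j) /\ Ck k (h j))
  (f_ge0 : forall x, feasible g h x -> 0 <= f x).

Definition feasible_zeros := [set x | feasible g h x /\ f x = 0].

(** Away from the feasible zeros a penalty term turns f into a positive
function, and the penalty weight can be written down explicitly. *)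
Lemma representation_off_zeros :
  represents D k g h (~` feasible_zeros) f.
Proof.
pose e := k.+1.
pose w := infeasibility g h (e * 2).
pose s x := Num.sqrt (f x ^+ 2 + w x ^+ 2).
(* Adding 1 keeps the weight positive, so that its square root is smooth. *)
pose M x := w x / (s x + f x) + 1.
have w0 x : 0 <= w x by exact: infeasibility_ge0.
have pos x : (~` feasible_zeros) x -> w x = 0 -> 0 < f x.
  move=> nz /infeasibility_eq0 Sx; rewrite lt_neqAle f_ge0 // andbT eq_sym.
  by apply/eqP => fx; apply: nz.
have Df : definable_fun D f by case: hf.
have Cf x : Ck_near k f x by move: x; apply/CkP; case: hf.
have Dg i : definable_fun D (g i) by case: (hg i).
have Cg i x : Ck_near k (g i) x by move: x; apply/CkP; case: (hg i).
have Dh j : definable_fun D (h j) by case: (hh j).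
have Ch j x : Ck_near k (h j) x by move: x; apply/CkP; case: (hh j).
have Dw : definable_fun D w.
  apply: (definableD hD); apply: (definable_sum hD) => i _; apply: (definableX hD) => //.
  by apply: (definable_max0 hD); exact: (definableN hD).
have Cw x : Ck_near k w x.
  apply: Ck_nearD; apply: Ck_near_sum => i _; last exact: Ck_nearX.
  by apply: Ck_near_max0X; [rewrite ltnS (leq_trans (leqnSn k)) // leq_pmulr|exact: Ck_nearN].
have Ds : definable_fun D s.
  by apply: (definable_sqrt hD); apply: (definableD hD); exact: (definableX hD).
have Cs x : (~` feasible_zeros) x -> Ck_near k s x.
  move=> nz; apply: Ck_near_sqrt; first by apply: penalty_radicand_gt0; exact: pos.
  by apply: Ck_nearD; exact: Ck_nearX.
have DM : definable_fun D M.
  apply: (definableD hD); last exact: definable_cst.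
  by apply: (definableM hD) => //; apply: (definableV hD); exact: (definableD hD).
have CM x : (~` feasible_zeros) x -> Ck_near k M x.
  move=> nz; apply: Ck_nearD; last exact: Ck_near_cst.
  apply: Ck_nearM => //; apply: Ck_nearV.
    by rewrite gt_eqF // penalty_denom_gt0 //; exact: pos.
  by apply: Ck_nearD => //; exact: Cs.
have M0 x : (~` feasible_zeros) x -> 0 < M x.
  move=> nz; apply: ltr_wpDl => //; rewrite divr_ge0 // ltW //.
  by apply: penalty_denom_gt0 => //; exact: pos.
have fM x : (~` feasible_zeros) x -> f x = s x + w x - M x * w x.
  move=> nz; have := penalty_identity (w0 x) (pos x nz); rewrite /M -/(s x).
  by move: (w x / _) => mu <-; ring.
have sw0 x : (~` feasible_zeros) x -> 0 < s x + w x.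
  move=> nz; rewrite ltr_pwDl // sqrtr_gt0.
  by apply: penalty_radicand_gt0; exact: pos.
pose r i x := Num.sqrt (M x) * Num.max 0 (- g i x) ^+ e.
pose phi (a : 'I_l.+1) x :=
  if unlift ord0 a is Some i then r i x ^+ 2 else Num.sqrt (s x + w x) ^+ 2.
exists phi, (fun j x => - (M x * h j x)); split=> [a|j|x nz].
- pose q x := if unlift ord0 a is Some i then r i x else Num.sqrt (s x + w x).
  exists 1%N, (fun _ => q); split=> [_|x]; last first.
    by rewrite big_ord1 /phi /q; case: unlift.
  rewrite /q; case: (unlift ord0 a) => [i|]; split=> [|x nz].
  + apply: (definableM hD); first exact: (definable_sqrt hD).
    apply: (definableX hD); apply: (definable_max0 hD); exact: (definableN hD).
  + apply: Ck_nearM; first by apply: Ck_near_sqrt; [exact: M0|exact: CM].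
    by apply: Ck_near_max0X => //; exact: Ck_nearN.
  + by apply: (definable_sqrt hD); exact: (definableD hD).
  + apply: Ck_near_sqrt; first exact: sw0.
    by apply: Ck_nearD => //; exact: Cs.
- split=> [|x nz]; first by apply: (definableN hD); exact: (definableM hD).
  by apply: Ck_nearN; apply: Ck_nearM => //; exact: CM.
- have phil i : phi (lift ord0 i) x * g i x = - (M x * Num.max 0 (- g i x) ^+ (e * 2).+1).
    rewrite /phi liftK /r exprMn sqr_sqrtr ?ltW ?M0 // -exprM exprSr.
    have [gi|gi] := leP 0 (- g i x); first by ring.
    by rewrite muln2 doubleS expr0n !mulr0 mul0r oppr0.
  under eq_bigr do rewrite phil.
  have -> : phi ord0 x = s x + w x.
    by rewrite /phi unlift_none sqr_sqrtr // ltW // sw0.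
  rewrite {1}fM // {2}/w /infeasibility mulrDr opprD addrA !big_distrr /= -!sumrN.
  by congr (_ + _); apply: eq_bigr => j _; ring.
Qed.

End Global.

(** * The representation theorem *)

Lemma represents_sum (R : realType) (D : forall n, set (set 'rV[R]_n)) (hD : o_minimal D)
    k n l m (g : 'I_l -> 'rV[R]_n -> R) (h : 'I_m -> 'rV[R]_n -> R)
    (I : eqType) (s : seq I) (F0 : 'rV[R]_n -> R) (F : I -> 'rV[R]_n -> R) :
  represents D k g h setT F0 ->
  (forall i, i \in s -> represents D k g h setT (F i)) ->
  represents D k g h setT (fun x => F0 x + \sum_(i <- s) F i x).
Proof.
elim: s F0 => [|i s IH] F0 H0 H.
  by under [X in represents _ _ _ _ _ X]funext do rewrite big_nil addr0.
under [X in represents _ _ _ _ _ X]funext do rewrite big_cons addrA.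
apply: IH => [|j js]; last by apply: H; rewrite inE js orbT.
by apply: (represents_add hD) => //; apply: H; exact: mem_head.
Qed.

(** Finitely many functions that are smooth near z are smooth on a common ball. *)
Lemma represents_at_zero (R : realType) (D : forall n, set (set 'rV[R]_n))
    (hD : o_minimal D) k n l m (f : 'rV[R]_n -> R)
    (g : 'I_l -> 'rV[R]_n -> R) (h : 'I_m -> 'rV[R]_n -> R)
    (hf : definable_fun D f /\ Ck k.+2 f)
    (hg : forall i, definable_fun D (g i) /\ Ck k.+2 (g i))
    (hh : forall j, definable_fun D (h j) /\ Ck k.+2 (h j))
    (f_ge0 : forall x, feasible g h x -> 0 <= f x) z :
  feasible g h z -> f z = 0 -> nondegenerate_at f g h z ->
  exists2 r, 0 < r & represents D k g h [set x | `|x - z| < r] f.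
Proof.
move=> Sz fz nd.
have [phi [psi [Hphi Hpsi /nbhs_ballP[d /= d0 Hd] _]]] :=
  local_representation hD hf hg hh f_ge0 Sz fz nd.
have H1 : \forall r \near (0 : R)^'+, forall i,
    sum_of_squares_in (smooth_on D k [set x | `|x - z| < r]) (phi i).
  apply: (@filter_forall R 'I_l.+1 (fun i r =>
    sum_of_squares_in (smooth_on D k [set x | `|x - z| < r]) (phi i)) (0^'+)) => i.
  exact: sum_of_squares_near.
have H2 : \forall r \near (0 : R)^'+, forall j,
    smooth_on D k [set x | `|x - z| < r] (psi j).
  apply: (@filter_forall R 'I_m (fun j r =>
    smooth_on D k [set x | `|x - z| < r] (psi j)) (0^'+)) => j.
  have [Dj /Ck_near_near /nbhs_ballP[d' /= d'0 Hd']] := Hpsi j.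
  near=> r; split=> // x /= xr; apply: Hd'; rewrite -ball_normE /= distrC.
  by apply: lt_trans xr _; near: r; exact: nbhs_right_lt.
have : \forall r \near (0 : R)^'+, 0 < r /\
    represents D k g h [set x | `|x - z| < r] f.
  near=> r; split; first by near: r; exact: nbhs_right_gt.
  exists phi, psi; split; [by near: r|by near: r|].
  move=> x /= xr; apply: Hd; rewrite -ball_normE /= distrC.
  by apply: lt_trans xr _; near: r; exact: nbhs_right_lt.
by move=> /filter_ex[r []]; exists r.
Unshelve. all: by end_near. Qed.

Theorem theorem3p2 (R : realType) (D : forall n : nat, set (set 'rV[R]_n))
    (hD : o_minimal D) (p : nat) (hp : (2 <= p)%N) (n l m : nat)
    (f : 'rV[R]_n -> R)
    (g : 'I_l -> 'rV[R]_n -> R) (h : 'I_m -> 'rV[R]_n -> R)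
    (hf : definable_fun D f /\ Ck p f)
    (hg : forall i, definable_fun D (g i) /\ Ck p (g i))
    (hh : forall j, definable_fun D (h j) /\ Ck p (h j))
    (S_nonempty : exists x, feasible g h x)
    (f_ge0 : forall x, feasible g h x -> 0 <= f x)
    (f_zeros : forall x, feasible g h x -> f x = 0 ->
      nondegenerate_at f g h x) :
  exists (phi : 'I_l.+1 -> 'rV[R]_n -> R) (psi : 'I_m -> 'rV[R]_n -> R),
    [/\ forall i, definable_fun D (phi i) /\ Ck (p - 2) (phi i),
        forall i, sum_of_squares_in
          (fun q => definable_fun D q /\ Ck (p - 2) q) (phi i),
        forall j, definable_fun D (psi j) /\ Ck (p - 2) (psi j) &
        forall x, f x = phi ord0 x
          + \sum_(i < l) phi (lift ord0 i) x * g i x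
          + \sum_(j < m) psi j x * h j x].
Proof.
case: p hp hf hg hh => [|[|k]] // _ hf hg hh; rewrite !subSS subn0.
have smoothE q : smooth_on D k setT q <-> definable_fun D q /\ Ck k q.
  split=> [[Dq Cq]|[Dq /CkP Cq]]; split=> //; first by apply/CkP => x; exact: Cq.
suff [phi [psi [Hphi Hpsi fE]]] : represents D k g h setT f.
  have sos i : sum_of_squares_in (fun q => definable_fun D q /\ Ck k q) (phi i).
    have [N [q [Hq qE]]] := Hphi i.
    by exists N, q; split=> // j; exact/smoothE.
  exists phi, psi; split=> // [i|j|x]; [|exact/smoothE|exact: fE].
  have [N [q [Hq qE]]] := sos i.
  have -> : phi i = fun x => \sum_j q j x ^+ 2 by apply/funext.
  split; first by apply: (definable_sum hD) => j _; apply: (definableX hD); case: (Hq j).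
  by apply/CkP => x; apply: Ck_near_sum => j _; apply: Ck_nearX; move: x; apply/CkP;
    case: (Hq j).
have weaken q : definable_fun D q /\ Ck k.+2 q -> definable_fun D q /\ Ck k q.
  by move=> [Dq Cq]; split=> //; apply: CkW Cq; rewrite -addn2 leq_addr.
pose Z := feasible_zeros f g h.
have DZ : D n Z.
  have D0 := @definable_cst _ _ hD n 0.
  apply: (defset_and hD); last by apply: (defset_eq hD) => //; case: hf.
  apply: (defset_and hD); apply: (defset_fin_forall hD) => i.
    by apply: (defset_le hD) => //; case: (hg i).
  by apply: (defset_eq hD) => //; case: (hh i).
have [s0 Hs0] : exists s : seq 'rV[R]_n, forall z, Z z -> z \in s.
  apply: (isolated_finite hD DZ) => z [Sz fz].
  have [phi [psi [_ _ _ iso]]] :=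
    local_representation hD hf hg hh f_ge0 Sz fz (f_zeros z Sz fz).
  by apply: filterS iso => x Hx [Sx fx]; exact: Hx.
pose s := [seq z <- s0 | `[< Z z >]].
have HsZ z : z \in s <-> Z z.
  by rewrite mem_filter; split=> [/andP[/asboolP]//|Zz]; apply/andP; split;
    [exact/asboolP|exact: Hs0].
have Hr z : exists r, 0 < r /\ (Z z ->
    represents D k g h [set x | `|x - z| < r] f).
  have [[Sz fz]|nZ] := pselect (Z z); last by exists 1; split.
  by have [r r0 Hr] := represents_at_zero hD hf hg hh f_ge0 Sz fz (f_zeros z Sz fz);
    exists r.
have [r /all_and2[r0 Hr']] := choice Hr.
(* The hole of radius r/2 lies inside the support of the cutoff, of radius
   r/sqrt 2, which lies inside the ball of radius r: the cutoffs and the product of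
   the holes have no common zero. *)
pose c z := cutoff k z (r z ^+ 2 / 2).
pose b x := \prod_(z <- s) hole k z (r z ^+ 2 / 4) x.
have sb : smooth_on D k setT b.
  split=> [|x _]; first by apply: (definable_prod hD) => z _; case: (smooth_hole hD k z (r z ^+ 2 / 4)).
  by apply: Ck_near_prod => z _; case: (smooth_hole hD k z (r z ^+ 2 / 4)) => _; exact.
have b_near0 z : Z z -> \forall x \near z, b x = 0.
  move=> /HsZ zs; have r4 : 0 < r z ^+ 2 / 4 by rewrite divr_gt0 // exprn_gt0.
  apply: filterS (near_hole0 k z r4) => x hx.
  by rewrite /b (big_rem z) //= hx mul0r.
have RepB : represents D k g h setT (fun x => b x ^+ 2 * f x).
  have off := representation_off_zeros hD (weaken _ _ hf) (fun i => weaken _ _ (hg i))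
    (fun j => weaken _ _ (hh j)) f_ge0.
  apply: (represents_cutoff hD sb _ _ off).
    move=> q [Dq Cq]; have [Db Cb] := sb; split=> [|x _]; first exact: (definableM hD).
    have [Zx|nZx] := pselect (Z x); last by apply: Ck_nearM; [exact: Cb|exact: Cq].
    apply: Ck_near_ext (Ck_near_cst k 0 x).
    by apply: filterS (b_near0 x Zx) => y ->; rewrite mul0r.
  by move=> x bx Zx; move: bx; rewrite (nbhs_singleton (b_near0 x Zx)) eqxx.
have RepC z : z \in s -> represents D k g h setT (fun x => c z x ^+ 2 * f x).
  move=> /HsZ Zz; apply: (represents_cutoff hD (smooth_cutoff hD k z _) _ _ (Hr' z Zz)).
    by move=> q; exact: smooth_cutoffM.
  move=> x /=; apply: contraNT; rewrite -leNgt => xr.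
  have : r z ^+ 2 / 2 <= dist2 z x.
    rewrite leNgt; apply/negP => xr2; move: xr; rewrite leNgt => /negP; apply.
    apply: dist2_lt_norm => //; apply: lt_le_trans xr2 _.
    by rewrite ler_pdivrMr // ler_peMr ?sqr_ge0 // ler1n.
  by rewrite -subr_le0 => xr2; rewrite /c /cutoff max_l ?expr0n.
pose G x := b x ^+ 2 + \sum_(z <- s) c z x ^+ 2.
have G0 x : 0 < G x.
  have s0' : 0 <= \sum_(z <- s) c z x ^+ 2 by apply: sumr_ge0 => ? _; exact: sqr_ge0.
  have [b0|b0] := eqVneq (b x) 0; last first.
    by apply: ltr_pwDl => //; rewrite exprn_even_gt0.
  apply: ltr_wpDl; first exact: sqr_ge0.
  move/eqP: b0; rewrite prodf_seq_eq0 => /hasP[z zs /= /eqP hz].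
  have r20 : 0 < r z ^+ 2 by rewrite exprn_gt0.
  rewrite (big_rem z) //=; apply: ltr_pwDl; last first.
    by apply: sumr_ge0 => ? _; exact: sqr_ge0.
  rewrite exprn_gt0 // exprn_gt0 // lt_max subr_gt0; apply/orP; right.
  move/eqP: hz; rewrite expf_eq0 /= => /eqP mz.
  have : dist2 z x - r z ^+ 2 / 4 <= 0.
    by rewrite leNgt; apply/negP => hp; move: mz; rewrite max_r ?ltW // => /eqP; rewrite gt_eqF.
  by lra.
have RepG : represents D k g h setT (fun x => G x * f x).
  have := represents_sum hD RepB RepC.
  by under [X in represents _ _ _ _ _ X -> _]funext do rewrite -big_distrl -mulrDl.
have [Db Cb] := sb.
have DG : definable_fun D G.
  apply: (definableD hD); first exact: (definableX hD).
  by apply: (definable_sum hD) => z _; apply: (definableX hD);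
    case: (smooth_cutoff hD k z (r z ^+ 2 / 2)).
have CG x : Ck_near k G x.
  apply: Ck_nearD; first by apply: Ck_nearX; exact: Cb.
  apply: Ck_near_sum => z _; apply: Ck_nearX.
  by case: (smooth_cutoff hD k z (r z ^+ 2 / 2)) => _; exact.
have sV : smooth_on D k setT (fun x => (Num.sqrt (G x))^-1).
  split=> [|x _]; first by apply: (definableV hD); exact: (definable_sqrt hD).
  by apply: Ck_nearV; [rewrite gt_eqF ?sqrtr_gt0|exact: Ck_near_sqrt].
have -> : f = fun x => (Num.sqrt (G x))^-1 ^+ 2 * (G x * f x).
  by apply/funext => x; rewrite exprVn sqr_sqrtr ?mulKf ?gt_eqF // ltW.
by apply: (represents_cutoff hD sV _ _ RepG) => // q; exact: smooth_onM.
Qed.
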